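(* Suppose that the data $(\xi,f,S)$ satisfy the standing assumption stated in the context, and let $(Y^{\lambda},Z^{\lambda})$ be the unique solution of the penalized BSDE $$Y_t^{\lambda}=\xi+\int_t^{T}f_s(Y_s^{\lambda},Z_s^{\lambda})\,ds+\int_t^T\lambda\max\{0,S_s-Y^{\lambda}_s\}\,ds-\int_t^{T}Z_s^{\lambda}\,dW_s,\qquad t\in[0,T].$$ For any integer $i\ge 1$, define the control set $$\mathcal{R}_{T_i}(\lambda)=\left\{\mathbb{G}\text{-stopping times }\tau \text{ with } \tau(\omega)=T_N(\omega)\text{ where } i\le N\le M+1\right\}.$$ Then, conditional on $\{T_{i-1}\le t<T_i\}$ (where $t\in[0,T]$), the value of the optimal stopping time problem $$y_t^{\lambda}=\operatorname*{ess\,sup}_{\tau\in\mathcal{R}_{T_i}(\lambda)}\mathbf{E}\left[\int_t^{\tau\wedge T}f_s(Y_s^{\lambda},Z_s^{\lambda})\,ds+S_{\tau}\mathbf{1}_{\{\tau<T\}}+\xi\mathbf{1}_{\{\tau\ge T\}}\,\Big|\,\mathcal{G}_t\right]$$ is given by the solution of the penalized BSDE: $y_t^{\lambda}=Y_t^{\lambda}$ a.s. The optimal stopping time is $$\tau^*_{T_i}=\inf\{T_N\ge T_i:\ Y^{\lambda}_{T_N}\le S_{T_N}\}\wedge T_{M+1}.$$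
   Context: Fix $T>0$ and $\lambda>0$. $W=(W_t)_{t\ge0}$ is a $d$-dimensional standard Brownian motion on a filtered probability space $(\Omega,\mathcal{F},\mathbb{F}=\{\mathcal{F}_t\}_{t\ge0},\mathbf{P})$ whose filtration $\mathbb{F}$ is right continuous and complete. Standing assumption on $(\xi,f,S)$: (i) the terminal datum $\xi$ ($\mathcal{F}_T$-measurable, real-valued) satisfies $\mathbf{E}[|\xi|^2]<\infty$; (ii) the driver $f:\Omega\times[0,T]\times\mathbb{R}\times\mathbb{R}^d\to\mathbb{R}$ is uniformly Lipschitz: $|f_t(y,z)-f_t(\bar y,\bar z)|\le C(|y-\bar y|+|z-\bar z|)$ a.s. for some $C>0$, with $f_t(0,0)$ $\mathbb{F}$-adapted and $\mathbf{E}[\int_0^T|f_t(0,0)|^2dt]<\infty$; (iii) the obstacle $S$ is a continuous $\mathbb{F}$-adapted real process with $\mathbf{E}[\sup_{t\in[0,T]}|S_t|^2]<\infty$. Under this assumption the penalized BSDE is taken to admit a unique $\mathbb{F}$-adapted square-integrable solution $(Y^\lambda,Z^\lambda)$, with $\mathbf{E}[\sup_{t\in[0,T]}|Y^\lambda_t|^2+\int_0^T|Z^\lambda_t|^2dt]<\infty$. $\{T_n\}_{n\ge0}$ (with $T_0=0$, $T_\infty=\infty$) are the arrival times of a Poisson process with intensity $\lambda$, independent of $\mathbb{F}$, with minimal augmented filtration $\{\mathcal{H}_t\}_{t\ge0}$. Put $\mathcal{G}_t=\mathcal{F}_t\vee\mathcal{H}_t$ and $\mathbb{G}=\{\mathcal{G}_t\}_{t\ge0}$.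 $M<\infty$ is the integer-valued random variable with $T_M\le T<T_{M+1}$, i.e. $M(\omega)=\sum_{n\ge0}n\mathbf{1}_{\{T_n(\omega)\le T<T_{n+1}(\omega)\}}$. In $\tau(\omega)=T_N(\omega)$, $N=N(\omega)$ is an integer-valued random variable. ''Conditional on $\{T_{i-1}\le t<T_i\}$'' means that the problem and the identities are considered on that event (on which $i\le M+1$). $S,Y^\lambda$ are only evaluated at times in $[0,T]$, and $\inf\emptyset=\infty$. *)

(* Defs.v *)
From HB Require Import structures.
From mathcomp Require Import all_boot all_order all_algebra.
From mathcomp Require Import all_classical all_reals all_analysis.
From mathcomp Require Import measurable_realfun.
Import Order.TTheory GRing.Theory Num.Theory.
Import numFieldNormedType.Exports.

Set Implicit Arguments.
Unset Strict Implicit.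
Unset Printing Implicit Defensive.

Local Open Scope classical_set_scope.
Local Open Scope ring_scope.

(* Points of R^d are tuples: these carry the library's product (Borel)
   sigma-algebra. The norm is the Euclidean one. *)
Section Euclidean.
Context {R : realType} {d : nat}.

Definition zero_tuple : d.-tuple R := [tuple of nseq d 0].

Definition sub_tuple (z z' : d.-tuple R) : d.-tuple R :=
  [tuple tnth z j - tnth z' j | j < d].

Definition dot_tuple (z z' : d.-tuple R) : R :=
  \sum_(j < d) tnth z j * tnth z' j.

Definition enorm (z : d.-tuple R) : R := Num.sqrt (dot_tuple z z).

End Euclidean.

(* Sub-sigma-algebras of the ambient one are sets of sets; a filtration is a
   family of them indexed by the reals, of which only times t >= 0 matter. *)
Section Filtrations.
Context {R : realType} {disp : measure_display} {Omega : measurableType disp}.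
Variable P : probability Omega R.

Definition measurable_wrt {d' : measure_display} {E : measurableType d'}
    (G : set (set Omega)) (X : Omega -> E) : Prop :=
  forall B : set E, measurable B -> G (X @^-1` B).

Record usual_filtration (F : R -> set (set Omega)) : Prop := {
  filt_sigma : forall t : R, 0 <= t -> sigma_algebra setT (F t) ;
  filt_sub : forall t : R, 0 <= t -> F t `<=` measurable ;
  filt_mono : forall s t : R, 0 <= s <= t -> F s `<=` F t ;
  filt_right_cont : forall t : R, 0 <= t ->
    \bigcap_(s in [set s : R | t < s]) F s `<=` F t ;
  filt_complete : P.-negligible `<=` F 0
}.

Definition adapted {d' : measure_display} {E : measurableType d'}
    (F : R -> set (set Omega)) (T : R) (X : R -> Omega -> E) : Prop :=
  forall t : R, 0 <= t <= T -> measurable_wrt (F t) (X t).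

Definition jointly_measurable {d' : measure_display} {E : measurableType d'}
    (T : R) (X : R -> Omega -> E) : Prop :=
  measurable_fun (`[0, T]%classic `*` setT)
    (fun p : measurableTypeR R * Omega => X p.1 p.2).

Definition filt_join (F H : R -> set (set Omega)) (t : R) : set (set Omega) :=
  <<s F t `|` H t >>.

Definition filt_infty (F : R -> set (set Omega)) : set (set Omega) :=
  <<s \bigcup_(t in [set t : R | 0 <= t]) F t >>.

Definition independent_sets (F G : set (set Omega)) : Prop :=
  forall A B, F A -> G B -> (P (A `&` B) = P A * P B)%E.

Definition stopping_time (F : R -> set (set Omega)) (tau : Omega -> \bar R) :=
  (forall w, 0 <= tau w)%E /\
  forall t : R, 0 <= t -> F t [set w | (tau w <= t%:E)%E].

End Filtrations.

Section ConditionalExpectation.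
Context {R : realType} {disp : measure_display} {Omega : measurableType disp}.
Variable P : probability Omega R.

Definition is_cond_exp (G : set (set Omega)) (X V : Omega -> R) : Prop :=
  [/\ P.-integrable setT (EFin \o X),
      P.-integrable setT (EFin \o V),
      measurable_wrt G V &
      forall A, G A ->
        (\int[P]_(w in A) (V w)%:E = \int[P]_(w in A) (X w)%:E)%E].

(* A version of E[X | G]; junk value 0 when X is not integrable. *)
Definition cond_exp (G : set (set Omega)) (X : Omega -> R) : Omega -> R :=
  xget (cst 0) [set V | is_cond_exp G X V].

(* y is an essential supremum of the family Phi, all inequalities being
   required on the event A only. *)
Definition is_ess_sup_on (A : set Omega) (Phi : set (Omega -> R))
    (y : Omega -> \bar R) : Prop :=
  [/\ measurable_fun setT y,
      forall V, Phi V -> {ae P, forall w, A w -> ((V w)%:E <= y w)%E} &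
      forall y', measurable_fun setT y' ->
        (forall V, Phi V -> {ae P, forall w, A w -> ((V w)%:E <= y' w)%E}) ->
        {ae P, forall w, A w -> (y w <= y' w)%E}].

End ConditionalExpectation.

Section BrownianMotion.
Context {R : realType} {disp : measure_display} {Omega : measurableType disp}.
Variables (P : probability Omega R) (F : R -> set (set Omega)).
Variables (d : nat) (W : R -> Omega -> d.-tuple R).

(* bm_increments says at once that W_t - W_s is independent of F_s, that its
   coordinates are independent, and that each of them is N(0, t - s);
   normal_prob takes the standard deviation. *)
Record brownian_motion : Prop := {
  bm_adapted : forall t : R, 0 <= t -> measurable_wrt (F t) (W t) ;
  bm_start : {ae P, forall w, W 0 w = zero_tuple} ;
  bm_continuous : forall w (j : 'I_d),
    {within `[0, +oo[, continuous (fun t : R => tnth (W t w) j)} ;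
  bm_increments : forall s t : R, 0 <= s < t ->
    forall (A : set Omega) (B : 'I_d -> set R),
      F s A -> (forall j, measurable (B j)) ->
      (P (A `&` [set w | forall j, B j (tnth (W t w) j - tnth (W s w) j)%R])
       = P A * \prod_(j < d) normal_prob 0 (Num.sqrt (t - s)%R) (B j))%E
}.

(* Simple integrands  sum_k c_k 1_{]t_k, t_{k+1}]}. *)
Record simple_process (T : R) := SimpleProcess {
  sp_size : nat ;
  sp_time : nat -> R ;
  sp_coef : nat -> Omega -> d.-tuple R ;
  sp_time_ge0 : 0 <= sp_time 0%N ;
  sp_time_leT : sp_time sp_size <= T ;
  sp_time_mono : forall k, (k < sp_size)%N -> sp_time k <= sp_time k.+1 ;
  sp_coef_meas : forall k, (k < sp_size)%N ->
    measurable_wrt (F (sp_time k)) (sp_coef k) ;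
  sp_coef_bounded : exists K, forall k w, (k < sp_size)%N ->
    enorm (sp_coef k w) <= K
}.

Definition sp_val (T : R) (H : simple_process T) (s : R) (w : Omega) :
    d.-tuple R :=
  [tuple \sum_(k < sp_size H | sp_time H k < s <= sp_time H k.+1)
           tnth (sp_coef H k w) j | j < d].

Definition sp_integral (T : R) (H : simple_process T) (t : R) (w : Omega) : R :=
  \sum_(k < sp_size H)
    dot_tuple (sp_coef H k w)
      (sub_tuple (W (Num.min t (sp_time H k.+1)) w)
                 (W (Num.min t (sp_time H k)) w)).

(* I is (a continuous version of) the process int_0^t Z_s dW_s on [0, T]:
   the integrals of simple processes converging to Z in L^2(dt x P) converge
   in L^2(P) to I_t for every t. *)
Definition is_ito_integral (T : R) (Z : R -> Omega -> d.-tuple R)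
    (I : R -> Omega -> R) : Prop :=
  [/\ adapted F T I,
      forall w, {within `[0, T], continuous (fun t : R => I t w)} &
      exists H : nat -> simple_process T,
        ((fun n => \int[P]_w \int[lebesgue_measure]_(s in `[0%R, T])
                     (enorm (sub_tuple (sp_val (H n) s w) (Z s w)) ^+ 2)%:E)
           @ \oo --> 0)%E /\
        forall t : R, 0 <= t <= T ->
          ((fun n => \int[P]_w ((sp_integral (H n) t w - I t w) ^+ 2)%:E)
             @ \oo --> 0)%E].

End BrownianMotion.

Section PoissonArrivals.
Context {R : realType} {disp : measure_display} {Omega : measurableType disp}.
Variables (P : probability Omega R) (Tn : nat -> Omega -> R).

(* The number of arrivals in ]0, t], i.e. the n with T_n <= t < T_{n+1};
   at t = T this is the random variable M. *)
Definition arrival_count (t : R) (w : Omega) : nat :=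
  xget 0%N [set n | Tn n w <= t < Tn n.+1 w].

Definition poisson_natural (t : R) : set (set Omega) :=
  <<s [set A | exists (s : R) (B : set nat),
         0 <= s <= t /\ A = arrival_count s @^-1` B] >>.

Definition poisson_augmented (t : R) : set (set Omega) :=
  <<s poisson_natural t `|` P.-negligible >>.

Record poisson_arrivals (lambda : R) : Prop := {
  pa_meas : forall n, measurable_fun setT (Tn n) ;
  pa_start : forall w, Tn 0%N w = 0 ;
  pa_mono : forall n w, Tn n w < Tn n.+1 w ;
  pa_infty : forall w, (fun n => Tn n w) @ \oo --> +oo%R ;
  pa_increments : forall s t : R, 0 <= s < t ->
    forall (A : set Omega) (k : nat), poisson_natural s A ->
      (P (A `&` [set w | arrival_count t w = arrival_count s w + k]%N)
       = P A * (poisson_pmf (lambda * (t - s)) k)%:E)%E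
}.

End PoissonArrivals.

Section PenalizedBSDE.
Context {R : realType} {disp : measure_display} {Omega : measurableType disp}.
Variables (P : probability Omega R) (F : R -> set (set Omega)).
Variables (d : nat) (T : R).
Variables (xi : Omega -> R) (f : R -> Omega -> R -> d.-tuple R -> R).
Variable S : R -> Omega -> R.

Record standing_assumption : Prop := {
  xi_meas : measurable_wrt (F T) xi ;
  xi_L2 : (\int[P]_w (`|xi w| ^+ 2)%:E < +oo)%E ;
  f_meas : measurable_fun
    [set p : measurableTypeR R * Omega * R * d.-tuple R | 0 <= p.1.1.1 <= T]
    (fun p : measurableTypeR R * Omega * R * d.-tuple R =>
       f p.1.1.1 p.1.1.2 p.1.2 p.2) ;
  f_lipschitz : exists2 C : R, 0 < C &
    {ae P, forall w (t y y' : R) (z z' : d.-tuple R), 0 <= t <= T ->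
       `|f t w y z - f t w y' z'|
         <= C * (`|y - y'| + enorm (sub_tuple z z'))} ;
  f0_adapted : adapted F T (fun t w => f t w 0 zero_tuple) ;
  f0_L2 : (\int[P]_w \int[lebesgue_measure]_(t in `[0%R, T])
             (`|f t w 0%R zero_tuple| ^+ 2)%:E < +oo)%E ;
  S_continuous : forall w, {within `[0, T], continuous (fun t : R => S t w)} ;
  S_adapted : adapted F T S ;
  S_L2 : (\int[P]_w ereal_sup [set (`|S t w| ^+ 2)%:E | t in `[0%R, T]]
            < +oo)%E
}.

Variables (W : R -> Omega -> d.-tuple R) (lambda : R).
Variables (Y : R -> Omega -> R) (Z : R -> Omega -> d.-tuple R).

Record penalized_solution : Prop := {
  Y_adapted : adapted F T Y ;
  Y_meas : jointly_measurable T Y ;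
  Y_L2 : (\int[P]_w ereal_sup [set (`|Y t w| ^+ 2)%:E | t in `[0%R, T]]
            < +oo)%E ;
  Z_adapted : adapted F T Z ;
  Z_meas : jointly_measurable T Z ;
  Z_L2 : (\int[P]_w \int[lebesgue_measure]_(t in `[0%R, T])
            (enorm (Z t w) ^+ 2)%:E < +oo)%E ;
  YZ_equation : exists2 I, is_ito_integral P F W T Z I &
    {ae P, forall w (t : R), 0 <= t <= T ->
       Y t w = xi w
         + \int[lebesgue_measure]_(s in `[t, T]) f s w (Y s w) (Z s w)
         + \int[lebesgue_measure]_(s in `[t, T])
             (lambda * Num.max 0 (S s w - Y s w))
         - (I T w - I t w)}
}.

Definition payoff (t : R) (tau : Omega -> \bar R) (w : Omega) : R :=
  \int[lebesgue_measure]_(s in `[t, fine (Order.min (tau w) T%:E)])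
     f s w (Y s w) (Z s w)
  + (if (tau w < T%:E)%E then S (fine (tau w)) w else xi w).

Variable Tn : nat -> Omega -> R.

Definition big_filtration : R -> set (set Omega) :=
  filt_join F (poisson_augmented P Tn).

(* The constraint i <= N <= M + 1 can only be met where i <= M + 1, and is
   imposed there; this contains the event {T_{i-1} <= t < T_i} on which the
   stopping problem is considered, for every t in [0, T]. *)
Definition control_set (i : nat) : set (Omega -> \bar R) :=
  [set tau | stopping_time big_filtration tau /\
     exists2 N : Omega -> nat, measurable_fun setT N &
       forall w, (i <= (arrival_count Tn T w).+1)%N ->
         (i <= N w <= (arrival_count Tn T w).+1)%N /\
         tau w = (Tn (N w) w)%:E].

Definition optimal_time (i : nat) (w : Omega) : \bar R :=
  Order.min
    (ereal_inf [set (Tn N w)%:E | N in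
       [set N | [/\ Tn i w <= Tn N w, Tn N w <= T &
                    Y (Tn N w) w <= S (Tn N w) w]]])
    (Tn (arrival_count Tn T w).+1 w)%:E.

End PenalizedBSDE.

(* Main.v *)
(** Write phi = max(0, S - Y) and let I be the stochastic integral of Z. Pathwise,
    for sigma = min(tau, T) >= t, the equation gives
      payoff(tau) = Y_t - int_t^sigma lambda phi ds + (I_sigma - I_t)
                    + (S_tau - Y_tau) 1_{tau < T}.
    Integrated over an event of G_t the martingale part vanishes. For tau one of
    the T_N with N >= i, (S_tau - Y_tau) 1_{tau < T} is at most the value of phi at
    one jump of the Poisson process in ]t, sigma], whose mean is at most that of the
    compensator int_t^sigma lambda phi ds; so the payoff has mean at most Y_t.
    For tau* equality holds: phi vanishes at all jumps in ]t, tau*[, and S_tau* -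
    Y_tau* = phi at tau*. Both comparisons with the compensator are made on a grid:
    a jump of the Poisson process in a cell, independent of F_infty and of the past,
    has probability 1 - exp(- lambda mesh), and phi is replaced on the cell by its
    supremum, respectively its infimum. *)
Require Import Defs.
From HB Require Import structures.
From mathcomp Require Import all_boot all_order all_algebra.
From mathcomp Require Import all_classical all_reals all_analysis.
From mathcomp Require Import measurable_realfun ring lra.
Import Order.TTheory GRing.Theory Num.Theory.
Import numFieldNormedType.Exports.

Set Implicit Arguments.
Unset Strict Implicit.
Unset Printing Implicit Defensive.

Local Open Scope classical_set_scope.
Local Open Scope ring_scope.

(** The obstacle is that [Y] is merely adapted and solves the equation almost surely, whereas
    stopped values, cell suprema and Riemann sums call for paths continuous at every outcome.
    Completeness of [F] supplies a version [Yc], zero off an almost sure event of [F 0]; one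
    integrable [K] dominates [Yc], [S] and, almost surely, [I], and the limits along the grid are
    taken under multiples of it. Conditional expectations appear only at the end: an inequality
    between [G t]-measurable variables is tested by means over events of [G t], so the core of the
    argument concerns real numbers. A cell supremum looks into the future of [F]; this is why a jump
    must be independent of [F_infty] and of the Poisson past jointly. That is proved on rectangles
    and extended by Dynkin's argument, which also makes [I] a martingale for [G]. The infimum serves
    for the optimal time because a cell with a jump at which [phi] vanishes has infimum zero,
    however many jumps it holds. With x = lambda mesh, the two comparisons rest on (1 - x) x <= 1 -
    exp(-x) <= x and meet as the mesh tends to 0. *)

(** * Means of integrable variables and their set-function properties *)

Section Mean.
Context {R : realType} {disp : measure_display} {Omega : measurableType disp}.
Variable P : probability Omega R.
Implicit Types (X Y K : Omega -> R) (D : set Omega).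

Definition mean (X : Omega -> R) : R := \int[P]_w X w.

Definition integr (X : Omega -> R) : Prop := P.-integrable setT (EFin \o X).

Lemma integr_meas X : integr X -> measurable_fun setT X.
Proof. by move=> /measurable_int/measurable_EFinP. Qed.

Lemma integr_le X Y : measurable_fun setT X -> integr Y ->
  (forall w, `|X w| <= `|Y w|) -> integr X.
Proof.
move=> mX iY XY; apply: (le_integrable measurableT _ _ iY).
  exact/measurable_EFinP.
by move=> w _ /=; rewrite lee_fin.
Qed.

Lemma integr_cst c : integr (cst c).
Proof. by apply: finite_measure_integrable_cst. Qed.

Lemma integrD X Y : integr X -> integr Y -> integr (fun w => X w + Y w).
Proof.
by move=> iX iY; apply: eq_integrable (integrableD measurableT iX iY).
Qed.

Lemma integrZl c X : integr X -> integr (fun w => c * X w).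
Proof.
by move=> iX; apply: eq_integrable (integrableZl measurableT c iX).
Qed.

Lemma integrN X : integr X -> integr (fun w => - X w).
Proof.
by move=> iX; exact: (integrableN iX).
Qed.

Lemma integrB X Y : integr X -> integr Y -> integr (fun w => X w - Y w).
Proof. by move=> iX iY; apply: integrD => //; exact: integrN. Qed.

Lemma integr_norm X : integr X -> integr (fun w => `|X w|).
Proof.
move=> iX; apply: (integr_le _ iX) => [|w]; last by rewrite normr_id.
by apply: measurableT_comp => //; exact: integr_meas.
Qed.

Lemma integr_indicM D X : measurable D -> integr X ->
  integr (fun w => \1_D w * X w).
Proof.
move=> mD iX; apply: (integr_le _ iX) => [|w].
  by apply: measurable_funM => //; exact: integr_meas.
by rewrite normrM indicE; case: (_ \in _); rewrite ?normr1 ?mul1r ?normr0 ?mul0r.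
Qed.

Lemma integr_bigsum (I : Type) (r : seq I) (X : I -> Omega -> R) :
  (forall i, integr (X i)) -> integr (fun w => \sum_(i <- r) X i w).
Proof.
move=> h; elim: r => [|i r IH].
  by under eq_fun do rewrite big_nil; exact: integr_cst.
by under eq_fun do rewrite big_cons; exact: integrD.
Qed.

Lemma meanD X Y : integr X -> integr Y ->
  mean (fun w => X w + Y w) = mean X + mean Y.
Proof. by move=> iX iY; rewrite /mean RintegralD. Qed.

Lemma meanB X Y : integr X -> integr Y ->
  mean (fun w => X w - Y w) = mean X - mean Y.
Proof. by move=> iX iY; rewrite /mean RintegralB. Qed.

Lemma meanZl c X : integr X -> mean (fun w => c * X w) = c * mean X.
Proof. by move=> iX; rewrite /mean RintegralZl. Qed.

Lemma mean_cst c : mean (cst c) = c.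
Proof.
by rewrite /mean Rintegral_cst// [X in fine X](probability_setT P) mulr1.
Qed.

Lemma mean_bigsum (I : Type) (r : seq I) (X : I -> Omega -> R) :
  (forall i, integr (X i)) ->
  mean (fun w => \sum_(i <- r) X i w) = \sum_(i <- r) mean (X i).
Proof.
move=> h; elim: r => [|i r IH].
  by under eq_fun do rewrite big_nil; rewrite big_nil (mean_cst 0).
under eq_fun do rewrite big_cons; rewrite big_cons meanD ?IH//.
exact: integr_bigsum.
Qed.

Lemma mean_ge0 X : (forall w, 0 <= X w) -> 0 <= mean X.
Proof. by move=> h; exact: Rintegral_ge0. Qed.

Lemma eq_mean_ae X Y : measurable_fun setT X -> measurable_fun setT Y ->
  {ae P, forall w, X w = Y w} -> mean X = mean Y.
Proof.
move=> mX mY XY; rewrite /mean /Rintegral; congr fine.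
apply: ae_eq_integral => //; [exact/measurable_EFinP|exact/measurable_EFinP|].
by apply: filterS XY => w /= -> _.
Qed.

Lemma le_mean X Y : integr X -> integr Y -> (forall w, X w <= Y w) ->
  mean X <= mean Y.
Proof. by move=> iX iY XY; apply: le_Rintegral. Qed.

Lemma le_mean_ae X Y : integr X -> integr Y -> {ae P, forall w, X w <= Y w} ->
  mean X <= mean Y.
Proof.
move=> iX iY XY.
have mX := integr_meas iX; have mY := integr_meas iY.
(* Pointwise monotonicity applies to the maximum, which equals [Y] almost everywhere and is
   integrable by the bound |X| + |Y|. *)
pose Y' w := Num.max (X w) (Y w).
have mY' : measurable_fun setT Y' by exact: measurable_maxr.
rewrite (@eq_mean_ae Y Y')//; last first.
  by apply: filterS XY => w XYw; rewrite /Y'; symmetry; apply/max_idPr.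
apply: le_mean => //; last by move=> w; rewrite le_max lexx.
apply: (integr_le mY' (integrD (integr_norm iX) (integr_norm iY))) => w.
rewrite [leRHS]ger0_norm ?addr_ge0// /Y'.
have := normr_ge0 (X w); have := normr_ge0 (Y w); case: (leP (X w) (Y w)) => _; lra.
Qed.

Lemma integrE X : integr X ->
  (\int[P]_w (X w)%:E = (mean X)%:E)%E.
Proof.
by move=> iX; rewrite /mean /Rintegral fineK//; exact: integrable_fin_num.
Qed.

Lemma integral_indicM D X : measurable D -> integr X ->
  (\int[P]_(w in D) (X w)%:E = (mean (fun w => \1_D w * X w))%:E)%E.
Proof.
move=> mD iX; rewrite -integrE; last exact: integr_indicM.
rewrite integral_mkcond; apply: eq_integral => w _.
rewrite patchE indicE; case: (_ \in _); by rewrite ?mul1r ?mul0r.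
Qed.

Lemma mean_indic D : measurable D -> (mean \1_D)%:E = P D.
Proof.
move=> mD; rewrite -integrE; first by rewrite integral_indic ?setIT.
apply: (@integr_le _ (cst 1)); first exact: measurable_indic.
  exact: integr_cst.
by move=> w; rewrite normr1 indicE; case: (_ \in _); rewrite ?normr1 ?normr0.
Qed.

Lemma mean_dct (X_ : nat -> Omega -> R) X K :
  (forall n, measurable_fun setT (X_ n)) -> measurable_fun setT X ->
  {ae P, forall w, X_ ^~ w @ \oo --> X w} -> integr K ->
  {ae P, forall w n, `|X_ n w| <= K w} ->
  integr X /\ (fun n => mean (X_ n)) @ \oo --> mean X.
Proof.
move=> mX_ mX cX iK XK.
have [] := @dominated_convergence _ _ _ P setT measurableT
  (fun n w => (X_ n w)%:E) (EFin \o X) (EFin \o K).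
- by move=> n; exact/measurable_EFinP.
- exact/measurable_EFinP.
- by apply: filterS cX => w cw _ /=; apply/cvg_EFin => //; exact: nearW.
- exact: iK.
- by apply: filterS XK => w h n _ /=; rewrite lee_fin.
move=> iX _ cv; split => //.
by apply: fine_cvg; rewrite fineK//; exact: integrable_fin_num.
Qed.

(** The preimages under [X] and [Y] differ only inside the null set where the functions disagree,
    and completeness makes every subset of it measurable. *)
Lemma ae_measurable X Y : P.-negligible `<=` measurable ->
  measurable_fun setT X -> {ae P, forall w, X w = Y w} ->
  measurable_fun setT (Y : Omega -> R).
Proof.
move=> cP mX XY _ B mB; rewrite setTI.
have mN : measurable [set w | X w <> Y w] by apply: cP.
have -> : Y @^-1` B = (X @^-1` B `&` ~` [set w | X w <> Y w]) `|`
    (Y @^-1` B `&` [set w | X w <> Y w]).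
  apply/seteqP; split=> w /=.
    have [e|e] := pselect (X w = Y w); last by right.
    by left; split; [rewrite e|].
  by case=> [[] + /contrapT <-|[]].
apply: measurableU.
  apply: measurableI; last exact: measurableC.
  by rewrite -[_ @^-1` _]setTI; exact: mX.
apply: cP; apply: (@negligibleS _ _ _ _ [set w | X w <> Y w]); last exact: XY.
by move=> w [].
Qed.

Lemma integr_ae X Y : P.-negligible `<=` measurable -> integr X ->
  {ae P, forall w, X w = Y w} -> integr Y.
Proof.
move=> cP iX XY.
have mY := ae_measurable cP (integr_meas iX) XY.
(* Dominated convergence along the constant sequence [X] yields integrability of its almost
   everywhere limit [Y]. *)
have cXY : {ae P, forall w, (fun _ : nat => X w) @ \oo --> Y w}.
  by apply: filterS XY => w ->; exact: cvg_cst.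
have bXY : {ae P, forall w (n : nat), `|X w| <= `|X w|} by exact: aeW.
by have [] := mean_dct (fun=> integr_meas iX) mY cXY (integr_norm iX) bXY.
Qed.

(** Countable additivity of the signed set function D to E[1_D X], by dominated convergence under
    |X|. It supplies the disjoint-union axiom of the Dynkin system below. *)
Lemma mean_setUN (F : (set Omega)^nat) X : (forall n, measurable (F n)) ->
  trivIset setT F -> integr X ->
  (fun n => \sum_(k < n) mean (fun w => \1_(F k) w * X w)) @ \oo -->
    mean (fun w => \1_(\bigcup_k F k) w * X w).
Proof.
move=> mF tF iX.
have mU : measurable (\bigcup_k F k) by exact: bigcupT_measurable.
pose X_ n w := \sum_(k < n) \1_(F k) w * X w.
have X_E n w : X_ n w = \1_(\big[setU/set0]_(k < n) F k) w * X w.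
  rewrite /X_ -mulr_suml; congr (_ * _).
  rewrite !indicE; elim: n => [|n IH]; first by rewrite !big_ord0 in_set0.
  rewrite !big_ord_recr /= IH in_setU.
  have [wA|wA] := boolP (w \in \big[setU/set0]_(i < n) F i); last first.
    by rewrite add0r indicE.
  have : w \notin F n; last by rewrite indicE => /negbTE -> /=; rewrite addr0.
  apply/negP => wFn; move: wA; rewrite inE -bigcup_mkord => -[k /= kn Fk].
  move/trivIsetP : tF => /(_ k n I I); rewrite neq_ltn kn => /(_ isT).
  by apply/eqP/set0P; exists w; split=> //; exact: set_mem.
have [] := @mean_dct X_ (fun w => \1_(\bigcup_k F k) w * X w) (fun w => `|X w|).
- move=> n; apply: measurable_sum => k.
  by apply: measurable_funM => //; exact: integr_meas.
- by apply: measurable_funM => //; exact: integr_meas.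
- apply: aeW => w.
  have [wU|wU] := boolP (w \in \bigcup_k F k); last first.
    rewrite indicE (negbTE wU) mul0r.
    rewrite (_ : X_ ^~ w = cst 0); first exact: cvg_cst.
    apply/funext => n; rewrite X_E indicE.
    case: (boolP (_ \in _)) => [|_]; last by rewrite mul0r.
    rewrite inE -bigcup_mkord => -[k _ Fk].
    by move/negP : wU; rewrite inE; case; exists k.
  move: (wU); rewrite inE => -[k _ Fk].
  apply: cvg_near_cst; exists k.+1 => // n /= kn.
  rewrite X_E !indicE wU mem_set// -bigcup_mkord.
  by exists k.
- exact: integr_norm.
- apply: aeW => w n; rewrite X_E normrM indicE.
  by case: (_ \in _); rewrite ?normr1 ?mul1r// normr0 mul0r.
move=> _ cX; rewrite (_ : (fun n => \sum_(k < n) _) = (fun n => mean (X_ n)))//.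
apply/funext => n; rewrite (mean_bigsum _ (X := fun (k : 'I_n) w => \1_(F k) w * X w))// => k.
exact: integr_indicM.
Qed.

(** Dynkin's argument for the signed measures X1 dP and X2 dP: the events on which they agree form a
    lambda-system. Equality of total masses, which handles complements, comes from [C setT]. *)
Lemma mean_pi_lambda (C : set (set Omega)) X1 X2 : integr X1 -> integr X2 ->
  setI_closed C -> C setT -> C `<=` measurable ->
  (forall D, C D ->
    mean (fun w => \1_D w * X1 w) = mean (fun w => \1_D w * X2 w)) ->
  forall D, <<s C >> D ->
    mean (fun w => \1_D w * X1 w) = mean (fun w => \1_D w * X2 w).
Proof.
move=> iX1 iX2 CI CT Cm CX D CD.
have T1 X : (fun w => \1_(@setT Omega) w * X w) = X.
  by apply/funext => w; rewrite indicT mul1r.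
pose H := [set D | measurable D /\
  mean (fun w => \1_D w * X1 w) = mean (fun w => \1_D w * X2 w)].
suff: <<s C >> `<=` H by move=> /(_ _ CD) [].
apply: lambda_system_subset => //; last by move=> B CB; split; [exact: Cm|exact: CX].
apply/dynkin_lambda_system; split.
- by split=> //; exact: CX.
- move=> B [mB eB]; split; first exact: measurableC.
  have Ec X : integr X -> mean (fun w => \1_(~` B) w * X w) =
      mean X - mean (fun w => \1_B w * X w).
    move=> iX; rewrite -meanB//; last exact: integr_indicM.
    congr mean; apply/funext => w; rewrite !indicE in_setC.
    by case: (_ \in _); rewrite ?mul0r ?mul1r ?subrr ?subr0.
  by rewrite !Ec// eB; have := CX _ CT; rewrite !T1 => ->.
- move=> F tF mF; split; first by apply: bigcupT_measurable => n; have [] := mF n.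
  have mF' n : measurable (F n) by have [] := mF n.
  have h1 := mean_setUN mF' tF iX1; have h2 := mean_setUN mF' tF iX2.
  apply: (cvg_unique _ h1) => //=.
  rewrite (_ : (fun n : nat => \sum_(k < n) _) =
    (fun n => \sum_(k < n) mean (fun w => \1_(F k) w * X2 w)))//.
  by apply/funext => n; apply: eq_bigr => k _; have [] := mF k.
Qed.

End Mean.

(** * Sub-sigma-algebras: pulling out factors and conditional expectation *)

Section SubSigmaAlgebra.
Context {R : realType} {disp : measure_display} {Omega : measurableType disp}.
Variable P : probability Omega R.
Implicit Types (X Y K V : Omega -> R) (D : set Omega).

(** [measurable_wrt] speaks of a bare set of sets; the closure rules of [measurable_fun] become
    available once [Omega] carries [G] through [g_sigma_algebraType]. *)
Lemma measurable_wrtE (G : set (set Omega)) X : sigma_algebra setT G ->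
  measurable_wrt G X <->
  measurable_fun setT (X : g_sigma_algebraType G -> R).
Proof.
move=> sG; split=> [h _ B mB|h B mB].
  by rewrite setTI measurable_g_measurableTypeE//; exact: h.
by have := h measurableT B mB; rewrite setTI measurable_g_measurableTypeE.
Qed.

Lemma sigma_algebraT (H : set (set Omega)) : sigma_algebra setT H -> H setT.
Proof. by case=> H0 HD _; rewrite -(setD0 setT); exact: HD. Qed.

Lemma sigma_algebraI (H : set (set Omega)) : sigma_algebra setT H -> setI_closed H.
Proof.
move=> sH A B HA HB; rewrite -(measurable_g_measurableTypeE sH).
by apply: measurableI; rewrite measurable_g_measurableTypeE.
Qed.

Lemma measurable_wrt_sub (G H : set (set Omega)) X : G `<=` H ->
  measurable_wrt G X -> measurable_wrt H X.
Proof. by move=> GH h B mB; apply: GH; exact: h. Qed.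

Lemma measurable_wrt_measurable (G : set (set Omega)) X : G `<=` measurable ->
  measurable_wrt G X -> measurable_fun setT X.
Proof. by move=> Gm h _ B mB; rewrite setTI; apply: Gm; exact: h. Qed.

Import HBNNSimple.

(** Approximating [X] from below by simple functions reduces the mean to means over level sets in
    [G], all zero by hypothesis. The domination is by |X V|, so [X] may be unbounded. *)
Let mean_pullout_ge0 (G : set (set Omega)) X V : sigma_algebra setT G ->
  G `<=` measurable -> measurable_wrt G X -> (forall w, 0 <= X w) ->
  integr P V -> integr P (fun w => X w * V w) ->
  (forall D, G D -> mean P (fun w => \1_D w * V w) = 0) ->
  mean P (fun w => X w * V w) = 0.
Proof.
move=> sG Gm mX X0 iV iXV V0.
have mX' : measurable_fun setT (EFin \o (X : g_sigma_algebraType G -> R)).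
  by apply/measurable_EFinP; exact/measurable_wrtE.
have mT : measurable (@setT (g_sigma_algebraType G)) by [].
(* The approximation takes place on [Omega] equipped with [G], so the level sets are events of [G]
   and not merely measurable. *)
pose X_ n : Omega -> R := nnsfun_approx mT mX' n.
have cX w : X_ ^~ w @ \oo --> X w.
  by have /(_ (fun x _ => X0 x) I)/fine_cvgP[] :=
    @cvg_nnsfun_approx _ _ _ _ mT _ mX' _ w.
have ndX w : nondecreasing_seq (X_ ^~ w).
  by move=> m n mn; exact/lefP/(nd_nnsfun_approx mT mX' mn).
have X_le n w : X_ n w <= X w.
  rewrite -(cvg_lim _ (cX w))//; apply: nondecreasing_cvgn_le => //.
  by apply/cvg_ex; exists (X w).
have X_ge0 n w : 0 <= X_ n w by exact: fun_ge0.
have mX_ n : measurable_wrt G (X_ n) by apply/measurable_wrtE.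
have X_V n : integr P (fun w => X_ n w * V w) /\
    mean P (fun w => X_ n w * V w) = 0.
  have -> : (fun w => X_ n w * V w) = (fun w =>
      (\sum_(y <- finmap.enum_fset (fset_set (range (X_ n)))) y * \1_(X_ n @^-1` [set y]) w) * V w).
    apply/funext => w; congr (_ * _).
    by rewrite {1}/X_ fimfunE fsbig_finite.
  elim: (finmap.enum_fset (fset_set (range (X_ n)))) => [|y s [iS mS]].
    under eq_fun do rewrite big_nil mul0r.
    by split; [exact: integr_cst|exact: mean_cst].
  have GX : G (X_ n @^-1` [set y]) by exact: mX_.
  have e w : (\sum_(z <- y :: s) z * \1_(X_ n @^-1` [set z]) w) * V w =
      y * (\1_(X_ n @^-1` [set y]) w * V w) +
      (\sum_(z <- s) z * \1_(X_ n @^-1` [set z]) w) * V w.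
    by rewrite big_cons mulrDl mulrA.
  have i1 : integr P (fun w => \1_(X_ n @^-1` [set y]) w * V w).
    by apply: integr_indicM => //; exact: Gm.
  under eq_fun do rewrite e; split; first by apply: integrD => //; exact: integrZl.
  by rewrite meanD//; [rewrite mS meanZl// V0// mulr0 addr0|exact: integrZl].
have [] := @mean_dct _ _ _ P (fun n w => X_ n w * V w) (fun w => X w * V w)
  (fun w => `|X w * V w|).
- by move=> n; exact: integr_meas (X_V n).1.
- exact: integr_meas iXV.
- by apply: aeW => w; apply: cvgM; [exact: cX|exact: cvg_cst].
- exact: integr_norm.
- apply: aeW => w n; rewrite !normrM ler_wpM2r// ger0_norm//.
  by rewrite ger0_norm.
move=> _; under eq_fun => n do rewrite (X_V n).2.
by move=> /(cvg_unique _ (@cvg_cst _ 0 _ _ _)) => /(_ _)/esym; apply.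
Qed.

(** If [V] has conditional mean zero given [G], it is orthogonal to every [G]-measurable factor.
    Independence is exploited later in this form, with a centred indicator as [V]. *)
Lemma mean_pullout (G : set (set Omega)) X V : sigma_algebra setT G ->
  G `<=` measurable -> measurable_wrt G X ->
  integr P V -> integr P (fun w => X w * V w) ->
  (forall D, G D -> mean P (fun w => \1_D w * V w) = 0) ->
  mean P (fun w => X w * V w) = 0.
Proof.
move=> sG Gm mX iV iXV V0.
have mXO := measurable_wrt_measurable Gm mX.
(* [s = 1] gives the positive part of [X] and [s = -1] the negative part, so both are treated at
   once. *)
have mpos (s : R) : measurable_wrt G (fun w => Num.max (s * X w) 0).
  apply/measurable_wrtE => //; apply: measurable_maxr => //.
  by apply: measurable_funM => //; exact/measurable_wrtE.
have ipos (s : R) : `|s| = 1 -> integr P (fun w => Num.max (s * X w) 0 * V w).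
  move=> s1; apply: (@integr_le _ _ _ _ _ (fun w => X w * V w)) => //.
    apply: measurable_funM; last exact: integr_meas iV.
    exact: measurable_wrt_measurable (mpos s).
  move=> w; rewrite !normrM ler_wpM2r//.
  rewrite -[leRHS]mul1r -s1 -normrM; case: (leP (s * X w) 0) => // _.
  by rewrite normr0.
have e w : X w * V w = Num.max (1 * X w) 0 * V w - Num.max (-1 * X w) 0 * V w.
  rewrite mul1r mulN1r; have [x0|/ltW x0] := leP 0 (X w).
    by rewrite max_r ?oppr_le0// mul0r subr0.
  by rewrite max_l ?oppr_ge0// mul0r sub0r mulNr opprK.
have n1 : `|1 : R| = 1 by rewrite normr1.
have nN1 : `|-1 : R| = 1 by rewrite normrN1.
under eq_fun do rewrite e; rewrite meanB; [|exact: ipos..].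
have h s : `|s| = 1 -> mean P (fun w => Num.max (s * X w) 0 * V w) = 0.
  move=> s1; apply: (@mean_pullout_ge0 G) => //; last exact: ipos.
  by move=> w; rewrite le_max lexx orbT.
by rewrite !h// subrr.
Qed.

Lemma measurable_id_sub (G : set (set Omega)) : sigma_algebra setT G ->
  G `<=` measurable ->
  measurable_fun setT (id : Omega -> g_sigma_algebraType G).
Proof.
move=> sG Gm _ B; rewrite measurable_g_measurableTypeE// => GB.
by rewrite setTI; exact: Gm.
Qed.

(** Radon-Nikodym on the coarser space: the charge X dP and [P] are both pushed forward by the
    identity from [Omega] to [Omega] with sigma-algebra [G], and [V] is the density of the first
    with respect to the second. *)
Lemma cond_exp_exists (G : set (set Omega)) X : sigma_algebra setT G ->
  G `<=` measurable -> integr P X -> exists V, is_cond_exp P G X V.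
Proof.
move=> sG Gm iX.
have mid := measurable_id_sub sG Gm.
pose idG : {mfun Omega >-> g_sigma_algebraType G} :=
  HB.pack (id : Omega -> g_sigma_algebraType G) (isMeasurableFun.Build _ _ _ _ _ mid).
pose mu := distribution P idG.
pose nu : {charge set (g_sigma_algebraType G) -> \bar R} :=
  measure_function_pushforward__canonical__charge_Charge (induced_charge iX) mid.
have dom : nu `<< mu.
  apply: dominates_pushforward => //; apply/null_content_dominatesP => A mA PA.
  apply: null_set_integral => //.
  by apply: measurable_funTS; exact: measurable_int iX.
pose V := Radon_Nikodym nu mu.
have fV x := Radon_Nikodym_fin_num x dom.
have iV : mu.-integrable setT V := Radon_Nikodym_integrable dom.
have VE : EFin \o (fine \o V) = V by apply/funext => w /=; rewrite fineK.
have mV : measurable_fun setT V := measurable_int mu iV.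
have iVP : P.-integrable setT V.
  have := iV; rewrite /mu => /integrableP[_ h].
  apply/integrableP; split; first by apply: measurableT_comp mV mid.
  move: h; rewrite ge0_integral_distribution//; exact: measurableT_comp.
exists (fine \o V); split=> //.
- by rewrite VE.
- apply/measurable_wrtE => //.
  by apply/measurable_EFinP; rewrite VE.
move=> A GA.
have mA : measurable (A : set (g_sigma_algebraType G)).
  by rewrite measurable_g_measurableTypeE.
have -> : (\int[P]_(w in A) (X w)%:E = \int[mu]_(w in A) V w)%E.
  exact: Radon_Nikodym_integral dom mA.
rewrite /mu /distribution integral_pushforward//.
  by apply: eq_integral => w _ /=; rewrite fineK.
by apply: (integrableS measurableT) => //; exact: Gm.
Qed.

Lemma cond_expP (G : set (set Omega)) X : sigma_algebra setT G ->
  G `<=` measurable -> integr P X -> is_cond_exp P G X (cond_exp P G X).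
Proof.
move=> sG Gm iX; rewrite /cond_exp; case: xgetP => [V -> //|h].
by have [V /h] := cond_exp_exists sG Gm iX.
Qed.

(** Tested on the part of [D0] where Y < V, the hypothesis makes the nonnegative variable 1_D (V -
    Y) have nonpositive mean, hence vanish almost surely. Conditional expectations are compared only
    through this lemma. *)
Lemma ae_le_of_mean (G : set (set Omega)) V Y D0 : sigma_algebra setT G ->
  G `<=` measurable -> G D0 -> measurable_wrt G V -> measurable_wrt G Y ->
  integr P V -> integr P Y ->
  (forall D, G D -> D `<=` D0 ->
    mean P (fun w => \1_D w * V w) <= mean P (fun w => \1_D w * Y w)) ->
  {ae P, forall w, D0 w -> V w <= Y w}.
Proof.
move=> sG Gm GD0 mV mY iV iY VY.
have mG (A : set Omega) : G A -> measurable (A : set (g_sigma_algebraType G)).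
  by rewrite measurable_g_measurableTypeE.
pose D := D0 `&` [set w | Y w < V w].
have GD : G D.
  rewrite -(measurable_g_measurableTypeE sG); apply: measurableI; first exact: mG.
  rewrite -[X in measurable X]setTI.
  have -> : [set w | Y w < V w] = (fun w => V w - Y w) @^-1` `]0, +oo[.
    by apply/seteqP; split=> w /=; rewrite in_itv /= andbT subr_gt0.
  by apply: measurable_funB => //; exact/measurable_wrtE.
have mD := Gm _ GD.
pose Z w := \1_D w * (V w - Y w).
have iZ : integr P Z by apply: integr_indicM => //; exact: integrB.
have Z0 w : 0 <= Z w.
  rewrite /Z indicE; have [|_] := boolP (w \in D); last by rewrite mul0r.
  by move=> /set_mem[_ /= /ltW]; rewrite mul1r subr_ge0.
have mZ : mean P Z <= 0.
  have -> : mean P Z = mean P (fun w => \1_D w * V w - \1_D w * Y w).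
    by congr mean; apply/funext => w; rewrite /Z mulrBr.
  by rewrite meanB ?subr_le0; [apply: VY => // w []|exact: integr_indicM..].
have Zae : ae_eq P setT (EFin \o Z) (cst 0%E).
  apply/ae_eq_integral_abs => //; first exact: measurable_int iZ.
  have mZ0 : mean P Z = 0 by apply/eqP; rewrite eq_le mZ mean_ge0.
  transitivity (\int[P]_w (Z w)%:E)%E; last by rewrite integrE// mZ0.
  by apply: eq_integral => w _ /=; rewrite ger0_norm.
apply: filterS Zae => w /= /(_ I) [Zw] D0w.
rewrite leNgt; apply/negP => YV.
move: Zw; rewrite /Z indicE mem_set// mul1r => /eqP.
by rewrite subr_eq0 gt_eqF.
Qed.

End SubSigmaAlgebra.

(** * Continuous functions on uniform grids, stopped at a point *)

Section DeterministicGrid.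
Context {R : realType}.
Implicit Types (f : R -> R) (a b t T x y e : R).

Lemma within_itv_cont a b f : {within `[a, b], continuous f} ->
  forall x e, a <= x <= b -> 0 < e ->
  exists2 dl : R, 0 < dl &
    forall y, a <= y <= b -> `|x - y| < dl -> `|f x - f y| < e.
Proof.
move=> cf x e xab e0.
have xI : `[a, b]%classic x by rewrite /= in_itv.
have /cvgrPdist_lt /(_ e e0) h := cf x.
have : nbhs_subspace (x : subspace `[a, b]) [set y | `|f x - f y| < e] by exact: h.
rewrite -nbhs_subspace_in//.
move=> {h} /nbhs_ballP[dl /= dl0 h]; exists dl => // y yab xy.
by apply: (h y); rewrite /ball //= in_itv.
Qed.

(** Heine's theorem by compactness in its near-covering form, with the modulus [dl] as the parameter
    tending to zero. *)
Lemma within_itv_unif_cont a b f : {within `[a, b], continuous f} ->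
  forall e, 0 < e -> exists2 dl : R, 0 < dl &
    forall x y, a <= x <= b -> a <= y <= b -> `|x - y| < dl -> `|f x - f y| < e.
Proof.
move=> cf e e0.
pose Q (dl : R) x := a <= x <= b -> forall y, a <= y <= b ->
  `|x - y| < dl -> `|f x - f y| < e.
have /compact_near_coveringP cpt := @segment_compact R a b.
have := cpt R (nbhs (0 : R)) (fun dl x => Q dl x) _.
have h : forall x, `[a, b]%classic x ->
    \forall x' \near x & i \near (0:R), Q i x'.
  move=> x; rewrite /= in_itv /= => xab.
  have e2 : 0 < e / 2 by rewrite divr_gt0.
  have [dl dl0 H] := within_itv_cont cf xab e2.
  exists (ball x (dl / 2), ball (0 : R) (dl / 2)) => /=.
    by split; apply: nbhsx_ballx; rewrite divr_gt0.
  move=> [x' i] /= [bx bi] x'ab y yab x'y.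
  have xx' : `|x - x'| < dl by rewrite (lt_trans bx)// ltr_pdivrMr// ltr_pMr// ltr1n.
  have xy : `|x - y| < dl.
    move: bx bi; rewrite /ball /= sub0r normrN => bx bi.
    rewrite -(subrKA x') (le_lt_trans (ler_normD _ _))// [ltRHS](splitr dl) ltrD//.
    by rewrite (lt_trans x'y)// (le_lt_trans (ler_norm _)).
  rewrite -(subrKA (f x)) (le_lt_trans (ler_normD _ _))// [ltRHS](splitr e) ltrD//.
    by rewrite distrC; exact: H.
  exact: H.
move=> /(_ _ h) /nbhs_ballP[dl /= dl0 H]; exists (dl / 2); first by rewrite divr_gt0.
move=> x y xab yab xy.
apply: (H (dl / 2) _ x _ xab y yab xy) => /=; last by rewrite in_itv.
rewrite /ball /= sub0r normrN gtr0_norm ?divr_gt0//.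
by rewrite ltr_pdivrMr// ltr_pMr// ltr1n.
Qed.

(** The index [n] stands for [n.+1] cells, so the mesh is defined from [n = 0] on. *)
Definition grid (t T : R) (n k : nat) : R := t + k%:R * ((T - t) / n.+1%:R).

Lemma grid0 t T n : grid t T n 0 = t.
Proof. by rewrite /grid mul0r addr0. Qed.

Lemma gridS t T n : grid t T n n.+1 = T.
Proof. by rewrite /grid mulrC divfK// subrKC. Qed.

Lemma grid_mono t T n k l : t <= T -> (k <= l)%N -> grid t T n k <= grid t T n l.
Proof.
by move=> tT kl; rewrite /grid lerD2l ler_wpM2r ?ler_nat// divr_ge0// subr_ge0.
Qed.

Lemma grid_bounds t T n k : t <= T -> (k <= n.+1)%N -> t <= grid t T n k <= T.
Proof.
move=> tT kn; have := grid_mono n tT kn; rewrite gridS => ->.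
by have := grid_mono n tT (leq0n k); rewrite grid0 => ->.
Qed.

Lemma gridSB t T n k : grid t T n k.+1 - grid t T n k = (T - t) / n.+1%:R.
Proof. by rewrite /grid opprD addrACA subrr add0r -mulrBl -natrB// subSnn mul1r. Qed.

Lemma grid_telescope t T n f :
  \sum_(k < n.+1) (f (grid t T n k.+1) - f (grid t T n k)) = f T - f t.
Proof.
rewrite -(big_mkord xpredT
  (fun k => f (grid t T n k.+1) - f (grid t T n k))).
by rewrite (telescope_sumr (fun k => f (grid t T n k)))// gridS grid0.
Qed.

Lemma near_mesh t T e : 0 < e -> \forall n \near \oo, (T - t) / n.+1%:R < e.
Proof.
move=> e0; have : (fun n : nat => (T - t) * n.+1%:R^-1) @ \oo --> (0 : R).
  rewrite -(mulr0 (T - t)); apply: cvgM; first exact: cvg_cst.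
  exact: cvg_harmonic.
move=> /cvgrPdist_lt /(_ e e0); apply: filterS => n.
by rewrite sub0r normrN; exact: le_lt_trans (ler_norm _).
Qed.

(** Whole cells are added as long as their left end is before [sg], so the sum stops at most one
    mesh too late; continuity of [f] at [sg] absorbs the excess. *)
Lemma stopped_cvg t T f sg : t <= T -> {within `[t, T], continuous f} ->
  t <= sg <= T ->
  (fun n => \sum_(k < n.+1) (grid t T n k < sg)%R%:R *
     (f (grid t T n k.+1) - f (grid t T n k))) @ \oo --> f sg - f t.
Proof.
move=> tT cf /andP[tsg sgT]; apply/cvgrPdist_lt => e e0.
have [dl dl0 H] := within_itv_cont cf (introT andP (conj tsg sgT)) e0.
near=> n.
have mesh : (T - t) / n.+1%:R < dl by near: n; exact: near_mesh.
(* Stopping [f] at [sg] makes the target a telescoping sum over the same grid; the two sums differ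
   only in the cell containing [sg]. *)
pose g x := f (Num.min x sg).
have -> : f sg - f t = g T - g t by rewrite /g (min_idPr sgT) (min_idPl tsg).
rewrite -(grid_telescope t T n g) -sumrB.
(* The increments of [h] are 1 on the cell containing [sg] and 0 on the others, so summing the
   cellwise bounds costs a factor at most 1. *)
pose h x : R := (sg <= x)%R%:R.
have bnd (k : 'I_n.+1) :
    `|(g (grid t T n k.+1) - g (grid t T n k)) - (grid t T n k < sg)%R%:R *
     (f (grid t T n k.+1) - f (grid t T n k))| <=
   \big[Num.max/0]_(k < n.+1) `|(grid t T n k < sg <= grid t T n k.+1)%R%:R *
      (f sg - f (grid t T n k.+1))| * (h (grid t T n k.+1) - h (grid t T n k)).
  set c := \big[_/_]_(_ < _) _.
  have c0 : 0 <= c by rewrite /c; apply: (big_ind (fun x => 0 <= x)) => // *; rewrite le_max; apply/orP; left.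
  have s12 := grid_mono n tT (leqnSn k).
  rewrite /g /h; case: (ltP (grid t T n k) sg) => [s1|s1]; last first.
    rewrite (min_idPr (le_trans s1 s12)).
    by rewrite subrr mul0r subr0 normr0 (le_trans s1 s12) subrr mulr0.
  case: (leP sg (grid t T n k.+1)) => s2; last first.
    by rewrite mul1r subrr normr0 subrr mulr0.
  rewrite subr0 mulr1 mul1r opprB addrA subrK.
  rewrite (le_trans _ (@le_bigmax _ _ _ 0 (fun k : 'I_n.+1 => `|(grid t T n k < sg <= grid t T n k.+1)%R%:R *
      (f sg - f (grid t T n k.+1))|) k))//=.
  by rewrite s1 s2 mul1r.
rewrite (le_lt_trans (ler_norm_sum _ _ _))//.
rewrite (le_lt_trans (ler_sum _ (fun k _ => bnd k)))//.
rewrite -mulr_sumr grid_telescope.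
rewrite (@le_lt_trans _ _ (\big[Num.max/0]_(k < n.+1) `|(grid t T n k < sg <= grid t T n k.+1)%R%:R *
      (f sg - f (grid t T n k.+1))|))//.
  rewrite ler_piMr//.
    by apply: (big_ind (fun x => 0 <= x)) => // *; rewrite le_max; apply/orP; left.
  by rewrite /h sgT; case: (sg <= t); rewrite ?subrr ?subr0.
apply/bigmax_ltP; split=> // k _.
case: (boolP (_ < sg <= _)) => [/andP[s1 s2]|_]; last by rewrite mul0r normr0.
rewrite mul1r; apply: H; first by apply: grid_bounds.
rewrite distrC ger0_norm ?subr_ge0//.
by rewrite (le_lt_trans _ mesh)// -(gridSB t T n k) lerD2l lerN2 ltW.
Unshelve. all: by end_near. Qed.

Lemma integral_mean_bound t T f (a b c e : R) :
  {within `[t, T], continuous f} -> t <= a -> a <= b -> b <= T ->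
  (forall s, a <= s <= b -> `|f c - f s| <= e) ->
  `|(b - a) * f c - (\int[lebesgue_measure]_(s in `[t, b]) f s -
      \int[lebesgue_measure]_(s in `[t, a]) f s)| <= (b - a) * e.
Proof.
move=> cf ta ab bT H.
have cfI : lebesgue_measure.-integrable `[t, b] (EFin \o f).
  apply: continuous_compact_integrable; first exact: segment_compact.
  by apply: continuous_subspaceW cf; apply: subset_itvl; rewrite bnd_simp.
have cfI' : lebesgue_measure.-integrable `]a, b] (EFin \o f).
  by apply: integrableS cfI => //; apply: subset_itvr; rewrite bnd_simp.
rewrite Rintegral_itvB ?bnd_simp//.
have leb : fine (lebesgue_measure `]a, b]) = b - a.
  by rewrite lebesgue_measure_itv /= lte_fin; case: ltgtP ab => // ->; rewrite ?subrr.
have ic r : lebesgue_measure.-integrable `]a, b] (EFin \o cst r).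
  have : lebesgue_measure.-integrable `[a, b] (EFin \o cst r).
    apply: continuous_compact_integrable; first exact: segment_compact.
    by apply: continuous_subspaceT => x; exact: cvg_cst.
  by apply: integrableS => //; apply: subset_itvr; rewrite bnd_simp.
rewrite (_ : (b - a) * f c = \int[lebesgue_measure]_(s in `]a, b]) (cst (f c) s)); last first.
  by rewrite Rintegral_cst// leb mulrC.
rewrite -RintegralB// (le_trans (le_normr_Rintegral _ _))//.
  by apply: (integrableB _ (ic _) cfI').
rewrite -leb mulrC -Rintegral_cst//; apply: le_Rintegral => //.
- have := integrable_norm (integrableB _ (ic (f c)) cfI'). by apply.
- exact: (ic e).
move=> s /=; rewrite in_itv /= => /andP[/ltW s1 s2]; apply: H.
by rewrite s1.
Qed.

(** The sample point [c] is arbitrary in its cell because [v] will be the running supremum or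
    infimum of a path, attained at an uncontrolled place. [stopped_cvg] applied to the primitive of
    [f] handles the exact cell integrals, and uniform continuity compares the samples with them. *)
Lemma stopped_riemann_cvg t T f (v : nat -> nat -> R) sg : t <= T ->
  {within `[t, T], continuous f} -> t <= sg <= T ->
  (forall n k, (k < n.+1)%N -> exists2 c,
     grid t T n k <= c <= grid t T n k.+1 & v n k = f c) ->
  (fun n => \sum_(k < n.+1) (grid t T n k < sg)%R%:R *
     ((T - t) / n.+1%:R * v n k)) @ \oo -->
  \int[lebesgue_measure]_(s in `[t, sg]) f s.
Proof.
move=> tT cf sgtT hv.
have cfI : lebesgue_measure.-integrable `[t, T] (EFin \o f).
  by apply: continuous_compact_integrable => //; exact: segment_compact.
pose I x := \int[lebesgue_measure]_(s in `[t, x]) f s.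
have cI : {within `[t, T], continuous I}.
  exact: parameterized_integral_continuous.
have It : I t = 0 by rewrite /I set_itv1 Rintegral_set1.
have := stopped_cvg tT cI sgtT; rewrite It subr0.
set u := (X in X @ _ --> _ -> _); set w := (X in _ -> X @ _ --> _).
apply: cvg_sub0; apply/cvgrPdist_le => e e0.
(* The summand 1 keeps the denominator positive when t = T. *)
have e1 : 0 < e / (T - t + 1) by rewrite divr_gt0// ltr_wpDl ?subr_ge0.
have [dl dl0 H] := within_itv_unif_cont cf e1.
near=> n.
have mesh : (T - t) / n.+1%:R < dl by near: n; exact: near_mesh.
rewrite sub0r normrN -[(w - u) n]/(w n - u n) /w /u -sumrB (le_trans (ler_norm_sum _ _ _))//.
apply: (@le_trans _ _ (\sum_(k < n.+1) (T - t) / n.+1%:R * (e / (T - t + 1)))).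
  apply: ler_sum => k _; rewrite -mulrBr normrM.
  have [c cs ->] := hv n k (ltn_ord k).
  have s12 := grid_mono n tT (leqnSn k).
  have st := grid_bounds tT (ltnW (ltn_ord k)).
  have sT := grid_bounds tT (ltn_ord k).
  rewrite (@le_trans _ _ `|(T - t) / n.+1%:R * f c -
      (I (grid t T n k.+1) - I (grid t T n k))|)//.
    by case: (_ < sg); rewrite ?normr1 ?mul1r// normr0 mul0r.
  rewrite -(gridSB t T n k).
  apply: (integral_mean_bound cf); rewrite ?(proj1 (andP st)) ?(proj2 (andP sT))// => s ss.
  apply/ltW/H.
  - by rewrite (le_trans (proj1 (andP st)) (proj1 (andP cs))) (le_trans (proj2 (andP cs)) (proj2 (andP sT))).
  - by rewrite (le_trans (proj1 (andP st)) (proj1 (andP ss))) (le_trans (proj2 (andP ss)) (proj2 (andP sT))).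
  rewrite (le_lt_trans _ mesh)// -(gridSB t T n k) ler_norml.
  by move: cs ss => /andP[? ?] /andP[? ?]; apply/andP; split; lra.
rewrite sumr_const card_ord -(mulr_natr ((T - t) / n.+1%:R * (e / (T - t + 1)))).
have c0 : 0 < T - t + 1 by rewrite ltr_wpDl ?subr_ge0.
rewrite (_ : _ * n.+1%:R = (T - t) * (e / (T - t + 1))); last first.
  by field; rewrite (gt_eqF c0) addrC natr1 pnatr_eq0.
by rewrite mulrA ler_pdivrMr// mulrDr mulr1 mulrC lerDl ltW.
Unshelve. all: by end_near. Qed.
End DeterministicGrid.

(** * Running suprema and infima of continuous processes *)

Section ContinuousProcess.
Context {R : realType} {disp : measure_display} {Omega : measurableType disp}.
Implicit Types (a b s : R) (X : R -> Omega -> R).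

(** An enumeration of the rationals clamped to [a, b], with 0 for codes that decode to nothing.
    Countably many times make [run_sup] measurable, and continuity makes it the true maximum. *)
Definition dense_time a b (k : nat) : R :=
  Num.max a (Num.min b (ratr (odflt 0 (unpickle k)))).

Definition run_sup a b X (w : Omega) : R :=
  sups (fun k => X (dense_time a b k) w) 0%N.

Lemma dense_time_itv a b k : a <= b -> a <= dense_time a b k <= b.
Proof. by move=> ab; rewrite /dense_time le_max lexx /= ge_max ab ge_min lexx. Qed.

Lemma dense_timeP a b s dl : a <= s <= b -> 0 < dl ->
  exists k, `|s - dense_time a b k| < dl.
Proof.
move=> /andP[as_ sb] dl0.
have : s - dl < s + dl by rewrite ltrD2l gtrN.
move=> /rat_in_itvoo[q]; rewrite in_itv /= => /andP[q1 q2].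
exists (pickle q); rewrite /dense_time pickleK /=.
rewrite ltr_norml; have [h1|h1] := leP b (ratr q).
  by have [h2|h2] := leP a b; apply/andP; split; lra.
by have [h2|h2] := leP a (ratr q); apply/andP; split; lra.
Qed.

Lemma run_supP a b X w : a <= b ->
  {within `[a, b], continuous (fun s => X s w)} ->
  (forall s, a <= s <= b -> X s w <= run_sup a b X w) /\
  exists2 c, a <= c <= b & run_sup a b X w = X c w.
Proof.
move=> ab cX.
have [c cab cM] := EVT_max ab cX; rewrite in_itv /= in cab.
pose h k := X (dense_time a b k) w.
have hc k : h k <= X c w by apply: cM; rewrite in_itv /=; exact: dense_time_itv.
have hub : has_ubound (sdrop h 0%N) by exists (X c w) => _ [k _ <-]; exact: hc.
have e : run_sup a b X w = X c w.
  apply/eqP; rewrite eq_le; apply/andP; split.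
    by apply: ge_sup => [|_ [k _ <-]]; [exists (h 0%N); exists 0%N|exact: hc].
  apply/ler_addgt0Pr => e e0.
  have [dl dl0 H] := within_itv_cont cX cab e0.
  have [k ck] := dense_timeP cab dl0.
  have := H _ (dense_time_itv k ab) ck.
  have : h k <= run_sup a b X w by apply: ub_le_sup => //; exists k.
  by rewrite ltr_norml -/(h k) => ? /andP[]; lra.
split; last by exists c.
by move=> s sab; rewrite e; apply: cM; rewrite in_itv.
Qed.

Lemma measurable_run_sup (G : set (set Omega)) a b X : a <= b ->
  sigma_algebra setT G ->
  (forall w, {within `[a, b], continuous (fun s => X s w)}) ->
  (forall s, a <= s <= b -> measurable_wrt G (X s)) ->
  measurable_wrt G (run_sup a b X).
Proof.
move=> ab sG cX mX; apply/measurable_wrtE => //.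
apply: measurable_fun_sups => [w _|k].
  have [c _ cM] := EVT_max ab (cX w).
  exists (X c w) => _ [k _ <-]; apply: cM; rewrite in_itv /=; exact: dense_time_itv.
by apply/measurable_wrtE => //; apply: mX; exact: dense_time_itv.
Qed.

Definition run_inf a b X : Omega -> R :=
  fun w => - run_sup a b (fun s w => - X s w) w.

Lemma run_infP a b X w : a <= b ->
  {within `[a, b], continuous (fun s => X s w)} ->
  (forall s, a <= s <= b -> run_inf a b X w <= X s w) /\
  exists2 c, a <= c <= b & run_inf a b X w = X c w.
Proof.
move=> ab cX.
have cN : {within `[a, b], continuous (fun s => - X s w)}.
  by move=> x; apply: cvgN; exact: cX.
have [h [c cab e]] := @run_supP a b (fun s w => - X s w) w ab cN.
split => [s /h|]; first by rewrite lerNl.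
by exists c => //; rewrite /run_inf e opprK.
Qed.

Lemma measurable_run_inf (G : set (set Omega)) a b X : a <= b ->
  sigma_algebra setT G ->
  (forall w, {within `[a, b], continuous (fun s => X s w)}) ->
  (forall s, a <= s <= b -> measurable_wrt G (X s)) ->
  measurable_wrt G (run_inf a b X).
Proof.
move=> ab sG cX mX; apply/measurable_wrtE => //.
apply: measurable_funN; apply/measurable_wrtE => //.
apply: measurable_run_sup => // [w x|s sab]; first by apply: cvgN; exact: cX.
by apply/measurable_wrtE => //; apply: measurable_funN; apply/measurable_wrtE => //; exact: mX.
Qed.

End ContinuousProcess.

(** Once a node reaches [sg] no further term is added, so the sum is one increment of [x]. Stopped
    sums are thereby bounded by twice the supremum of the path, uniformly in the grid. *)
Lemma stopped_sum_telescope {R : realType} (x s : nat -> R) (sg : R) n :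
  (forall k, s k <= s k.+1) ->
  exists2 j, (j <= n)%N &
    \sum_(k < n) (s k < sg)%R%:R * (x k.+1 - x k) = x j - x 0%N.
Proof.
move=> s_mono.
have smono k l : (k <= l)%N -> s k <= s l.
  by move=> kl; apply: (homo_leq (@lexx _ _) (@le_trans _ _)) kl.
(* The induction also carries that an index [j] short of the end means [sg] has been reached, so
   that no later term is added. *)
suff [j jn [h _]] : exists2 j, (j <= n)%N &
    \sum_(k < n) (s k < sg)%R%:R * (x k.+1 - x k) = x j - x 0%N /\
    ((j < n)%N -> sg <= s j) by exists j.
elim: n => [|n [j jn [IH jlt]]].
  by exists 0%N => //; split => //; rewrite big_ord0 subrr.
rewrite big_ord_recr /= IH.
have [sn|sn] := ltP (s n) sg; last first.
  exists j; first exact: ltnW.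
  rewrite mul0r addr0; split=> // _.
  have [/jlt//|nj] := ltnP j n.
  by have -> : j = n by apply/eqP; rewrite eqn_leq jn.
exists n.+1 => //; rewrite ltnn; split => //.
have -> : j = n.
  apply/eqP; rewrite eqn_leq jn /= leqNgt; apply/negP => /[dup] /jlt sgj jn'.
  by have := smono _ _ (ltnW jn'); rewrite leNgt (lt_le_trans sn).
by rewrite mul1r addrC subrKA.
Qed.

(** * Stopping at a random time on an event of the initial sigma-algebra *)

Section StoppedProcess.
Context {R : realType} {disp : measure_display} {Omega : measurableType disp}.
Variables (P : probability Omega R) (G : R -> set (set Omega)) (t T : R).
Variables (D : set Omega) (sg : Omega -> R).
Hypothesis tT : t <= T.
Implicit Types (X : R -> Omega -> R) (K : Omega -> R) (E : set Omega).
Hypothesis sG : forall s, t <= s <= T -> sigma_algebra setT (G s).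
Hypothesis Gm : forall s, t <= s <= T -> G s `<=` measurable.
Hypothesis Gmono : forall s s', t <= s -> s <= s' -> s' <= T -> G s `<=` G s'.
Hypothesis GD : G t D.
Hypothesis sgT : forall w, D w -> t <= sg w <= T.
Hypothesis sg_stop : forall s, t <= s <= T -> G s [set w | sg w <= s].

Let before s := D `&` [set w | s < sg w].

(** The indicator attached to a cell is decided at its left end; this makes the stopped sums
    martingale transforms and, later, lets the jump rate be applied cell by cell. *)
Lemma before_adapted s : t <= s <= T -> G s (before s).
Proof.
move=> /[dup] sT /andP[ts sT'].
rewrite -(measurable_g_measurableTypeE (sG sT)).
apply: measurableI; rewrite measurable_g_measurableTypeE; do ?exact: sG.
  exact: Gmono GD.
have -> : [set w | s < sg w] = ~` [set w | sg w <= s].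
  by apply/seteqP; split=> w /=; rewrite ltNge => /negP.
rewrite -setTD; have [_ sD _] := sG sT; apply: sD; exact: sg_stop.
Qed.

Let gridT n k : (k <= n.+1)%N -> t <= grid t T n k <= T.
Proof. exact: grid_bounds. Qed.

Let before_meas n k : (k < n.+1)%N -> measurable (before (grid t T n k)).
Proof.
move=> kn; apply: (Gm (gridT (ltnW kn))).
exact: before_adapted (gridT (ltnW kn)).
Qed.

Let before1 s w : \1_(before s) w = \1_D w * (s < sg w)%R%:R :> R.
Proof.
rewrite !indicE in_setI; case: (w \in D) => /=; rewrite ?mul0r ?mul1r//.
by congr (nat_of_bool _)%:R; apply/idP/idP; rewrite inE.
Qed.

Let stopped_sum (X : R -> Omega -> R) n w :=
  \sum_(k < n.+1) \1_(before (grid t T n k)) w *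
    (X (grid t T n k.+1) w - X (grid t T n k) w).

Let stopped_sum_cvg (X : R -> Omega -> R) w : {within `[t, T], continuous (fun s => X s w)} ->
  stopped_sum X ^~ w @ \oo --> \1_D w * (X (sg w) w - X t w).
Proof.
move=> cX; rewrite /stopped_sum.
have e n : \sum_(k < n.+1) \1_(before (grid t T n k)) w *
    (X (grid t T n k.+1) w - X (grid t T n k) w) = \1_D w *
   (\sum_(k < n.+1) (grid t T n k < sg w)%R%:R *
     (X (grid t T n k.+1) w - X (grid t T n k) w)).
  by rewrite mulr_sumr; apply: eq_bigr => k _; rewrite before1 mulrA.
under eq_fun do rewrite e.
rewrite indicE; have [/set_mem Dw|_] := boolP (w \in D); last first.
  by under eq_fun do rewrite mul0r; rewrite mul0r; exact: cvg_cst.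
under eq_fun do rewrite mul1r; rewrite mul1r.
exact: (stopped_cvg tT cX (sgT Dw)).
Qed.

Let stopped_sum_bound (X : R -> Omega -> R) (K : R) w n :
  (forall s, t <= s <= T -> `|X s w| <= K) -> `|stopped_sum X n w| <= 2 * K.
Proof.
move=> XK.
have K0 : 0 <= K by rewrite (le_trans (normr_ge0 _) (XK t _))// lexx.
have [j jn e] := @stopped_sum_telescope R (fun k => X (grid t T n k) w)
  (grid t T n) (sg w) n.+1 (fun k => grid_mono n tT (leqnSn k)).
rewrite /stopped_sum.
rewrite (eq_bigr (fun k : 'I_n.+1 => \1_D w * ((grid t T n k < sg w)%R%:R *
  (X (grid t T n k.+1) w - X (grid t T n k) w)))); last first.
  by move=> k _; rewrite before1 mulrA.
rewrite -mulr_sumr e grid0 normrM.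
have h : `|X (grid t T n j) w - X t w| <= 2 * K.
  rewrite (le_trans (ler_normB _ _))// mulr2n mulrDl mul1r.
  by apply: lerD; apply: XK; [exact: gridT|rewrite lexx].
rewrite indicE; case: (_ \in _); rewrite ?normr1 ?mul1r// normr0 mul0r.
by rewrite mulr_ge0.
Qed.

(** The value at the random time is a pointwise limit of finite sums over deterministic times; the
    factor [\1_D] confines it to where [sg] lies in [t, T]. *)
Lemma measurable_stopped (X : R -> Omega -> R) :
  (forall w, {within `[t, T], continuous (fun s => X s w)}) ->
  (forall s, t <= s <= T -> measurable_fun setT (X s)) ->
  measurable_fun setT (fun w => \1_D w * (X (sg w) w - X t w)).
Proof.
move=> cX mX; apply: (measurable_fun_cvg (h := stopped_sum X)) => [n|w _].
  apply: measurable_sum => k; apply: measurable_funM.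
    by apply: measurable_indic; exact: before_meas.
  by apply: measurable_funB; apply: mX; apply: gridT => //; exact: ltnW.
exact: stopped_sum_cvg.
Qed.

(** Each term of a stopped sum has mean zero, since [before] is an event of the left end of its
    cell; the telescoping bound dominates the sums by [2 * K], so the mean survives the limit. *)
Lemma optional_stopping (X : R -> Omega -> R) (K : Omega -> R) :
  (forall w, {within `[t, T], continuous (fun s => X s w)}) ->
  (forall s, t <= s <= T -> measurable_fun setT (X s)) ->
  integr P K ->
  {ae P, forall w, forall s, t <= s <= T -> `|X s w| <= K w} ->
  (forall s s' E, t <= s -> s <= s' -> s' <= T -> G s E ->
     mean P (fun w => \1_E w * (X s' w - X s w)) = 0) ->
  integr P (fun w => \1_D w * (X (sg w) w - X t w)) /\
  mean P (fun w => \1_D w * (X (sg w) w - X t w)) = 0.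
Proof.
move=> cX mX iK XK mart.
have mXs := measurable_stopped cX mX.
have iX s : t <= s <= T -> integr P (X s).
  move=> sT; apply/integrableP; split; first by apply/measurable_EFinP; exact: mX.
  move: (iK) => /integrableP[mK]; apply: le_lt_trans.
  apply: ae_ge0_le_integral => //.
  - by apply: measurableT_comp => //; apply/measurable_EFinP; exact: mX.
  - exact: measurableT_comp.
  apply: filterS XK => w /(_ s sT) h _ /=.
  by rewrite lee_fin (le_trans h)// ler_norm.
have iS n k : (k < n.+1)%N -> integr P (fun w => \1_(before (grid t T n k)) w *
    (X (grid t T n k.+1) w - X (grid t T n k) w)).
  move=> kn; apply: integr_indicM; first exact: before_meas.
  by apply: integrB; apply: iX; apply: gridT => //; exact: ltnW.
have S0 n : mean P (stopped_sum X n) = 0.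
  rewrite /stopped_sum (mean_bigsum _ (X := fun (k : 'I_n.+1) w =>
    \1_(before (grid t T n k)) w * (X (grid t T n k.+1) w - X (grid t T n k) w)))//.
    apply: big1 => k _; apply: mart.
    - by have /andP[] := gridT (ltnW (ltn_ord k)).
    - exact: grid_mono.
    - by have /andP[] := gridT (ltn_ord k).
    - exact: before_adapted (gridT (ltnW (ltn_ord k))).
  by move=> k; exact: iS (ltn_ord k).
have [] := @mean_dct _ _ _ P (stopped_sum X) _ (fun w => 2 * K w) _ mXs.
- move=> n; apply: measurable_sum => k; exact: integr_meas (iS _ _ (ltn_ord k)).
- by apply: aeW => w; exact: stopped_sum_cvg.
- exact: integrZl.
- by apply: filterS XK => w h n; exact: stopped_sum_bound.
move=> iXs; under eq_fun do rewrite S0.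
by move=> /(cvg_unique _ (@cvg_cst _ 0 _ _ _)) e; split=> //; rewrite -e.
Qed.

(** * Compensator inequalities, with [J s s'] standing for an arrival in ]s, s'] *)

Section Compensator.
Variables (lam : R) (phi : R -> Omega -> R) (K : Omega -> R).
Variables (Finf : set (set Omega)) (J : R -> R -> set Omega) (B : set Omega).
Hypothesis lam_gt0 : 0 < lam.
Hypothesis phi_cont : forall w, {within `[t, T], continuous (fun s => phi s w)}.
Hypothesis phi_ge0 : forall s w, t <= s <= T -> 0 <= phi s w.
Hypothesis phi_le : forall s w, t <= s <= T -> phi s w <= K w.
Hypothesis sFinf : sigma_algebra setT Finf.
Hypothesis Finfm : Finf `<=` measurable.
Hypothesis phi_meas : forall s, t <= s <= T -> measurable_wrt Finf (phi s).
Hypothesis iK : integr P K.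
Hypothesis J_meas : forall s s', t <= s -> s <= s' -> s' <= T -> measurable (J s s').
Hypothesis J_rate : forall s s' E (X : Omega -> R), t <= s -> s <= s' -> s' <= T -> G s E ->
  measurable_wrt Finf X -> integr P X ->
  mean P (fun w => \1_E w * (\1_(J s s') w * X w)) =
  (1 - expR (- (lam * (s' - s)))) * mean P (fun w => \1_E w * X w).
Hypothesis B_meas : measurable B.

Definition stopped_area w := \int[lebesgue_measure]_(s in `[t, sg w]) phi s w.

Let mesh n := (T - t) / n.+1%:R.

Let mesh_ge0 n : 0 <= mesh n. Proof. by rewrite divr_ge0// subr_ge0. Qed.

(* [run] is [run_sup] or [run_inf]; these are measurable for [Finf] only, which
   is why [J_rate] allows a non-adapted factor [X]. *)
Section Run.
Variable run : R -> R -> (R -> Omega -> R) -> Omega -> R.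
Hypothesis runP : forall a b w, t <= a -> a <= b -> b <= T ->
  exists2 c, a <= c <= b & run a b phi w = phi c w.
Hypothesis run_meas : forall a b, t <= a -> a <= b -> b <= T ->
  measurable_wrt Finf (run a b phi).

Let v n k w := run (grid t T n k) (grid t T n k.+1) phi w.

Let vP n k w : (k < n.+1)%N ->
  exists2 c, grid t T n k <= c <= grid t T n k.+1 & v n k w = phi c w.
Proof.
move=> kn; apply: runP; [|exact: grid_mono|].
  by have /andP[] := gridT (ltnW kn).
by have /andP[] := gridT kn.
Qed.

Let v_bounds n k w : (k < n.+1)%N -> 0 <= v n k w <= K w.
Proof.
move=> kn; have [c /andP[c1 c2] ->] := vP w kn.
have cT : t <= c <= T.
  have /andP[h _] := gridT (ltnW kn); have /andP[_ h'] := gridT kn.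
  by rewrite (le_trans h c1) (le_trans c2 h').
by rewrite phi_ge0 ?phi_le.
Qed.

Let v_meas n k : (k < n.+1)%N -> measurable_wrt Finf (v n k).
Proof.
move=> kn; apply: run_meas; [|exact: grid_mono|].
  by have /andP[] := gridT (ltnW kn).
by have /andP[] := gridT kn.
Qed.

Let v_integr n k : (k < n.+1)%N -> integr P (v n k).
Proof.
move=> kn; apply: (integr_le _ iK).
  exact: measurable_wrt_measurable Finfm (v_meas kn).
move=> w; have /andP[v0 vK] := v_bounds w kn.
by rewrite ger0_norm// (le_trans vK)// ler_norm.
Qed.

Definition riemann_sum n w := \sum_(k < n.+1)
  \1_(before (grid t T n k)) w * (mesh n * v n k w).

Lemma riemann_sum_cvg : integr P (fun w => \1_D w * stopped_area w) /\
  (fun n => mean P (riemann_sum n)) @ \oo -->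
    mean P (fun w => \1_D w * stopped_area w).
Proof.
have mR n : measurable_fun setT (riemann_sum n).
  apply: measurable_sum => k; apply: measurable_funM.
    by apply: measurable_indic; exact: before_meas.
  by apply: measurable_funM => //; exact: integr_meas (v_integr (ltn_ord k)).
have cR w : riemann_sum ^~ w @ \oo --> \1_D w * stopped_area w.
  have e n : riemann_sum n w = \1_D w * (\sum_(k < n.+1)
      (grid t T n k < sg w)%R%:R * (mesh n * v n k w)).
    by rewrite /riemann_sum mulr_sumr; apply: eq_bigr => k _; rewrite before1 -mulrA.
  under eq_fun do rewrite e.
  rewrite indicE; have [/set_mem Dw|_] := boolP (w \in D); last first.
    by under eq_fun do rewrite mul0r; rewrite mul0r; exact: cvg_cst.
  under eq_fun do rewrite mul1r; rewrite mul1r.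
  apply: (@stopped_riemann_cvg R t T (fun s => phi s w) (fun n k => v n k w)) => //.
    exact: sgT.
  by move=> n k; exact: vP.
have mA : measurable_fun setT (fun w => \1_D w * stopped_area w).
  by apply: (measurable_fun_cvg (h := riemann_sum)) => // w _; exact: cR.
apply: (@mean_dct _ _ _ P riemann_sum _ (fun w => (T - t) * K w)) => //.
- exact: aeW.
- exact: integrZl.
apply: aeW => w n; rewrite /riemann_sum (le_trans (ler_norm_sum _ _ _))//.
have -> : (T - t) * K w = \sum_(k < n.+1) mesh n * K w.
  rewrite sumr_const card_ord -mulrnAl; congr (_ * _).
  by rewrite -mulr_natr /mesh divfK.
apply: ler_sum => k _; have /andP[v0 vK] := v_bounds w (ltn_ord k).
rewrite (normrM (\1_ _ w)) (normrM (mesh n)) (ger0_norm (mesh_ge0 n)) (ger0_norm v0).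
rewrite indicE; case: (_ \in _); rewrite ?normr1 ?mul1r ?normr0 ?mul0r.
  by rewrite ler_wpM2l.
by rewrite mulr_ge0// (le_trans v0).
Qed.

Definition jump_sum n w := \sum_(k < n.+1) \1_(before (grid t T n k)) w *
  (\1_(J (grid t T n k) (grid t T n k.+1)) w * v n k w).

Let jump_term_integr n k : (k < n.+1)%N ->
  integr P (fun w => \1_(before (grid t T n k)) w *
  (\1_(J (grid t T n k) (grid t T n k.+1)) w * v n k w)).
Proof.
move=> kn; apply: integr_indicM; first exact: before_meas.
apply: integr_indicM; last exact: v_integr.
apply: J_meas; [|exact: grid_mono|].
  by have /andP[] := gridT (ltnW kn).
by have /andP[] := gridT kn.
Qed.

Lemma jump_sum_integr n : integr P (jump_sum n).
Proof.
apply: (integr_bigsum _ (X := fun (k : 'I_n.+1) w => \1_(before (grid t T n k)) w *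
  (\1_(J (grid t T n k) (grid t T n k.+1)) w * v n k w))).
by move=> k; exact: jump_term_integr (ltn_ord k).
Qed.

(** Both sums are built from the same means of v on [before], whose total is [c]; comparing jumps
    with the compensator is reduced to comparing 1 - exp(-x) with x = [lam * mesh n]. *)
Lemma mean_jump_sum n : exists2 c, 0 <= c &
  lam * mean P (riemann_sum n) = lam * mesh n * c /\
  mean P (jump_sum n) = (1 - expR (- (lam * mesh n))) * c.
Proof.
exists (\sum_(k < n.+1) mean P (fun w => \1_(before (grid t T n k)) w * v n k w)).
  apply: sumr_ge0 => k _; apply: mean_ge0 => w; rewrite mulr_ge0//.
  by have /andP[] := v_bounds w (ltn_ord k).
have ib k : (k < n.+1)%N -> integr P (fun w => \1_(before (grid t T n k)) w * v n k w).
  by move=> kn; apply: integr_indicM; [exact: before_meas|exact: v_integr].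
split.
  have -> : riemann_sum n = (fun w => \sum_(k < n.+1)
      mesh n * (\1_(before (grid t T n k)) w * v n k w)).
    by apply/funext => w; apply: eq_bigr => k _; rewrite mulrCA.
  rewrite (mean_bigsum _ (X := fun (k : 'I_n.+1) w =>
    mesh n * (\1_(before (grid t T n k)) w * v n k w))); last first.
    by move=> k; apply: integrZl; exact: ib (ltn_ord k).
  rewrite -mulrA [mesh n * _]mulr_sumr; congr (_ * _); apply: eq_bigr => k _.
  by rewrite meanZl//; exact: ib.
rewrite (mean_bigsum _ (X := fun (k : 'I_n.+1) w => \1_(before (grid t T n k)) w *
  (\1_(J (grid t T n k) (grid t T n k.+1)) w * v n k w)));
  last by move=> k; exact: jump_term_integr (ltn_ord k).
rewrite mulr_sumr; apply: eq_bigr => k _.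
rewrite J_rate ?gridSB//.
- by have /andP[] := gridT (ltnW (ltn_ord k)).
- exact: grid_mono.
- by have /andP[] := gridT (ltn_ord k).
- exact: before_adapted (gridT (ltnW (ltn_ord k))).
- exact: v_meas.
- exact: v_integr.
Qed.

End Run.

Let run_sup_attained a b w : t <= a -> a <= b -> b <= T ->
  exists2 c, a <= c <= b & run_sup a b phi w = phi c w.
Proof.
move=> ta ab bT; have [] // := @run_supP _ _ _ a b phi w ab.
apply: continuous_subspaceW (@phi_cont w).
by apply: subset_itv; rewrite bnd_simp.
Qed.

Let run_sup_Finf a b : t <= a -> a <= b -> b <= T ->
  measurable_wrt Finf (run_sup a b phi).
Proof.
move=> ta ab bT; apply: measurable_run_sup => //.
  move=> w; apply: continuous_subspaceW (@phi_cont w).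
  by apply: subset_itv; rewrite bnd_simp.
move=> s /andP[as_ sb]; apply: phi_meas.
by rewrite (le_trans ta as_) (le_trans sb bT).
Qed.

Lemma stopped_area_integr : integr P (fun w => \1_D w * stopped_area w).
Proof.
by have [] := riemann_sum_cvg run_sup_attained run_sup_Finf.
Qed.

Let reward w := \1_D w * (\1_B w * phi (sg w) w).

(** As t < [sg] <= T, exactly one cell ]s, s'] contains [sg]; spreading the reward over the cells
    allows a comparison with [jump_sum] term by term. *)
Let reward_telescope n w : D w -> B w -> t < sg w ->
  phi (sg w) w = \sum_(k < n.+1)
   ((sg w <= grid t T n k.+1)%R%:R - (sg w <= grid t T n k)%R%:R) * phi (sg w) w.
Proof.
move=> Dw Bw tsg; rewrite -mulr_suml (grid_telescope t T n (fun x => (sg w <= x)%R%:R)).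
have /andP[_ ->] := sgT Dw.
by rewrite leNgt tsg subr0 mul1r.
Qed.

Lemma reward_integr : integr P reward.
Proof.
have mD : measurable D by apply: (Gm (s := t)) => //; rewrite lexx.
have itT : t <= t <= T by rewrite lexx.
have mp : measurable_fun setT (fun w => \1_D w * phi (sg w) w).
  have -> : (fun w => \1_D w * phi (sg w) w) = (fun w =>
    \1_D w * (phi (sg w) w - phi t w) + \1_D w * phi t w).
    by apply/funext => w; rewrite -mulrDr subrK.
  apply: measurable_funD; last first.
    apply: measurable_funM => //.
    exact: measurable_wrt_measurable Finfm (phi_meas itT).
  apply: measurable_stopped => // s sT.
  exact: measurable_wrt_measurable Finfm (phi_meas sT).
apply: (integr_le _ iK).
  have -> : reward = (fun w => \1_B w * (\1_D w * phi (sg w) w)).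
    by apply/funext => w; rewrite /reward mulrCA.
  exact: measurable_funM.
move=> w; rewrite /reward !indicE.
have K0 : 0 <= K w by rewrite (le_trans (phi_ge0 w itT))// phi_le.
have [/set_mem Dw|_] := boolP (w \in D); last by rewrite mul0r normr0.
rewrite mul1r (ger0_norm K0); case: (_ \in _); last by rewrite mul0r normr0.
by rewrite mul1r ger0_norm ?phi_ge0 ?phi_le// sgT.
Qed.

(** By hypothesis a cell containing [sg] has a jump, so its term in [jump_sum] is the supremum of
    [phi] over the cell, at least [phi] at [sg]; all other terms are nonnegative. *)
Lemma reward_le_compensator :
  (forall w, D w -> B w -> t < sg w /\ forall s s', t <= s -> s < sg w ->
     sg w <= s' -> s' <= T -> J s s' w) ->
  mean P reward <= lam * mean P (fun w => \1_D w * stopped_area w).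
Proof.
move=> hJ.
have [_ cR] := riemann_sum_cvg run_sup_attained run_sup_Finf.
have cl : (fun n => lam * mean P (riemann_sum (@run_sup _ _ _) n)) @ \oo -->
    lam * mean P (fun w => \1_D w * stopped_area w).
  by apply: cvgM => //; exact: cvg_cst.
apply: (cvgr_to_ge cl).
apply: nearW => n /=.
have [c c0 [-> jE]] := mean_jump_sum run_sup_attained run_sup_Finf n.
apply: (@le_trans _ _ (mean P (jump_sum (@run_sup _ _ _) n))); last first.
  rewrite jE ler_wpM2r// lerBlDr -lerBlDl.
  (* This is 1 - exp(-x) <= x. *)
  have := expR_ge1Dx (- (lam * mesh n)); lra.
apply: le_mean; [exact: reward_integr|exact: jump_sum_integr|move=> w].
have term0 (k : 'I_n.+1) : 0 <= \1_(before (grid t T n k)) w *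
  (\1_(J (grid t T n k) (grid t T n k.+1)) w *
     run_sup (grid t T n k) (grid t T n k.+1) phi w).
  rewrite !mulr_ge0//.
  have /andP[h1 _] := gridT (ltnW (ltn_ord k)).
  have /andP[_ h2] := gridT (ltn_ord k).
  have [c' /andP[h3 h4] ->] := run_sup_attained w h1 (grid_mono n tT (leqnSn k)) h2.
  by rewrite phi_ge0// (le_trans h1 h3) (le_trans h4 h2).
rewrite /reward !indicE; have [/set_mem Dw|_] := boolP (w \in D); last first.
  by rewrite mul0r sumr_ge0.
have [/set_mem Bw|_] := boolP (w \in B); last by rewrite mul0r mulr0 sumr_ge0.
have [tsg Jw] := hJ _ Dw Bw.
rewrite !mul1r (reward_telescope n Dw Bw tsg); apply: ler_sum => k _.
have [h|h] := leP (sg w) (grid t T n k).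
  rewrite (le_trans h (grid_mono n tT (leqnSn k))) subrr mul0r; exact: term0.
have [h'|h'] := leP (sg w) (grid t T n k.+1); last first.
  by rewrite subrr mul0r; exact: term0.
have /andP[h1 _] := gridT (ltnW (ltn_ord k)).
have /andP[_ h2] := gridT (ltn_ord k).
rewrite subr0 mul1r before1 h !indicE !mem_set//; last exact: Jw.
rewrite !mul1r.
have [] := @run_supP _ _ _ (grid t T n k) (grid t T n k.+1) phi w
  (grid_mono n tT (leqnSn k)).
  apply: continuous_subspaceW (@phi_cont w).
  by apply: subset_itv; rewrite bnd_simp.
by move=> + _; apply; rewrite h' ltW.
Qed.

(** With infima, a cell with a jump contributes nothing when [phi] vanishes somewhere in it. The
    only other possibility is the cell of [sg], where the infimum is at most the reward. *)
Lemma compensator_le_reward :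
  {ae P, forall w, D w -> B w -> t < sg w} ->
  {ae P, forall w, D w -> forall s s', t <= s -> s < sg w -> s <= s' ->
     s' <= T -> J s s' w ->
     (exists2 r, s <= r <= s' & phi r w = 0) \/ (B w /\ sg w <= s')} ->
  lam * mean P (fun w => \1_D w * stopped_area w) <= mean P reward.
Proof.
move=> tsg hJ.
have runP a b w : t <= a -> a <= b -> b <= T ->
    exists2 c, a <= c <= b & run_inf a b phi w = phi c w.
  move=> ta ab bT; have [] // := @run_infP _ _ _ a b phi w ab.
  apply: continuous_subspaceW (@phi_cont w).
  by apply: subset_itv; rewrite bnd_simp.
have run_meas a b : t <= a -> a <= b -> b <= T -> measurable_wrt Finf (run_inf a b phi).
  move=> ta ab bT; apply: measurable_run_inf => //.
    move=> w; apply: continuous_subspaceW (@phi_cont w).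
    by apply: subset_itv; rewrite bnd_simp.
  move=> s /andP[as_ sb]; apply: phi_meas.
  by rewrite (le_trans ta as_) (le_trans sb bT).
have [_ cR] := riemann_sum_cvg runP run_meas.
(* With x = [lam * mesh n], the factor 1 - x makes up for 1 - exp(-x) being smaller than x, and
   tends to 1. *)
have cm : (fun n => 1 - lam * mesh n) @ \oo --> (1 : R).
  rewrite -[X in _ --> X]subr0; apply: cvgB; first exact: cvg_cst.
  rewrite -(mulr0 lam); apply: cvgM; first exact: cvg_cst.
  rewrite /mesh -(mulr0 (T - t)); apply: cvgM; first exact: cvg_cst.
  exact: cvg_harmonic.
have cl : (fun n => (1 - lam * mesh n) *
    (lam * mean P (riemann_sum (@run_inf _ _ _) n))) @ \oo -->
    lam * mean P (fun w => \1_D w * stopped_area w).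
  rewrite -[X in _ --> X]mul1r; apply: cvgM => //.
  by apply: cvgM => //; exact: cvg_cst.
apply: (cvgr_to_le cl).
apply: nearW => n /=.
have [c c0 [-> jE]] := mean_jump_sum runP run_meas n.
apply: (@le_trans _ _ (mean P (jump_sum (@run_inf _ _ _) n))).
  rewrite jE mulrA ler_wpM2r//.
  have x0 : 0 <= lam * mesh n by rewrite mulr_ge0// ltW.
  move: (lam * mesh n) x0 => x x0.
  (* From this bound follows (1 - x) x <= 1 - exp(-x) for x >= 0. *)
  have h : expR (- x) * (1 + x) <= 1.
    rewrite -[leRHS](expRxMexpNx_1 x) mulrC ler_wpM2r ?expR_ge0//.
    exact: expR_ge1Dx.
  have e0 := expR_ge0 (- x); nra.
apply: le_mean_ae; [exact: jump_sum_integr|exact: reward_integr|].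
apply: filterS2 tsg hJ => w tsg hJ.
rewrite /reward; have [Dw|nDw] := pselect (D w); last first.
  rewrite indicE memNset// mul0r /jump_sum big1// => k _.
  by rewrite before1 indicE memNset// !mul0r.
rewrite [\1_D w]indicE mem_set// mul1r.
apply: (@le_trans _ _ (\sum_(k < n.+1) \1_B w *
   (((sg w <= grid t T n k.+1)%R%:R - (sg w <= grid t T n k)%R%:R) *
     phi (sg w) w))); last first.
  rewrite -mulr_sumr indicE; have [/set_mem Bw|_] := boolP (w \in B).
    by rewrite !mul1r -(reward_telescope n Dw Bw (tsg Dw Bw)).
  by rewrite !mul0r.
apply: ler_sum => k _.
have /andP[h1 _] := gridT (ltnW (ltn_ord k)).
have /andP[_ h2] := gridT (ltn_ord k).
have h12 := grid_mono n tT (leqnSn k).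
have p0 : 0 <= phi (sg w) w by apply: phi_ge0; exact: sgT.
have r0 : 0 <= \1_B w * (((sg w <= grid t T n k.+1)%R%:R -
    (sg w <= grid t T n k)%R%:R) * phi (sg w) w).
  apply: mulr_ge0 => //; apply: mulr_ge0 => //.
  have [h|_] := leP (sg w) (grid t T n k); last by rewrite subr0.
  by rewrite (le_trans h h12) subrr.
rewrite before1 [\1_D w]indicE mem_set// mul1r.
have [h|h] := boolP (grid t T n k < sg w); last by rewrite mul0r.
rewrite mul1r [X in X * _]indicE; have [/set_mem Jw|_] := boolP (w \in J _ _);
  last by rewrite mul0r.
rewrite mul1r.
have [inf_le _] := @run_infP _ _ _ (grid t T n k) (grid t T n k.+1) phi w h12
  (continuous_subspaceW (subset_itv (h1 : BLeft t <= BLeft _)%O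
    (h2 : BRight _ <= BRight T)%O) (@phi_cont w)).
have [[r rs r0']|[Bw sg_le]] := hJ Dw _ _ h1 h h12 h2 Jw.
  by apply: le_trans r0; rewrite -r0'; exact: inf_le.
rewrite indicE mem_set// sg_le (lt_geF h) subr0 !mul1r.
by apply: inf_le; rewrite sg_le ltW.
Qed.

End Compensator.
End StoppedProcess.

(** [measurable_stopped] with a constant filtration, from time 0 and on the whole space. With [G]
    the information at [u], it says that a path read at a time at most [u] is known at [u]. *)
Lemma measurable_at_time {R : realType} {disp : measure_display}
    {Omega : measurableType disp} (G : set (set Omega)) (u : R)
    (X : R -> Omega -> R) (sg : Omega -> R) : sigma_algebra setT G -> 0 <= u ->
  (forall w, {within `[0, u], continuous (fun s => X s w)}) ->
  (forall s, 0 <= s <= u -> measurable_wrt G (X s)) ->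
  (forall w, 0 <= sg w <= u) -> (forall s, 0 <= s <= u -> G [set w | sg w <= s]) ->
  measurable_wrt G (fun w => X (sg w) w).
Proof.
move=> sG u0 cX mX sgu sg_stop.
have mX' s : 0 <= s <= u -> measurable_fun setT (X s : g_sigma_algebraType G -> R).
  by move=> su; apply/measurable_wrtE => //; exact: mX.
have zu : 0 <= (0 : R) <= u by rewrite lexx.
apply/measurable_wrtE => //.
have -> : (fun w => X (sg w) w) =
    (fun w => \1_setT w * (X (sg w) w - X 0 w) + X 0 w).
  by apply/funext => w; rewrite indicT mul1r subrK.
apply: measurable_funD; last exact: mX'.
apply: (@measurable_stopped R _ (g_sigma_algebraType G) (fun=> G) 0 u setT sg) => //.
  by move=> s _ A; rewrite measurable_g_measurableTypeE.
  by move=> s s' _ _ _ A.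
exact: sigma_algebraT sG.
Qed.

(** * The filtration enlarged by the Poisson process, and its jumps *)

Section BigFiltration.
Context {R : realType} {disp : measure_display} {Omega : measurableType disp}.
Variables (P : probability Omega R) (F : R -> set (set Omega)).
Variables (Tn : nat -> Omega -> R) (lam : R).
Hypothesis lam_gt0 : 0 < lam.
Hypothesis filtF : usual_filtration P F.
Hypothesis poissonT : poisson_arrivals P Tn lam.
Hypothesis indepFT : independent_sets P (filt_infty F)
                 (filt_infty (poisson_natural Tn)).
Implicit Types (s t : R) (w : Omega) (X : Omega -> R) (A B E : set Omega).

Local Notation G := (big_filtration P F Tn).
Local Notation count := (arrival_count Tn).

Lemma negligible_measurable : P.-negligible `<=` measurable.
Proof.
by move=> A /(filt_complete filtF); exact: (filt_sub filtF (lexx 0)).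
Qed.

Lemma arrival_lt m n w : (m < n)%N -> Tn m w < Tn n w.
Proof.
move=> mn; apply: (homo_ltn (r := <%R) (f := Tn ^~ w)) => //.
- exact: lt_trans.
- by move=> k; exact: pa_mono poissonT k w.
Qed.

Lemma arrival_le m n w : (m <= n)%N -> Tn m w <= Tn n w.
Proof. by rewrite leq_eqVlt => /predU1P[->//|/arrival_lt/ltW]. Qed.

(** Divergence of the arrival times gives a first one beyond [t], so a witness for the [xget] in the
    count exists and its default value is not taken. *)
Lemma arrival_countP t w : 0 <= t -> Tn (count t w) w <= t < Tn (count t w).+1 w.
Proof.
move=> t0.
have [n tn] : exists n, t < Tn n w.
  have /cvgryPgt /(_ t) := pa_infty poissonT w.
  by case=> n _ h; exists n; apply: h => /=.
have [m] := ex_minnP (ex_intro (fun n => t < Tn n w) n tn).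
case: m => [|m] tm mmin.
  by move: tm; rewrite (pa_start poissonT) ltNge t0.
rewrite /arrival_count; apply: (@xgetPex _ 0%N [set n | Tn n w <= t < Tn n.+1 w]).
exists m => /=; rewrite tm andbT leNgt; apply/negP => /mmin.
by rewrite ltnn.
Qed.

(** The dictionary between arrival times and counting process, through which events on [Tn] are
    recognised as events of [poisson_natural]. *)
Lemma arrival_count_ge n t w : 0 <= t -> (n <= count t w)%N = (Tn n w <= t).
Proof.
move=> t0; have /andP[h1 h2] := arrival_countP w t0.
apply/idP/idP => [/(@arrival_le _ _ w) h|h]; first exact: le_trans h h1.
rewrite leqNgt; apply/negP => /(@arrival_le _ _ w) h'.
by have := lt_le_trans h2 h'; rewrite ltNge h.
Qed.

Lemma poisson_natural_sigma t : sigma_algebra setT (poisson_natural Tn t).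
Proof. exact: smallest_sigma_algebra. Qed.

Lemma arrival_count_natural s t (B : set nat) : 0 <= s <= t ->
  poisson_natural Tn t (count s @^-1` B).
Proof. by move=> st; apply: sub_sigma_algebra; exists s, B. Qed.

Lemma poisson_natural_measurable t : poisson_natural Tn t `<=` measurable.
Proof.
apply: smallest_sub.
  split; [exact: measurable0|by move=> A mA; rewrite setTD; exact: measurableC|].
  by move=> A mA; exact: bigcupT_measurable.
move=> _ [s [B [/andP[s0 _] ->]]].
have -> : count s @^-1` B =
    \bigcup_(n in B) ([set w | Tn n w <= s] `&` [set w | s < Tn n.+1 w]).
  apply/seteqP; split => [w Bw|w [n Bn /= [h1 h2]]].
    by exists (count s w) => //; have /andP[] := arrival_countP w s0.
  suff -> : count s w = n by [].
  apply/eqP; rewrite eqn_leq arrival_count_ge// h1 andbT leqNgt.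
  by rewrite arrival_count_ge// -ltNge.
apply: bigcup_measurable => n _; apply: measurableI.
  rewrite -[X in measurable X]setTI; have -> : [set w | Tn n w <= s] = Tn n @^-1` `]-oo, s].
    by apply/seteqP; split=> w /=; rewrite in_itv.
  exact: (pa_meas poissonT).
rewrite -[X in measurable X]setTI; have -> : [set w | s < Tn n.+1 w] = Tn n.+1 @^-1` `]s, +oo[.
  by apply/seteqP; split=> w /=; rewrite in_itv/= andbT.
exact: (pa_meas poissonT).
Qed.

Lemma poisson_natural_mono s t : s <= t ->
  poisson_natural Tn s `<=` poisson_natural Tn t.
Proof.
move=> st; apply: sub_smallest2r; first exact: smallest_sigma_algebra.
by move=> _ [r [B [/andP[r0 rs] ->]]]; exists r, B; rewrite r0 (le_trans rs).
Qed.

Lemma big_filtration_sigma t : sigma_algebra setT (G t).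
Proof. exact: smallest_sigma_algebra. Qed.

Lemma big_filtration_F t : F t `<=` G t.
Proof. by move=> A FA; apply: sub_sigma_algebra; left. Qed.

Lemma big_filtration_natural t : poisson_natural Tn t `<=` G t.
Proof.
move=> A HA; apply: sub_sigma_algebra; right; apply: sub_sigma_algebra; left.
exact: HA.
Qed.

Lemma big_filtration_sub t : 0 <= t -> G t `<=` measurable.
Proof.
move=> t0.
have sm : sigma_algebra setT (@measurable _ Omega).
  split; [exact: measurable0|by move=> A mA; rewrite setTD; exact: measurableC|].
  by move=> A mA; exact: bigcupT_measurable.
apply: smallest_sub => // A [|]; first exact: filt_sub filtF t t0 A.
move: A; apply: smallest_sub => // A [|]; first exact: poisson_natural_measurable.
exact: negligible_measurable.
Qed.

Lemma big_filtration_mono s t : 0 <= s -> s <= t -> G s `<=` G t.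
Proof.
move=> s0 st; apply: smallest_sub; first exact: big_filtration_sigma.
move=> A [FA|]; first by apply: big_filtration_F; apply: (filt_mono filtF) FA; rewrite s0.
move: A; apply: smallest_sub; first exact: big_filtration_sigma.
move=> A [/(poisson_natural_mono st)/big_filtration_natural//|/(filt_complete filtF)].
move=> FA; apply: big_filtration_F; apply: (filt_mono filtF) FA.
by rewrite lexx (le_trans s0).
Qed.

Definition rectangles t : set (set Omega) :=
  [set E | exists A B, [/\ F t A, poisson_natural Tn t B & E = A `&` B]].

Lemma rectanglesI t : 0 <= t -> setI_closed (rectangles t).
Proof.
move=> t0 _ _ [A [B [FA HB ->]]] [A' [B' [FA' HB' ->]]].
exists (A `&` A'), (B `&` B'); split; last by rewrite setIACA.
  exact: sigma_algebraI (filt_sigma filtF t0) _ _ FA FA'.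
exact: sigma_algebraI (poisson_natural_sigma t) _ _ HB HB'.
Qed.

Lemma rectanglesT t : 0 <= t -> rectangles t setT.
Proof.
move=> t0; exists setT, setT; rewrite setIT; split=> //.
  exact: sigma_algebraT (filt_sigma filtF t0).
exact: sigma_algebraT (poisson_natural_sigma t).
Qed.

Lemma rectangles_measurable t : 0 <= t -> rectangles t `<=` measurable.
Proof.
move=> t0 _ [A [B [FA HB ->]]]; apply: measurableI.
  exact: filt_sub filtF _ t0 _ FA.
exact: poisson_natural_measurable HB.
Qed.

(** The null sets added to the Poisson filtration already lie in [F 0]; so the rectangles, a
    pi-system on which independence applies directly, generate all of [G t]. *)
Lemma big_filtration_rectangles t : 0 <= t -> G t `<=` <<s rectangles t >>.
Proof.
move=> t0; have FR A : F t A -> <<s rectangles t >> A.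
  move=> FA; apply: sub_sigma_algebra; exists A, setT; rewrite setIT; split=> //.
  exact: sigma_algebraT (poisson_natural_sigma t).
apply: smallest_sub; first exact: smallest_sigma_algebra.
move=> A [/FR//|]; move: A; apply: smallest_sub; first exact: smallest_sigma_algebra.
move=> A [HA|/(filt_complete filtF) FA].
  apply: sub_sigma_algebra; exists setT, A; rewrite setTI; split=> //.
  exact: sigma_algebraT (filt_sigma filtF t0).
by apply: FR; apply: (filt_mono filtF) FA; rewrite lexx.
Qed.

Lemma filt_infty_sigma (H : R -> set (set Omega)) : sigma_algebra setT (filt_infty H).
Proof. exact: smallest_sigma_algebra. Qed.

Lemma filt_infty_ub (H : R -> set (set Omega)) t : 0 <= t -> H t `<=` filt_infty H.
Proof. by move=> t0 A HA; apply: sub_sigma_algebra; exists t. Qed.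

Lemma filt_infty_sub (H : R -> set (set Omega)) :
  (forall t, 0 <= t -> H t `<=` measurable) -> filt_infty H `<=` measurable.
Proof.
move=> Hm; apply: smallest_sub.
  split; [exact: measurable0|by move=> A mA; rewrite setTD; exact: measurableC|].
  by move=> A mA; exact: bigcupT_measurable.
by move=> A [t /= t0]; exact: Hm.
Qed.

Lemma filt_inftyF_sub : filt_infty F `<=` measurable.
Proof. by apply: filt_infty_sub => t; exact: filt_sub filtF t. Qed.

Lemma filt_inftyP_sub : filt_infty (poisson_natural Tn) `<=` measurable.
Proof. by apply: filt_infty_sub => t _; exact: poisson_natural_measurable. Qed.

(* Independence says that [\1_B - P B] integrates to zero over every event of
   [filt_infty F], so any factor measurable for that algebra can be pulled out. *)
Lemma mean_indep X B : measurable_wrt (filt_infty F) X -> integr P X ->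
  filt_infty (poisson_natural Tn) B ->
  mean P (fun w => \1_B w * X w) = fine (P B) * mean P X.
Proof.
move=> mX iX HB; have mB := filt_inftyP_sub HB.
have iB : integr P (\1_B : Omega -> R).
  have := integr_indicM mB (integr_cst P 1).
  by apply: eq_integrable => // w _ /=; rewrite mulr1.
have i1 : integr P (fun w => \1_B w - fine (P B)).
  by apply: integrB => //; exact: integr_cst.
have i2 : integr P (fun w => X w * (\1_B w - fine (P B))).
  have := integrB (integr_indicM mB iX) (integrZl (fine (P B)) iX).
  by apply: eq_integrable => // w _ /=; rewrite mulrBr mulrC [fine _ * _]mulrC.
have h := @mean_pullout _ _ _ P (filt_infty F) X _ (filt_infty_sigma F)
  filt_inftyF_sub mX i1 i2.
apply/eqP; rewrite -subr_eq0 -(meanZl _ iX) -meanB; last 2 first.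
- exact: integr_indicM.
- exact: integrZl.
apply/eqP; rewrite -[RHS]h.
  by congr mean; apply/funext => w; rewrite mulrBr mulrC [fine _ * _]mulrC.
move=> A FA; have mA := filt_inftyF_sub FA.
have -> : (fun w => \1_A w * (\1_B w - fine (P B))) =
    (fun w => \1_(A `&` B) w - fine (P B) * \1_A w).
  by apply/funext => w; rewrite indicI mulrBr [fine _ * _]mulrC.
have iA (C : set Omega) : measurable C -> integr P (\1_C : Omega -> R).
  move=> mC; have := integr_indicM mC (integr_cst P 1).
  by apply: eq_integrable => // w _ /=; rewrite mulr1.
have mE (C : set Omega) : measurable C -> mean P \1_C = fine (P C).
  by move=> mC; rewrite -(mean_indic P mC).
rewrite meanB; [|by apply: iA; exact: measurableI|by apply: integrZl; exact: iA].
rewrite meanZl; last exact: iA.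
rewrite !mE//; last exact: measurableI.
by rewrite indepFT// fineM ?fin_num_measure// mulrC subrr.
Qed.

Definition jump s s' : set Omega := [set w | count s' w <> count s w].

Lemma jump_natural s s' : 0 <= s -> s <= s' -> poisson_natural Tn s' (jump s s').
Proof.
move=> s0 ss'.
have -> : jump s s' = \bigcup_n (count s @^-1` [set n] `&` count s' @^-1` (~` [set n])).
  by apply/seteqP; split => [w|w [n _ [/= <- //]]]; exists (count s w).
have [_ _ sU] := poisson_natural_sigma s'.
apply: sU => n; apply: sigma_algebraI (poisson_natural_sigma s') _ _ _ _.
  by apply: arrival_count_natural; rewrite s0.
by apply: arrival_count_natural; rewrite lexx (le_trans s0).
Qed.

Lemma jump_measurable s s' : 0 <= s -> s <= s' -> measurable (jump s s').
Proof. by move=> s0 ss'; exact: poisson_natural_measurable (jump_natural s0 ss'). Qed.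

(** The complement of a jump is a zero increment of the count, of probability exp(-lam (s' - s)) and
    independent of the natural past. The case s = s' is separate because [pa_increments] requires s
    < s'. *)
Lemma jump_prob s s' B : 0 <= s -> s <= s' -> poisson_natural Tn s B ->
  fine (P (B `&` jump s s')) = (1 - expR (- (lam * (s' - s)))) * fine (P B).
Proof.
move=> s0; rewrite le_eqVlt => /predU1P[<- HB|ss' HB].
  rewrite subrr mulr0 oppr0 expR0 subrr mul0r.
  by rewrite (_ : jump s s = set0) ?setI0 ?measure0//; apply/seteqP; split => w.
have mB := poisson_natural_measurable HB.
have := @pa_increments _ _ _ _ _ _ poissonT s s' _ B 0%N HB.
rewrite s0 ss' => /(_ isT).
have -> : [set w | count s' w = (count s w + 0)%N] = ~` jump s s'.
  apply/seteqP; split => w /=; rewrite addn0 /jump /=; [by move=> ? []|].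
  by move/contrapT.
rewrite /poisson_pmf mulr_gt0 ?subr_gt0// expr0 fact0 invr1 !mul1r => h.
have mJ := jump_measurable s0 (ltW ss').
have := measureIl.
have : (P B = P (B `&` jump s s') + P (B `&` ~` jump s s'))%E.
  rewrite -measureU//; [by rewrite -setIUr setUv setIT| | |].
  - exact: measurableI.
  - by apply: measurableI => //; exact: measurableC.
  - by rewrite setIACA setICr setI0.
rewrite h => + _.
have := fin_num_measure P _ mB; have := fin_num_measure P _ (measurableI _ _ mB mJ).
move=> f1 f2; rewrite -(fineK f1) -(fineK f2) -EFinM -EFinD => -[] /= e.
lra.
Qed.

(** On a rectangle, [B] together with the jump is independent of [F_infty], hence of 1_A X, and the
    jump is independent of [B]. Both sides are signed measures in [E], so agreement extends to
    [G s]; [X] may depend on the future of [F]. *)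
Lemma mean_jump s s' E X : 0 <= s -> s <= s' -> G s E ->
  measurable_wrt (filt_infty F) X -> integr P X ->
  mean P (fun w => \1_E w * (\1_(jump s s') w * X w)) =
  (1 - expR (- (lam * (s' - s)))) * mean P (fun w => \1_E w * X w).
Proof.
move=> s0 ss' GE mX iX; set c := 1 - _.
have mJ := jump_measurable s0 ss'.
have mE := big_filtration_sub s0 GE.
have iJX : integr P (fun w => \1_(jump s s') w * X w) by exact: integr_indicM.
rewrite -meanZl; last exact: integr_indicM.
have -> : (fun w => c * (\1_E w * X w)) = (fun w => \1_E w * (c * X w)).
  by apply/funext => w; rewrite mulrCA.
apply: (@mean_pi_lambda _ _ _ P (rectangles s)) => //.
- exact: integrZl.
- exact: rectanglesI.
- exact: rectanglesT.
- exact: rectangles_measurable.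
- move=> _ [A [B [FA HB ->]]].
  have mA := filt_sub filtF s0 FA.
  have iAX : integr P (fun w => \1_A w * X w) by exact: integr_indicM.
  have mAX : measurable_wrt (filt_infty F) (fun w => \1_A w * X w).
    have sF := filt_infty_sigma F.
    apply/measurable_wrtE => //; apply: measurable_funM; last exact/measurable_wrtE.
    apply: measurable_indic.
    rewrite measurable_g_measurableTypeE//; exact: filt_infty_ub FA.
  have HBJ : filt_infty (poisson_natural Tn) (B `&` jump s s').
    have s'0 := le_trans s0 ss'.
    apply: (filt_infty_ub s'0); apply: sigma_algebraI (poisson_natural_sigma s') _ _ _ _.
      exact: poisson_natural_mono HB.
    exact: jump_natural.
  have HB' := filt_infty_ub s0 HB.
  transitivity (mean P (fun w => \1_(B `&` jump s s') w * (\1_A w * X w))).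
    by congr mean; apply/funext => w; rewrite !indicI /=; ring.
  rewrite (mean_indep mAX iAX HBJ) jump_prob//.
  transitivity (c * mean P (fun w => \1_B w * (\1_A w * X w))).
    by rewrite (mean_indep mAX iAX HB') mulrA.
  rewrite -meanZl; last by apply: integr_indicM => //; exact: poisson_natural_measurable HB.
  by congr mean; apply/funext => w; rewrite !indicI /=; ring.
- exact: big_filtration_rectangles.
Qed.

(** An independent Poisson process does not destroy [F]-martingales: on a rectangle the Poisson
    factor splits off as a probability. It is applied to increments of the stochastic integral. *)
Lemma mean_big_filtration s E X : 0 <= s -> G s E ->
  measurable_wrt (filt_infty F) X -> integr P X ->
  (forall A, F s A -> mean P (fun w => \1_A w * X w) = 0) ->
  mean P (fun w => \1_E w * X w) = 0.
Proof.
move=> s0 GE mX iX X0.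
transitivity (mean P (fun w => \1_E w * (cst 0 : Omega -> R) w)); last first.
  rewrite -[RHS](mean_cst P 0); congr mean; apply/funext => w /=.
  by rewrite mulr0.
apply: (@mean_pi_lambda _ _ _ P (rectangles s)) => //.
- exact: integr_cst.
- exact: rectanglesI.
- exact: rectanglesT.
- exact: rectangles_measurable.
- move=> _ [A [B [FA HB ->]]].
  have mA := filt_sub filtF s0 FA.
  have iAX : integr P (fun w => \1_A w * X w) by exact: integr_indicM.
  have mAX : measurable_wrt (filt_infty F) (fun w => \1_A w * X w).
    have sF := filt_infty_sigma F.
    apply/measurable_wrtE => //; apply: measurable_funM; last exact/measurable_wrtE.
    apply: measurable_indic.
    rewrite measurable_g_measurableTypeE//; exact: filt_infty_ub FA.
  transitivity (mean P (fun w => \1_B w * (\1_A w * X w))).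
    by congr mean; apply/funext => w; rewrite !indicI /=; ring.
  rewrite mean_indep//; last exact: filt_infty_ub HB.
  rewrite X0// mulr0 -[LHS](mean_cst P 0); congr mean; apply/funext => w /=.
  by rewrite mulr0.
- exact: big_filtration_rectangles.
Qed.

(** An arrival at [t] is a jump in ]t - d, t] for every 0 < d <= t, an event of probability at most
    [lam * d]. *)
Lemma arrival_neq_ae t : 0 < t ->
  {ae P, forall w, forall n, (0 < n)%N -> Tn n w <> t}.
Proof.
move=> t0.
pose N := [set w | exists2 n, (0 < n)%N & Tn n w = t].
have NJ e : 0 < e <= t -> N `<=` jump (t - e) t.
  move=> /andP[e0 et] w [n n0 Tt] /= cc.
  have te : 0 <= t - e by rewrite subr_ge0.
  have : (n <= count t w)%N by rewrite arrival_count_ge ?Tt// ltW.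
  rewrite cc arrival_count_ge// Tt; lra.
have mN : measurable N.
  have -> : N = \bigcup_(n in [set n | (0 < n)%N]) (Tn n @^-1` [set t]).
    by apply/seteqP; split => w [n n0 e]; exists n.
  apply: bigcup_measurable => n _; rewrite -[X in measurable X]setTI.
  exact: (pa_meas poissonT).
exists N; split => //; last first.
  move=> w /= /existsNP[n /not_implyP[n0 /contrapT Tt]]; by exists n.
have fN := fin_num_measure P _ mN.
rewrite -(fineK fN); congr (_%:E); apply/eqP; rewrite eq_le fine_ge0 ?andbT//.
apply/ler_addgt0Pr => e e0; rewrite add0r.
(* The first bound keeps t - d nonnegative, the second makes [lam * d] at most [e]. *)
pose d := Num.min t (e / lam).
have d0 : 0 < d by rewrite lt_min t0 divr_gt0.
have dt : d <= t by rewrite ge_min lexx.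
have td : 0 <= t - d by rewrite subr_ge0.
have tdt : t - d <= t by rewrite gerBl ltW.
have mJ := jump_measurable td tdt.
apply: (@le_trans _ _ (fine (P (jump (t - d) t)))).
  apply: fine_le => //; first exact: fin_num_measure.
  by apply: le_measure; rewrite ?inE//; apply: NJ; rewrite d0.
have := @jump_prob (t - d) t setT td tdt (sigma_algebraT (poisson_natural_sigma _)).
rewrite setTI probability_setT /= mulr1 => ->.
rewrite (_ : t - (t - d) = d); last by lra.
have := expR_ge1Dx (- (lam * d)).
have : lam * d <= e.
  rewrite -ler_pdivlMl// mulrC ge_min lexx orbT//.
lra.
Qed.

End BigFiltration.

(** * First moments of Gaussian laws *)

Section NormalMoments.
Context {R : realType}.
Local Notation mu := lebesgue_measure.

(** The centred density and Lebesgue measure are both invariant under reflection; the vanishing mean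
    of Brownian increments rests on this. *)
Lemma normal_prob_opp (s : R) (B : set R) : s != 0 -> measurable B ->
  normal_prob 0 s (-%R @^-1` B) = normal_prob 0 s B.
Proof.
move=> s0 mB; rewrite /normal_prob.
have mN : measurable_fun setT (-%R : measurableTypeR R -> measurableTypeR R) by [].
have mpdf : measurable_fun B (fun x => (normal_pdf 0 s x)%:E).
  by apply/measurable_EFinP/measurable_funTS; exact: measurable_normal_pdf.
have -> : (\int[mu]_(x in B) (normal_pdf 0 s x)%:E =
    \int[pushforward mu (-%R : _ -> measurableTypeR R)]_(x in B) (normal_pdf 0 s x)%:E)%E.
  by apply: eq_measure_integral => //= A mA _; exact/esym/lebesgue_measureN.
rewrite ge0_integral_pushforward//.
  by apply: eq_integral => x _ /=; rewrite normal_pdfE// /normal_fun !subr0 sqrrN.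
by move=> x _; rewrite lee_fin normal_pdf_ge0.
Qed.

(* [2|s| (1 + x^2/(4 s^2))] dominates [|x|], and one factor [exp(-x^2/(4 s^2))]
   of the density absorbs it; the other is the density of [N(0, 2 s^2)]. *)
Lemma normal_pdf_abs_le (s x : R) : s != 0 ->
  `|x| * normal_pdf 0 s x <=
  2 * `|s| * normal_peak s / normal_peak (Num.sqrt 2 * s) *
    normal_pdf 0 (Num.sqrt 2 * s) x.
Proof.
move=> s0.
have r2 : (0 : R) < Num.sqrt 2 by rewrite sqrtr_gt0.
have s20 : Num.sqrt 2 * s != 0 by rewrite mulf_neq0// gt_eqF.
rewrite !normal_pdfE//= /normal_fun subr0.
have p0 := normal_peak_gt0 s0; have p20 := normal_peak_gt0 s20.
rewrite exprMn sqr_sqrtr//.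
pose y := `|x| / (2 * `|s|).
have as0 : 0 < `|s| by rewrite normr_gt0.
have xy : `|x| = 2 * `|s| * y by rewrite /y mulrC divfK// mulf_neq0// gt_eqF.
have y0 : 0 <= y by rewrite divr_ge0// mulr_ge0// ltW.
have e1 : - x ^+ 2 / (2 * s ^+ 2 *+ 2) = - y ^+ 2.
  rewrite /y expr_div_n exprMn !real_normK ?num_real//.
  by field.
have e2 : - x ^+ 2 / (s ^+ 2 *+ 2) = - y ^+ 2 + - y ^+ 2.
  rewrite -e1; by field.
rewrite e1 e2 expRD.
rewrite (_ : 2 * `|s| * normal_peak s / normal_peak (Num.sqrt 2 * s) *
  (normal_peak (Num.sqrt 2 * s) * expR (- y ^+ 2)) =
  2 * `|s| * normal_peak s * expR (- y ^+ 2)); last first.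
  by field; rewrite gt_eqF.
rewrite xy.
rewrite (_ : 2 * `|s| * y * (normal_peak s * (expR (- y ^+ 2) * expR (- y ^+ 2))) =
  (2 * `|s| * normal_peak s * expR (- y ^+ 2)) * (y * expR (- y ^+ 2))); last by ring.
apply: ler_piMr.
  by rewrite !mulr_ge0 ?expR_ge0// ltW.
rewrite -[leRHS](expRxMexpNx_1 (y ^+ 2)) ler_wpM2r ?expR_ge0//.
apply: le_trans (expR_ge1Dx _); nra.
Qed.

Lemma normal_prob_abs_lty (s : R) : s != 0 ->
  (\int[normal_prob 0 s]_x `|x|%:E < +oo)%E.
Proof.
move=> s0; have dom := @normal_prob_dominates R 0 s.
have mabs : measurable_fun [set: R] (fun x : R => `|x|%:E).
  by apply/measurable_EFinP; exact: normr_measurable.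
have m1 : measurable_fun [set: R] (fun x : R => `|x|%:E * (normal_pdf 0 s x)%:E)%E.
  apply: emeasurable_funM => //; apply/measurable_EFinP; exact: measurable_normal_pdf.
rewrite -(Radon_Nikodym_SigmaFinite.change_of_variables dom)//.
have fi := Radon_Nikodym_SigmaFinite.f_integrable dom.
(* The Radon-Nikodym derivative agrees almost everywhere with the Gaussian density because both
   integrate to [normal_prob] over every measurable set. *)
have ae : ae_eq mu setT (Radon_Nikodym_SigmaFinite.f (normal_prob 0 s) mu)
    (fun x => (normal_pdf 0 s x)%:E).
  apply: integral_ae_eq => //.
    by apply/measurable_EFinP; exact: measurable_normal_pdf.
  by move=> E _ mE; rewrite -Radon_Nikodym_SigmaFinite.f_integral.
apply: (@le_lt_trans _ _ (\int[mu]_x (`|x|%:E * (normal_pdf 0 s x)%:E))%E).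
  rewrite le_eqVlt; apply/orP; left; apply/eqP; apply: ae_eq_integral => //.
  - by apply: emeasurable_funM => //; exact: measurable_int fi.
  - by apply: filterS ae => x /= h _; rewrite h.
pose s2 := Num.sqrt 2 * s.
pose C := 2 * `|s| * normal_peak s / normal_peak s2.
have C0 : 0 <= C by rewrite !mulr_ge0 ?invr_ge0 ?normal_peak_ge0.
apply: (@le_lt_trans _ _ (\int[mu]_x (C%:E * (normal_pdf 0 s2 x)%:E))%E).
  apply: ge0_le_integral => //.
  - by move=> x _; rewrite -EFinM lee_fin mulr_ge0// normal_pdf_ge0.
  - by apply: emeasurable_funM => //; apply/measurable_EFinP; exact: measurable_normal_pdf.
  by move=> x _; rewrite -!EFinM lee_fin; exact: normal_pdf_abs_le.
rewrite ge0_integralZl_EFin//.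
- rewrite integral_normal_pdf mule1 ltry//.
- by move=> x _; rewrite lee_fin normal_pdf_ge0.
- by apply/measurable_EFinP; exact: measurable_normal_pdf.
Qed.

End NormalMoments.

Section Law.
Context {R : realType} {disp : measure_display} {Omega : measurableType disp}.
Variable P : probability Omega R.

(** By symmetry [X] and [- X] have the same law, so the mean, finite by the Gaussian first moment,
    equals its own opposite. *)
Lemma normal_law_integr (X : Omega -> R) s : s != 0 -> measurable_fun setT X ->
  (forall B, measurable B -> P (X @^-1` B) = normal_prob 0 s B) ->
  integr P X /\ mean P X = 0.
Proof.
move=> s0 mX lX.
have mabs : measurable_fun [set: R] (fun x : R => `|x|%:E).
  by apply/measurable_EFinP; exact: normr_measurable.
have mX' : measurable_fun setT (X : Omega -> measurableTypeR R) := mX.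
pose XM : {mfun Omega >-> measurableTypeR R} :=
  HB.pack (X : Omega -> measurableTypeR R) (isMeasurableFun.Build _ _ _ _ _ mX').
have mN : measurable_fun setT (fun w => - X w) by exact: measurable_funN.
have mN' : measurable_fun setT ((fun w => - X w) : Omega -> measurableTypeR R) := mN.
pose NM : {mfun Omega >-> measurableTypeR R} :=
  HB.pack ((fun w => - X w) : Omega -> measurableTypeR R) (isMeasurableFun.Build _ _ _ _ _ mN').
have iX : integr P X.
  apply/integrableP; split; first exact/measurable_EFinP.
  apply: le_lt_trans (normal_prob_abs_lty s0).
  have -> : (\int[normal_prob 0 s]_x `|x|%:E =
      \int[distribution P XM]_x `|x|%:E)%E.
    by apply: eq_measure_integral => A mA _; exact/esym/lX.
  by rewrite ge0_integral_distribution//= lexx.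
split=> //.
have e1 : (\int[P]_w (X w)%:E = \int[normal_prob 0 s]_x x%:E)%E.
  have -> : (\int[normal_prob 0 s]_x x%:E = \int[distribution P XM]_x x%:E)%E.
    by apply: eq_measure_integral => A mA _; exact/esym/lX.
  by rewrite integral_distribution//; exact/measurable_EFinP.
have e2 : (\int[P]_w (- X w)%:E = \int[normal_prob 0 s]_x x%:E)%E.
  have -> : (\int[normal_prob 0 s]_x x%:E = \int[distribution P NM]_x x%:E)%E.
    apply: eq_measure_integral => A mA _.
    rewrite [LHS](_ : _ = normal_prob 0 s (-%R @^-1` A)).
      by rewrite -lX//; rewrite -[X in measurable X]setTI; exact: measurable_funN.
    exact/esym/normal_prob_opp.
  rewrite integral_distribution//; exact: integrN.
have e3 : mean P X = mean P (fun w => - X w).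
  by rewrite /mean /Rintegral e1 e2.
have e4 : mean P (fun w => - X w) = - mean P X.
  have -> : (fun w => - X w) = (fun w => -1 * X w) by apply/funext => w; rewrite mulN1r.
  by rewrite meanZl// mulN1r.
lra.
Qed.

End Law.

(** * The stochastic integral is a martingale *)

Section ItoMartingale.
Context {R : realType} {disp : measure_display} {Omega : measurableType disp}.
Variables (P : probability Omega R) (F : R -> set (set Omega)).
Variables (d : nat) (W : R -> Omega -> d.-tuple R).
Hypothesis filtF : usual_filtration P F.
Hypothesis bmW : brownian_motion P F W.
Implicit Types (s t u v : R) (A : set Omega).

Let bm_coord t j : 0 <= t -> measurable_wrt (F t) (fun w => tnth (W t w) j).
Proof.
move=> t0 B mB; have := bm_adapted bmW t0.
move=> /(_ ((fun z : d.-tuple R => tnth z j) @^-1` B)); apply.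
by rewrite -[X in measurable X]setTI; exact: measurable_tnth.
Qed.

Let incr u v j w := tnth (W v w) j - tnth (W u w) j.

Let incr_meas u v j : 0 <= u -> u <= v -> measurable_fun setT (incr u v j).
Proof.
move=> u0 uv; have v0 := le_trans u0 uv.
apply: measurable_funB.
  exact: measurable_wrt_measurable (filt_sub filtF v0) (bm_coord j v0).
exact: measurable_wrt_measurable (filt_sub filtF u0) (bm_coord j u0).
Qed.

Let incr_law u v j A B : 0 <= u < v -> F u A -> measurable B ->
  (P (A `&` incr u v j @^-1` B) = P A * normal_prob 0 (Num.sqrt (v - u)) B)%E.
Proof.
move=> uv FA mB.
have := bm_increments bmW uv (B := fun i => if i == j then B else setT) FA.
rewrite (_ : [set w | forall i, _] = incr u v j @^-1` B); last first.
  apply/seteqP; split => w /=; first by move=> /(_ j); rewrite eqxx.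
  by move=> h i; case: eqP => [->|].
move=> -> //; last by move=> i; case: ifP.
congr (_ * _)%E; rewrite (bigD1 j)//= eqxx big1 ?mule1// => i ij.
by rewrite (negbTE ij) probability_setT.
Qed.

Lemma incr_mean u v j A : 0 <= u -> u <= v -> F u A ->
  integr P (incr u v j) /\ mean P (fun w => \1_A w * incr u v j w) = 0.
Proof.
move=> u0; rewrite le_eqVlt => /predU1P[<- FA|uv FA].
  rewrite (_ : incr u u j = cst 0); last by apply/funext => w; rewrite /incr subrr.
  split; first exact: integr_cst.
  by rewrite -[RHS](mean_cst P 0); congr mean; apply/funext => w /=; rewrite mulr0.
have mI := incr_meas j u0 (ltW uv).
have uv' : 0 <= u < v by rewrite u0.
have sF := filt_sigma filtF u0.
have s0 : Num.sqrt (v - u) != 0 by rewrite gt_eqF// sqrtr_gt0 subr_gt0.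
have law0 B : measurable B -> P (incr u v j @^-1` B) = normal_prob 0 (Num.sqrt (v - u)) B.
  move=> mB; have := incr_law j uv' (sigma_algebraT sF) mB.
  by rewrite setTI probability_setT mul1e.
have [iI mI0] := normal_law_integr s0 mI law0.
split => //.
have mA := filt_sub filtF u0 FA.
(* [H] is generated by the increment. Independence from [F u] says that 1_A - P(A) has mean zero
   over every event of [H], so it is orthogonal to the increment, which itself has mean zero. *)
pose H := preimage_set_system setT (incr u v j) measurable.
have sH : sigma_algebra setT H by exact: sigma_algebra_preimage (@sigma_algebra_measurable _ _).
have Hm : H `<=` measurable by move=> _ [B mB <-]; exact: mI.
have mXH : measurable_wrt H (incr u v j) by move=> B mB; exists B => //; rewrite setTI.
have iA (C : set Omega) : measurable C -> integr P (\1_C : Omega -> R).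
  move=> mC; have := integr_indicM mC (integr_cst P 1).
  by apply: eq_integrable => // w _ /=; rewrite mulr1.
have i1 : integr P (fun w => \1_A w - fine (P A)).
  by apply: integrB; [exact: iA|exact: integr_cst].
have i2 : integr P (fun w => incr u v j w * (\1_A w - fine (P A))).
  have := integrB (integr_indicM mA iI) (integrZl (fine (P A)) iI).
  by apply: eq_integrable => // w _ /=; congr (_%:E); ring.
have := @mean_pullout _ _ _ P H (incr u v j) _ sH Hm mXH i1 i2.
have -> : (fun w => incr u v j w * (\1_A w - fine (P A))) =
    (fun w => \1_A w * incr u v j w - fine (P A) * incr u v j w).
  by apply/funext => w; ring.
rewrite meanB; [|exact: integr_indicM|exact: integrZl].
rewrite meanZl// mI0 mulr0 subr0; apply => D [B mB]; rewrite setTI => <-.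
have mD : measurable (incr u v j @^-1` B) by apply: Hm; exists B => //; rewrite setTI.
have -> : (fun w => \1_(incr u v j @^-1` B) w * (\1_A w - fine (P A))) =
    (fun w => \1_(A `&` incr u v j @^-1` B) w - fine (P A) * \1_(incr u v j @^-1` B) w).
  by apply/funext => w; rewrite indicI /=; ring.
rewrite meanB; [|by apply: iA; exact: measurableI|by apply: integrZl; exact: iA].
have mE (C : set Omega) : measurable C -> mean P \1_C = fine (P C).
  by move=> mC; rewrite -(mean_indic P mC).
rewrite meanZl; last exact: iA.
rewrite !mE//; last exact: measurableI.
rewrite incr_law// -law0// fineM ?fin_num_measure// subrr//.
Qed.

Lemma coef_incr_mean u v j A (c : Omega -> R) K : 0 <= u -> u <= v -> F u A ->
  measurable_wrt (F u) c -> (forall w, `|c w| <= K) ->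
  integr P (fun w => c w * incr u v j w) /\
  mean P (fun w => \1_A w * (c w * incr u v j w)) = 0.
Proof.
move=> u0 uv FA mc cK.
have sF := filt_sigma filtF u0; have Fm := filt_sub filtF u0.
have mc' := measurable_wrt_measurable Fm mc.
have iI := (incr_mean j u0 uv FA).1.
have ic : integr P (fun w => c w * incr u v j w).
  apply: (integr_le _ (integrZl K iI)).
    by apply: measurable_funM => //; exact: integr_meas iI.
  by move=> w; rewrite !normrM ler_wpM2r// (le_trans (cK w))// ler_norm.
split=> //.
have e : (fun w => \1_A w * (c w * incr u v j w)) =
    (fun w => (\1_A w * c w) * incr u v j w) by apply/funext => w; rewrite mulrA.
rewrite e; apply: (@mean_pullout _ _ _ P (F u)) => //.
- apply/measurable_wrtE => //; apply: measurable_funM; last exact/measurable_wrtE.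
  by apply: measurable_indic; rewrite measurable_g_measurableTypeE.
- by rewrite -e; apply: integr_indicM => //; exact: Fm.
- by move=> D FD; have [] := incr_mean j u0 uv FD.
Qed.

Section Simple.
Variables (T : R) (H : simple_process F d T).

Let tm_ge0 k : (k <= sp_size H)%N -> 0 <= sp_time H k.
Proof.
elim: k => [|k IH] kH; first exact: sp_time_ge0.
by rewrite (le_trans (IH (ltnW kH)))// sp_time_mono.
Qed.

Let coef_meas k j : (k < sp_size H)%N ->
  measurable_wrt (F (sp_time H k)) (fun w => tnth (sp_coef H k w) j).
Proof.
move=> kH B mB; have := sp_coef_meas kH.
move=> /(_ ((fun z : d.-tuple R => tnth z j) @^-1` B)); apply.
by rewrite -[X in measurable X]setTI; exact: measurable_tnth.
Qed.

Let coef_bound : exists K, forall k j w, (k < sp_size H)%N ->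
  `|tnth (sp_coef H k w) j| <= K.
Proof.
have [K hK] := sp_coef_bounded H; exists K => k j w kH.
apply: le_trans (hK k w kH); rewrite /enorm /dot_tuple -sqrtr_sqr ler_sqrt.
  by rewrite (bigD1 j)//= expr2 lerDl sumr_ge0// => i _; rewrite -expr2 sqr_ge0.
by apply: sumr_ge0 => i _; rewrite -expr2 sqr_ge0.
Qed.

Lemma sp_integralE t w : sp_integral W H t w = \sum_(k < sp_size H)
  \sum_(j < d) tnth (sp_coef H k w) j *
    incr (Num.min t (sp_time H k)) (Num.min t (sp_time H k.+1)) j w.
Proof.
apply: eq_bigr => k _; apply: eq_bigr => j _.
by rewrite /sub_tuple tnth_mktuple.
Qed.

(** Restricted to ]s, t], each summand is zero or a known coefficient times an increment beginning
    at max(s, t_k); the case distinctions locate s and t relative to the cell. *)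
Lemma sp_integral_martingale s t A : 0 <= s -> s <= t -> F s A ->
  [/\ integr P (sp_integral W H s), integr P (sp_integral W H t) &
    mean P (fun w => \1_A w * (sp_integral W H t w - sp_integral W H s w)) = 0].
Proof.
move=> s0 st FA; have [K hK] := coef_bound.
have FT u : 0 <= u -> F u setT by move=> u0; exact: sigma_algebraT (filt_sigma filtF u0).
have term_int r k j : 0 <= r -> (k < sp_size H)%N ->
    integr P (fun w => tnth (sp_coef H k w) j *
      incr (Num.min r (sp_time H k)) (Num.min r (sp_time H k.+1)) j w).
  move=> r0 kH.
  have a0 := tm_ge0 (ltnW kH); have ab := sp_time_mono kH.
  have [rk|kr] := leP r (sp_time H k).
    rewrite (min_idPl (le_trans rk ab)).
    have -> : (fun w => tnth (sp_coef H k w) j * incr r r j w) = cst 0.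
      by apply/funext => w; rewrite /incr subrr mulr0.
    exact: integr_cst.
  have le1 : sp_time H k <= Num.min r (sp_time H k.+1) by rewrite le_min (ltW kr).
  have [] := @coef_incr_mean (sp_time H k) (Num.min r (sp_time H k.+1)) j setT
    (fun w => tnth (sp_coef H k w) j) K a0 le1 (FT _ a0) (coef_meas j kH) => //.
  by move=> w; exact: hK.
have sp_int r : 0 <= r -> integr P (sp_integral W H r).
  move=> r0; rewrite (_ : sp_integral W H r = (fun w => \sum_(k < sp_size H)
    \sum_(j < d) tnth (sp_coef H k w) j *
    incr (Num.min r (sp_time H k)) (Num.min r (sp_time H k.+1)) j w)).
    by apply: integr_bigsum => k; apply: integr_bigsum => j; exact: term_int.
  by apply/funext => w; exact: sp_integralE.
have t0 := le_trans s0 st.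
split; [exact: sp_int|exact: sp_int|].
have mA := filt_sub filtF s0 FA.
rewrite (_ : (fun w => _) = (fun w => \sum_(k < sp_size H) \sum_(j < d)
  (\1_A w * (tnth (sp_coef H k w) j *
     incr (Num.min t (sp_time H k)) (Num.min t (sp_time H k.+1)) j w) -
   \1_A w * (tnth (sp_coef H k w) j *
     incr (Num.min s (sp_time H k)) (Num.min s (sp_time H k.+1)) j w)))); last first.
  apply/funext => w; rewrite !sp_integralE -sumrB mulr_sumr.
  apply: eq_bigr => k _; rewrite -sumrB mulr_sumr.
  by apply: eq_bigr => j _; rewrite mulrBr.
have it r k j : 0 <= r -> (k < sp_size H)%N -> integr P (fun w => \1_A w *
    (tnth (sp_coef H k w) j *
     incr (Num.min r (sp_time H k)) (Num.min r (sp_time H k.+1)) j w)).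
  by move=> r0 kH; apply: integr_indicM => //; exact: term_int.
rewrite mean_bigsum; last first.
  by move=> k; apply: integr_bigsum => j; apply: integrB; exact: it.
apply: big1 => k _; rewrite mean_bigsum; last by move=> j; apply: integrB; exact: it.
apply: big1 => j _.
have kH := ltn_ord k; have a0 := tm_ge0 (ltnW kH); have ab := sp_time_mono kH.
pose c w := tnth (sp_coef H k w) j.
have incr0 u : mean P (fun w => \1_A w * (c w * incr u u j w)) = 0.
  rewrite -[RHS](mean_cst P 0); congr mean; apply/funext => w.
  by rewrite /incr subrr !mulr0.
have [sk|] := boolP (s <= sp_time H k).
  rewrite meanB; [|exact: it..].
  rewrite (min_idPl sk) (min_idPl (le_trans sk ab)) incr0 subr0.
  have [tk|] := boolP (t <= sp_time H k).
    by rewrite (min_idPl tk) (min_idPl (le_trans tk ab)) incr0.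
  rewrite -ltNge => kt; rewrite (min_idPr (ltW kt)).
  have le1 : sp_time H k <= Num.min t (sp_time H k.+1) by rewrite le_min (ltW kt).
  have FkA : F (sp_time H k) A by apply: (filt_mono filtF) FA; rewrite s0.
  by have [] := coef_incr_mean j a0 le1 FkA (coef_meas j kH) (fun w => hK k j w kH).
(* The cell has begun before [s]: the part up to [s] cancels, and the coefficient is known at
   [s]. *)
rewrite -ltNge => ks; rewrite (min_idPr (ltW ks)) (min_idPr (le_trans (ltW ks) st)).
rewrite (_ : (fun w => _) = (fun w => \1_A w * (c w *
    incr (Num.min s (sp_time H k.+1)) (Num.min t (sp_time H k.+1)) j w))); last first.
  by apply/funext => w; rewrite /incr /c; ring.
have [bs|] := boolP (sp_time H k.+1 <= s).
  by rewrite (min_idPr bs) (min_idPr (le_trans bs st)) incr0.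
rewrite -ltNge => sb; rewrite (min_idPl (ltW sb)).
have le1 : s <= Num.min t (sp_time H k.+1) by rewrite le_min st ltW.
have cm : measurable_wrt (F s) c.
  apply: measurable_wrt_sub (coef_meas j kH); apply: (filt_mono filtF).
  by rewrite a0 ltW.
by have [] := coef_incr_mean j s0 le1 FA cm (fun w => hK k j w kH).
Qed.

End Simple.

(** The inequality |x| <= e + x^2 / e turns smallness in L^2 into smallness in L^1; each of its two
    terms contributes at most [e]. *)
Lemma integr_of_sqr (X : Omega -> R) e : 0 < e -> measurable_fun setT X ->
  (\int[P]_w ((X w) ^+ 2)%:E < (e ^+ 2)%:E)%E ->
  integr P X /\ mean P (fun w => `|X w|) <= 2 * e.
Proof.
move=> e0 mX X2.
have mX2 : measurable_fun setT (fun w => X w ^+ 2) by exact: measurable_funX.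
have iX2 : integr P (fun w => X w ^+ 2).
  apply/integrableP; split; first exact/measurable_EFinP.
  under eq_integral do rewrite /= ger0_norm ?sqr_ge0//.
  by apply: lt_trans X2 _; rewrite ltry.
have bnd w : `|X w| <= e + e^-1 * X w ^+ 2.
  rewrite -(real_normK (num_real (X w))); move: `|X w| (normr_ge0 (X w)) => x x0.
  rewrite (_ : e + _ = (e ^+ 2 + x ^+ 2) / e); last by field; rewrite gt_eqF.
  by rewrite ler_pdivlMr//; nra.
have ib : integr P (fun w => e + e^-1 * X w ^+ 2).
  by apply: integrD; [exact: integr_cst|exact: integrZl].
have iX : integr P X.
  by apply: (integr_le mX ib) => w; rewrite (le_trans (bnd w))// ler_norm.
split=> //; apply: (le_trans (le_mean (integr_norm iX) ib bnd)).
rewrite meanD; [|exact: integr_cst|exact: integrZl].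
rewrite (mean_cst P e) meanZl//.
have : mean P (fun w => X w ^+ 2) < e ^+ 2 by rewrite -lte_fin -integrE.
move=> h; have : e^-1 * mean P (fun w => X w ^+ 2) <= e.
  by rewrite ler_pdivrMl// -expr2 ltW.
lra.
Qed.

(** Simple integrals are martingales and approach [I] in L^1 at each fixed time; integrability and
    the vanishing mean of increments over [A] pass to that limit. *)
Lemma ito_martingale T Z I : is_ito_integral P F W T Z I ->
  (forall t, 0 <= t <= T -> integr P (I t)) /\
  forall s t A, 0 <= s -> s <= t -> t <= T -> F s A ->
    mean P (fun w => \1_A w * (I t w - I s w)) = 0.
Proof.
move=> [aI cI [H [_ HI]]].
have mI t : 0 <= t <= T -> measurable_fun setT (I t).
  move=> /[dup] tT /andP[t0 _].
  exact: measurable_wrt_measurable (filt_sub filtF t0) (aI t tT).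
have FT u : 0 <= u -> F u setT by move=> u0; exact: sigma_algebraT (filt_sigma filtF u0).
have sp_int n t : 0 <= t -> integr P (sp_integral W (H n) t).
  by move=> t0; have [] := sp_integral_martingale (H n) t0 (lexx t) (FT _ t0).
have close t e : 0 <= t <= T -> 0 < e -> \forall n \near \oo,
    integr P (fun w => sp_integral W (H n) t w - I t w) /\
    mean P (fun w => `|sp_integral W (H n) t w - I t w|) <= 2 * e.
  move=> tT e0; have /andP[t0 _] := tT.
  have e20 : 0 < e ^+ 2 by rewrite exprn_gt0.
  have /fine_cvgP[fin /cvgr_lt lt_e] := HI t tT.
  apply: filterS2 fin (lt_e _ e20) => n fin_n h.
  have {h} : (\int[P]_w ((sp_integral W (H n) t w - I t w) ^+ 2)%:E < (e ^+ 2)%:E)%E.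
    by rewrite -(fineK fin_n) lte_fin.
  move=> h; apply: integr_of_sqr e0 _ h; apply: measurable_funB; last exact: mI.
  exact: integr_meas (sp_int n t t0).
have iI t : 0 <= t <= T -> integr P (I t).
  move=> tT; have [n _ /(_ n (leqnn n)) [h _]] := close t 1 tT ltr01.
  have /andP[t0 _] := tT.
  have := integrB (sp_int n t t0) h.
  by apply: eq_integrable => // w _ /=; rewrite opprB addrC subrK.
split=> // s t A s0 st tT FA.
have sT : 0 <= s <= T by rewrite s0 (le_trans st).
have tT' : 0 <= t <= T by rewrite tT (le_trans s0).
have mA := filt_sub filtF s0 FA.
apply/eqP; rewrite -normr_le0; apply/ler_addgt0Pr => e e0; rewrite add0r.
(* There are two approximation errors, at [s] and at [t], each at most 2 (e / 4). *)
have e4 : 0 < e / 4 by rewrite divr_gt0.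
have [n _ /(_ n (leqnn n)) [[is_ ms] [it mt]]] :=
  filterI (close s _ sT e4) (close t _ tT' e4).
have [is0 it0 m0] := sp_integral_martingale (H n) s0 st FA.
have -> : (fun w => \1_A w * (I t w - I s w)) = (fun w =>
   \1_A w * (sp_integral W (H n) t w - sp_integral W (H n) s w) -
   (\1_A w * (sp_integral W (H n) t w - I t w) -
    \1_A w * (sp_integral W (H n) s w - I s w))).
  by apply/funext => w; ring.
have i1 := integr_indicM mA it; have i2 := integr_indicM mA is_.
rewrite meanB; [|by apply: integr_indicM => //; exact: integrB|exact: integrB].
rewrite m0 sub0r normrN meanB//.
have small X : integr P X -> mean P (fun w => `|X w|) <= 2 * (e / 4) ->
    `|mean P (fun w => \1_A w * X w)| <= 2 * (e / 4).
  move=> iX; apply: le_trans.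
  apply: (le_trans (le_normr_Rintegral measurableT (integr_indicM mA iX))).
  apply: le_mean; [exact: integr_norm (integr_indicM mA iX)|exact: integr_norm|].
  move=> w; rewrite normrM indicE.
  by case: (_ \in _); rewrite ?normr1 ?mul1r// normr0 mul0r.
rewrite (le_trans (ler_normB _ _))//.
have := small _ is_ ms; have := small _ it mt; lra.
Qed.

End ItoMartingale.

(** * Lower integrals, joint measurability and time integrals *)

Section LowerIntegral.
Local Open Scope ereal_scope.
Import HBNNSimple.

(* No measurability is assumed: the integral of a nonnegative function is a
   supremum over the simple functions below it. *)
Lemma ge0_le_lower_integral d (T : measurableType d) (R : realType)
    (mu : {measure set T -> \bar R}) (f g : T -> \bar R) :
  (forall x, 0 <= f x) -> (forall x, f x <= g x) ->
  \int[mu]_x f x <= \int[mu]_x g x.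
Proof.
move=> f0 fg; rewrite !ge0_integralTE//; last first.
  by move=> x; exact: le_trans (f0 x) (fg x).
apply: le_ereal_sup => _ [h /= hf <-]; exists h => //= x.
exact: le_trans (hf x) (fg x).
Qed.

End LowerIntegral.

Section JointMeasurability.
Context {R : realType} {disp : measure_display} {Omega : measurableType disp}.
Variables (P : probability Omega R) (T : R).
Local Notation mu := (@lebesgue_measure R).
Local Notation strip := (`[0, T]%classic `*` [set: Omega]).

Let strip_meas : measurable (strip : set (measurableTypeR R * Omega)).
Proof. exact: measurableX. Qed.

Lemma joint_section (X : R -> Omega -> R) w : jointly_measurable T X ->
  measurable_fun `[0, T] (fun s : measurableTypeR R => X s w).
Proof.
move=> jX.
have := measurable_comp strip_meas _ jX
  (measurable_funTS (D := `[0, T]) (pair2_measurable w)).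
by apply => _ [s sT <-].
Qed.

Lemma joint_time_integral (X : R -> Omega -> R) :
  jointly_measurable T X -> (forall s w, 0 <= X s w) ->
  measurable_fun setT (fun w => \int[mu]_(s in `[0%R, T]) (X s w)%:E)%E /\
  (\int[P]_w \int[mu]_(s in `[0%R, T]) (X s w)%:E =
   \int[mu]_(s in `[0%R, T]) \int[P]_w (X s w)%:E)%E.
Proof.
move=> jX X0.
(* Measurability is given only on the strip of times in [0, T]; extension by zero yields a function
   on the whole product, to which Tonelli applies. *)
pose h : measurableTypeR R * Omega -> \bar R :=
  EFin \o ((fun p => X p.1 p.2) \_ strip).
have mh : measurable_fun setT h.
  by apply/measurable_EFinP; apply/(measurable_restrictT _ strip_meas).
have h0 p : (0 <= h p)%E by rewrite lee_fin patchE; case: ifP.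
have hE s w : s \in `[0%R, T]%classic -> h (s, w) = (X s w)%:E.
  by move=> sT; rewrite /h /= patchE mem_set//; split=> //=; exact: set_mem.
have hN s w : s \notin `[0%R, T]%classic -> h (s, w) = 0%E.
  move=> sT; rewrite /h /= patchE memNset//= => -[/= h' _].
  by move/negP : sT; apply; exact/mem_set.
have e w : (\int[mu]_(s in `[0%R, T]) (X s w)%:E = \int[mu]_s h (s, w))%E.
  rewrite integral_mkcond; apply: eq_integral => s _; rewrite patchE.
  by case: ifPn => [/hE ->//|/hN ->].
split.
  under eq_fun do rewrite e.
  exact: (measurable_fun_fubini_tonelli_G (m1 := mu) h).
under eq_integral do rewrite e.
rewrite -(@fubini_tonelli _ _ _ _ _ mu P h mh h0).
rewrite [RHS]integral_mkcond; apply: eq_integral => s _; rewrite patchE.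
case: ifPn => [sT|sT]; first by apply: eq_integral => w _; rewrite hE.
by rewrite integral0_eq// => w _; rewrite hN.
Qed.

Lemma joint_integrable (X : R -> Omega -> R) :
  jointly_measurable T X -> (forall s w, 0 <= X s w) ->
  (\int[P]_w \int[mu]_(s in `[0%R, T]) (X s w)%:E < +oo)%E ->
  integr P (fun w => \int[mu]_(s in `[0, T]) X s w) /\
  {ae P, forall w, mu.-integrable `[0, T] (fun s => (X s w)%:E)}.
Proof.
move=> jX X0 fin; have [mI _] := joint_time_integral jX X0.
have I0 w : (0 <= \int[mu]_(s in `[0%R, T]) (X s w)%:E)%E.
  by apply: integral_ge0 => s _; rewrite lee_fin.
have iI : P.-integrable setT (fun w => \int[mu]_(s in `[0%R, T]) (X s w)%:E)%E.
  apply/integrableP; split=> //.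
  by under eq_integral do rewrite gee0_abs//.
have aefin := integrable_ae measurableT iI.
split; last first.
  apply: filterS aefin => w /(_ I) fw; apply/integrableP; split.
    by apply/measurable_EFinP; exact: joint_section.
  under eq_integral do rewrite gee0_abs ?lee_fin//.
  by rewrite ltey_eq fw.
apply/integrableP; split.
  by apply/measurable_EFinP; apply: measurableT_comp mI; exact: fine_measurable.
move: fin; apply: le_lt_trans; apply: ge0_le_lower_integral => // w.
rewrite /= ger0_norm; last by apply: Rintegral_ge0.
rewrite /Rintegral; by case: (\int[mu]_(_ in _) _)%E (I0 w) => //=.
Qed.

Lemma jointly_measurableP d (E : measurableType d) (X : R -> Omega -> E) :
  jointly_measurable T X <->
  measurable_fun [set: measurableTypeR R * Omega] ((fun p => X p.1 p.2) \_ strip).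
Proof. exact: measurable_restrictT. Qed.

Lemma joint_compose d (f : R -> Omega -> R -> d.-tuple R -> R)
    (Y : R -> Omega -> R) (Z : R -> Omega -> d.-tuple R) :
  measurable_fun
    [set p : measurableTypeR R * Omega * R * d.-tuple R | 0 <= p.1.1.1 <= T]
    (fun p : measurableTypeR R * Omega * R * d.-tuple R =>
       f p.1.1.1 p.1.1.2 p.1.2 p.2) ->
  jointly_measurable T Y -> jointly_measurable T Z ->
  jointly_measurable T (fun s w => f s w (Y s w) (Z s w)).
Proof.
move=> mf /jointly_measurableP mY /jointly_measurableP mZ.
set E := (X in measurable_fun X _) in mf.
pose Y' := (fun p : measurableTypeR R * Omega => Y p.1 p.2) \_ strip.
pose Z' := (fun p : measurableTypeR R * Omega => Z p.1 p.2) \_ strip.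
have mE : measurable E.
  have -> : E = (fun p : measurableTypeR R * Omega * R * d.-tuple R =>
      p.1.1.1) @^-1` `[0, T].
    by apply/seteqP; split=> p /=; rewrite in_itv.
  rewrite -[X in measurable X]setTI.
  have : measurable_fun setT (fun p : measurableTypeR R * Omega * R * d.-tuple R =>
      p.1.1.1).
    by apply: measurableT_comp => //; apply: measurableT_comp.
  by apply.
have m4 : measurable_fun strip (fun p : measurableTypeR R * Omega =>
    (p, Y' p, Z' p)).
  apply: measurable_funTS; apply: measurable_fun_pair => //.
  exact: measurable_fun_pair.
have sub : (fun p : measurableTypeR R * Omega => (p, Y' p, Z' p)) @` strip `<=` E.
  by move=> _ [[s w] [/= sT _] <-] /=; move: sT; rewrite in_itv.
apply: eq_measurable_fun (measurable_comp mE sub mf m4) => -[s w] sw /=.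
by rewrite /Y' /Z' !patchE sw.
Qed.

End JointMeasurability.

Section TimeIntegrals.
Context {R : realType}.
Local Notation mu := (@lebesgue_measure R).
Implicit Types (g : R -> R) (a b T : R).

Lemma Rintegral_itv_split g T a b : mu.-integrable `[0, T] (EFin \o g) ->
  0 <= a -> a <= b -> b <= T ->
  \int[mu]_(s in `[a, T]) g s =
    \int[mu]_(s in `[a, b]) g s + \int[mu]_(s in `[b, T]) g s.
Proof.
move=> ig a0 ab bT.
have ig' : mu.-integrable `[a, T] (EFin \o g).
  by apply: integrableS ig => //; apply: subset_itvr; rewrite bnd_simp.
have ig2 : mu.-integrable `]b, T] (EFin \o g).
  by apply: integrableS ig' => //; apply: subset_itvr; rewrite bnd_simp.
rewrite -(Rintegral_itv_obnd_cbnd ig2) -(Rintegral_itvB ig') ?bnd_simp//.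
by rewrite addrC subrK.
Qed.

Lemma Rintegral_norm_le g h T b : mu.-integrable `[0, T] (EFin \o g) ->
  mu.-integrable `[0, T] (EFin \o h) -> 0 <= b <= T ->
  (forall s, 0 <= s <= T -> `|g s| <= h s) ->
  `|\int[mu]_(s in `[0, b]) g s| <= \int[mu]_(s in `[0, T]) h s.
Proof.
move=> ig ih /andP[b0 bT] gh.
have sub : `[0, b] `<=` `[0, T] by apply: subset_itvl; rewrite bnd_simp.
have ig' : mu.-integrable `[0, b] (EFin \o g) by exact: integrableS ig.
have ih' : mu.-integrable `[0, b] (EFin \o h) by exact: integrableS ih.
apply: (le_trans (le_normr_Rintegral _ ig')) => //.
apply: (@le_trans _ _ (\int[mu]_(s in `[0, b]) h s)).
  apply: le_Rintegral => //; first exact: integrable_norm.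
  move=> s /=; rewrite in_itv /= => /andP[s0 sb]; apply: gh.
  by rewrite s0 (le_trans sb).
rewrite (Rintegral_itv_split ih (lexx 0) b0 bT) lerDl.
apply: Rintegral_ge0 => s /=; rewrite in_itv /= => /andP[bs sT].
by rewrite (le_trans (normr_ge0 (g s)))// gh// sT (le_trans b0).
Qed.

Lemma cst_itv_integrable T r : mu.-integrable `[0, T] (EFin \o cst r).
Proof.
apply: continuous_compact_integrable; first exact: segment_compact.
by apply: continuous_subspaceT => x; exact: cvg_cst.
Qed.

Lemma Rintegral_cst_itv T r : 0 <= T -> \int[mu]_(s in `[0, T]) (cst r s) = r * T.
Proof.
move=> T0; rewrite Rintegral_cst//= lebesgue_measure_itv /= lte_fin.
by move: T0; rewrite le_eqVlt => /predU1P[<-|->]; rewrite ?ltxx ?mulr0//= ?subr0.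
Qed.

End TimeIntegrals.

(** With this, square-integrability of the data and of the solution yields the L^1 dominations
    below. *)
Lemma normr_le_1Dsqr {R : realType} (x : R) : `|x| <= 1 + `|x| ^+ 2.
Proof. by have := normr_ge0 x; nra. Qed.

Lemma pos_part_sub_le {R : realType} (x y : R) :
  `|Num.max 0 (x - y)| <= `|x| + `|y|.
Proof.
have [h|h] := leP 0 (x - y); last by rewrite normr0 addr_ge0.
by rewrite ler_normB.
Qed.

(** * Domination from square-integrable suprema *)

Section SupSquare.
Context {R : realType} {disp : measure_display} {Omega : measurableType disp}.
Variables (P : probability Omega R) (T : R).
Hypothesis T_ge0 : 0 <= T.

(** The supremum of [Y] over uncountably many times may fail to be measurable. That of the
    continuous [X] is attained, hence lies pointwise below it, and lower integrals compare the two.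
    The use for the solution has its continuous version as [X]. *)
Lemma run_sup_sqr_integr (X Y : R -> Omega -> R) :
  (forall w, {within `[0, T], continuous (fun s => X s w)}) ->
  (forall s, 0 <= s <= T -> measurable_fun setT (X s)) ->
  (forall s w, `|X s w| <= `|Y s w|) ->
  (\int[P]_w ereal_sup [set (`|Y s w| ^+ 2)%:E | s in `[0%R, T]] < +oo)%E ->
  integr P (run_sup 0 T (fun s w => X s w ^+ 2)) /\
  forall s w, 0 <= s <= T -> `|X s w| <= 1 + run_sup 0 T (fun s w => X s w ^+ 2) w.
Proof.
move=> cX mX XY fin.
have cX2 w : {within `[0, T], continuous (fun s => X s w ^+ 2)}.
  have -> : (fun s => X s w ^+ 2) = (fun s => X s w * X s w).
    by apply/funext => s; rewrite expr2.
  by move=> s; apply: cvgM; exact: cX.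
split; last first.
  move=> s w sT; apply: le_trans (normr_le_1Dsqr _) _.
  rewrite lerD2l real_normK ?num_real//.
  by have [+ _] := @run_supP _ _ _ 0 T (fun s w => X s w ^+ 2) w T_ge0 (cX2 w); exact.
have mS : measurable_wrt (@measurable _ Omega) (run_sup 0 T (fun s w => X s w ^+ 2)).
  apply: measurable_run_sup => //; first exact: sigma_algebra_measurable.
  move=> s sT B mB; rewrite -[_ @^-1` _]setTI.
  by have : measurable_fun setT (fun w => X s w ^+ 2) by [exact: measurable_funX (mX s sT)]; exact.
apply/integrableP; split.
  apply/measurable_EFinP; apply: measurable_wrt_measurable mS => //.
apply: le_lt_trans fin; apply: ge0_le_lower_integral => // w /=.
have [_ [c cT ->]] := @run_supP _ _ _ 0 T (fun s w => X s w ^+ 2) w T_ge0 (cX2 w).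
apply: (@le_trans _ _ (`|Y c w| ^+ 2)%:E).
  rewrite lee_fin ger0_norm ?sqr_ge0// -(real_normK (num_real (X c w))).
  by rewrite ler_sqr ?nnegrE.
by apply: ereal_sup_ubound; exists c => //=; rewrite in_itv.
Qed.

(** After Tonelli, each time slice has second moment at most the constant [C] by monotonicity of
    lower integrals; integrating over time gives at most C T. *)
Lemma joint_sup_lty (Y : R -> Omega -> R) : jointly_measurable T Y ->
  (\int[P]_w ereal_sup [set (`|Y s w| ^+ 2)%:E | s in `[0%R, T]] < +oo)%E ->
  (\int[P]_w \int[lebesgue_measure]_(s in `[0%R, T]) (`|Y s w| ^+ 2)%:E < +oo)%E.
Proof.
move=> jY; set C := (\int[P]_w _)%E => fin.
have jY2 : jointly_measurable T (fun s w => `|Y s w| ^+ 2).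
  by apply: measurable_funX; apply: measurableT_comp => //.
have [_ ->] := joint_time_integral P jY2 (fun s w => sqr_ge0 _).
have C0 : (0 <= C)%E.
  apply: integral_ge0 => w _; apply: (@le_trans _ _ (`|Y 0 w| ^+ 2)%:E).
    by rewrite lee_fin sqr_ge0.
  by apply: ereal_sup_ubound; exists 0 => //=; rewrite in_itv /= lexx.
apply: (@le_lt_trans _ _ (\int[lebesgue_measure]_(s in `[0%R, T]) (cst C s))%E).
  rewrite integral_mkcond [leRHS]integral_mkcond; apply: ge0_le_lower_integral.
    by move=> s; rewrite patchE; case: ifP => // _; apply: integral_ge0 => w _; rewrite lee_fin sqr_ge0.
  move=> s; rewrite !patchE; case: ifPn => // /set_mem sT.
  apply: ge0_le_lower_integral => w; first by rewrite lee_fin sqr_ge0.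
  by apply: ereal_sup_ubound; exists s.
rewrite integral_cst//= lebesgue_measure_itv /=; case: ifP => _; last by rewrite mule0 ltry.
by rewrite lte_mul_pinfty// ?ge0_fin_numE// -EFinB ltry.
Qed.

End SupSquare.

Section EuclideanNorm.
Context {R : realType} {d : nat}.

Lemma enorm_sqr (z : d.-tuple R) : enorm z ^+ 2 = \sum_(j < d) tnth z j ^+ 2.
Proof.
rewrite /enorm sqr_sqrtr; first by apply: eq_bigr => j _; rewrite expr2.
by apply: sumr_ge0 => j _; rewrite -expr2 sqr_ge0.
Qed.

Lemma measurable_enorm_sqr : measurable_fun setT (fun z : d.-tuple R => enorm z ^+ 2).
Proof.
under eq_fun do rewrite enorm_sqr.
by apply: measurable_sum => j; apply: measurable_funX; exact: measurable_tnth.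
Qed.

Lemma sub_tuple0 (z : d.-tuple R) : sub_tuple z zero_tuple = z.
Proof.
apply: eq_from_tnth => j; rewrite /sub_tuple tnth_mktuple.
have -> : tnth zero_tuple j = 0 :> R by rewrite (tnth_nth 0) /= nth_nseq ltn_ord.
by rewrite subr0.
Qed.

Lemma enorm_ge0 (z : d.-tuple R) : 0 <= enorm z. Proof. exact: sqrtr_ge0. Qed.

End EuclideanNorm.

(** * Continuous version of the solution and a common dominating variable *)

Section Regularity.
Context {R : realType} {disp : measure_display} {Omega : measurableType disp}.
Variables (P : probability Omega R) (F : R -> set (set Omega)).
Variables (d : nat) (W : R -> Omega -> d.-tuple R) (T lam : R).
Variables (xi : Omega -> R) (f : R -> Omega -> R -> d.-tuple R -> R).
Variables (S Y : R -> Omega -> R) (Z : R -> Omega -> d.-tuple R).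
Hypothesis bmW : brownian_motion P F W.
Hypothesis T_gt0 : 0 < T.
Hypothesis lam_gt0 : 0 < lam.
Hypothesis filtF : usual_filtration P F.
Hypothesis data : standing_assumption P F T xi f S.
Hypothesis solYZ : penalized_solution P F T xi f S W lam Y Z.
Local Notation mu := (@lebesgue_measure R).

Let driver s w := f s w (Y s w) (Z s w).
Let f0 s w := f s w 0 zero_tuple.
Let gap s w := lam * Num.max 0 (S s w - Y s w).
Let T_ge0 := ltW T_gt0.

Let driver_joint : jointly_measurable T driver.
Proof. exact: joint_compose (f_meas data) (Y_meas solYZ) (Z_meas solYZ). Qed.

Let f0_joint : jointly_measurable T f0.
Proof.
apply: (joint_compose (Y := fun _ _ => 0) (Z := fun _ _ => zero_tuple) (f_meas data)).
  exact: measurable_cst.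
exact: measurable_cst.
Qed.

Let sqr_f0 : integr P (fun w => \int[mu]_(s in `[0, T]) (`|f0 s w| ^+ 2)) /\
  {ae P, forall w, mu.-integrable `[0, T] (fun s => (`|f0 s w| ^+ 2)%:E)}.
Proof.
apply: joint_integrable => [|s w|]; [|exact: sqr_ge0|exact: f0_L2 data].
by apply: measurable_funX; apply: measurableT_comp => //; exact: f0_joint.
Qed.

Let sqr_Y : integr P (fun w => \int[mu]_(s in `[0, T]) (`|Y s w| ^+ 2)) /\
  {ae P, forall w, mu.-integrable `[0, T] (fun s => (`|Y s w| ^+ 2)%:E)}.
Proof.
apply: joint_integrable => [|s w|]; [|exact: sqr_ge0|].
  by apply: measurable_funX; apply: measurableT_comp => //; exact: Y_meas solYZ.
apply: (joint_sup_lty T_ge0); [exact: Y_meas solYZ|exact: Y_L2 solYZ].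
Qed.

Let sqr_Z : integr P (fun w => \int[mu]_(s in `[0, T]) (enorm (Z s w) ^+ 2)) /\
  {ae P, forall w, mu.-integrable `[0, T] (fun s => (enorm (Z s w) ^+ 2)%:E)}.
Proof.
apply: joint_integrable => [|s w|]; [|exact: sqr_ge0|exact: Z_L2 solYZ].
by have mZ := Z_meas solYZ; exact: measurableT_comp measurable_enorm_sqr mZ.
Qed.

Section Pathwise.
Variables (I : R -> Omega -> R) (C : R) (w : Omega).
Hypothesis C_ge0 : 0 <= C.
Hypothesis I_cont : {within `[0, T], continuous (fun t => I t w)}.
Hypothesis lip : forall (t y y' : R) (z z' : d.-tuple R), 0 <= t <= T ->
  `|f t w y z - f t w y' z'| <= C * (`|y - y'| + enorm (sub_tuple z z')).
Hypothesis f0_int : mu.-integrable `[0, T] (fun s => (`|f0 s w| ^+ 2)%:E).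
Hypothesis Y_int : mu.-integrable `[0, T] (fun s => (`|Y s w| ^+ 2)%:E).
Hypothesis Z_int : mu.-integrable `[0, T] (fun s => (enorm (Z s w) ^+ 2)%:E).
Hypothesis equation : forall t : R, 0 <= t <= T ->
  Y t w = xi w + \int[mu]_(s in `[t, T]) driver s w
   + \int[mu]_(s in `[t, T]) gap s w - (I T w - I t w).

(** Lipschitz growth of the driver with every norm replaced by one plus its square, so that the L^2
    assumptions make it integrable in time. *)
Let bound s := (1 + `|f0 s w| ^+ 2) +
  C * ((1 + `|Y s w| ^+ 2) + (1 + enorm (Z s w) ^+ 2)).

Let driver_le s : 0 <= s <= T -> `|driver s w| <= bound s.
Proof.
move=> sT; have := lip (Y s w) 0 (Z s w) zero_tuple sT.
rewrite subr0 sub_tuple0 -/(driver s w) -/(f0 s w) => h.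
have h1 := normr_le_1Dsqr (f0 s w).
have h2 := normr_le_1Dsqr (Y s w).
have h3 := normr_le_1Dsqr (enorm (Z s w)).
rewrite ger0_norm ?enorm_ge0// in h3.
have h4 : C * (`|Y s w| + enorm (Z s w)) <=
    C * ((1 + `|Y s w| ^+ 2) + (1 + enorm (Z s w) ^+ 2)).
  by rewrite ler_wpM2l// lerD.
have := ler_normD (driver s w - f0 s w) (f0 s w); rewrite subrK /bound; lra.
Qed.

Let one_int g : mu.-integrable `[0, T] (fun s : R => (g s)%:E) ->
  mu.-integrable `[0, T] (fun s => (1 + g s)%:E).
Proof. by move=> ig; exact: integrableD (cst_itv_integrable T 1) ig. Qed.

Let YZ_int : mu.-integrable `[0, T]
  (fun s => ((1 + `|Y s w| ^+ 2) + (1 + enorm (Z s w) ^+ 2))%:E).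
Proof. by exact: integrableD (one_int Y_int) (one_int Z_int). Qed.

Let bound_int : mu.-integrable `[0, T] (EFin \o bound).
Proof. by exact: integrableD (one_int f0_int) (integrableZl _ C YZ_int). Qed.

Lemma driver_integrable : mu.-integrable `[0, T] (fun s => (driver s w)%:E).
Proof.
apply: le_integrable bound_int => //.
  by apply/measurable_EFinP; exact: joint_section driver_joint.
move=> s /=; rewrite in_itv /= => sT; rewrite lee_fin.
by rewrite (le_trans (driver_le sT))// ler_norm.
Qed.

Let S_int : mu.-integrable `[0, T] (fun s => (S s w)%:E).
Proof.
apply: continuous_compact_integrable; first exact: segment_compact.
exact: S_continuous data w.
Qed.

Let gap_integrable : mu.-integrable `[0, T] (fun s => (gap s w)%:E).
Proof.
suff h : mu.-integrable `[0, T] (fun s => (Num.max 0 (S s w - Y s w))%:E).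
  by apply: eq_integrable (integrableZl _ lam h) => //.
have iS := integrableD _ (integrable_norm S_int) (one_int Y_int).
apply: le_integrable (iS _) => //.
  apply/measurable_EFinP; apply: measurable_maxr => //; apply: measurable_funB.
    by apply/measurable_EFinP; exact: measurable_int S_int.
  exact: joint_section (Y_meas solYZ).
move=> s _ /=; rewrite lee_fin [leRHS]ger0_norm ?addr_ge0//.
have h := normr_le_1Dsqr (Y s w).
by have := pos_part_sub_le (S s w) (Y s w); lra.
Qed.

Lemma solution_increment a b : 0 <= a -> a <= b -> b <= T ->
  Y a w - Y b w = \int[mu]_(s in `[a, b]) driver s w +
     \int[mu]_(s in `[a, b]) gap s w - (I b w - I a w).
Proof.
move=> a0 ab bT.
have aT : 0 <= a <= T by rewrite a0 (le_trans ab).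
have bT' : 0 <= b <= T by rewrite bT (le_trans a0).
rewrite (equation aT) (equation bT').
rewrite (Rintegral_itv_split driver_integrable a0 ab bT).
rewrite (Rintegral_itv_split gap_integrable a0 ab bT); lra.
Qed.

Lemma solution_terminal : Y T w = xi w.
Proof.
rewrite equation ?lexx ?ltW//.
by rewrite !set_itv1 !Rintegral_set1 subrr !addr0 subr0.
Qed.

Lemma solution_continuous : {within `[0, T], continuous (fun s => Y s w)}.
Proof.
have e s : s \in `[0, T]%classic -> Y 0 w - \int[mu]_(r in `[0, s]) driver r w -
    \int[mu]_(r in `[0, s]) gap r w + (I s w - I 0 w) = Y s w.
  rewrite inE /= in_itv /= => /andP[s0 sT].
  have := solution_increment (lexx 0) s0 sT; lra.
apply: (subspace_eq_continuous e) => s.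
apply: cvgD; last by apply: cvgB; [exact: I_cont|exact: cvg_cst].
apply: cvgB; first apply: cvgB; first exact: cvg_cst.
  exact: parameterized_integral_continuous T_ge0 driver_integrable s.
exact: parameterized_integral_continuous T_ge0 gap_integrable s.
Qed.

(** Solving the equation for [I] bounds its whole path by the bounds of [S] and [Y] and by time
    integrals of squares. This gives the domination under which [I] is stopped later. *)
Lemma ito_bound KS KY : (forall s, 0 <= s <= T -> `|S s w| <= KS) ->
  (forall s, 0 <= s <= T -> `|Y s w| <= KY) ->
  forall s, 0 <= s <= T -> `|I s w| <= `|I 0 w| + 2 * KY +
    ((T + \int[mu]_(r in `[0, T]) (`|f0 r w| ^+ 2)) +
     C * ((T + \int[mu]_(r in `[0, T]) (`|Y r w| ^+ 2)) +
          (T + \int[mu]_(r in `[0, T]) (enorm (Z r w) ^+ 2)))) +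
    lam * (KS + KY) * T.
Proof.
move=> hS hY s sT; have /andP[s0 sT'] := sT.
have := solution_increment (lexx 0) s0 sT' => e.
have zT : 0 <= (0 : R) <= T by rewrite lexx.
have h1 := Rintegral_norm_le driver_integrable bound_int sT driver_le.
have one_R g : mu.-integrable `[0, T] (fun r : R => (g r)%:E) ->
    \int[mu]_(r in `[0, T]) (1 + g r) = T + \int[mu]_(r in `[0, T]) g r.
  move=> ig; have i1 := cst_itv_integrable T 1.
  rewrite (RintegralD _ i1 ig)//; congr (_ + _).
  by rewrite (Rintegral_cst_itv 1 T_ge0) mul1r.
rewrite /bound (RintegralD _ (one_int f0_int) (integrableZl _ C YZ_int))// in h1.
rewrite (RintegralZl C _ YZ_int)// (RintegralD _ (one_int Y_int) (one_int Z_int))// in h1.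
rewrite !one_R// in h1.
have gb r : 0 <= r <= T -> `|gap r w| <= cst (lam * (KS + KY)) r.
  move=> rT; rewrite /gap /= normrM (gtr0_norm lam_gt0); apply: ler_wpM2l; first exact: ltW.
  by have := hS r rT; have := hY r rT; have := pos_part_sub_le (S r w) (Y r w); lra.
have h2 := Rintegral_norm_le gap_integrable (cst_itv_integrable T _) sT gb.
rewrite (Rintegral_cst_itv _ T_ge0) in h2.
have h3 := hY s sT; have h4 := hY 0 zT.
have -> : I s w = I 0 w + (Y s w - Y 0 w) +
    (\int[mu]_(r in `[0, s]) driver r w + \int[mu]_(r in `[0, s]) gap r w) by lra.
apply: (le_trans (ler_normD _ _)); rewrite -[leRHS]addrA; apply: lerD.
  apply: (le_trans (ler_normD _ _)); rewrite lerD2l (le_trans (ler_normB _ _))//.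
  by rewrite mulr2n mulrDl mul1r; exact: lerD.
by apply: (le_trans (ler_normD _ _)); exact: lerD.
Qed.

End Pathwise.

(** The almost sure properties of a path are gathered in one event [good], which completeness puts
    in [F 0]; multiplying [Y] by its indicator makes the paths continuous at every outcome and keeps
    adaptedness. *)
Lemma solution_regular : exists (I Yc : R -> Omega -> R) (K : Omega -> R),
  [/\ is_ito_integral P F W T Z I,
      (forall w, {within `[0, T], continuous (fun s => Yc s w)}) /\ adapted F T Yc,
      integr P K /\ (forall s w, 0 <= s <= T -> `|Yc s w| <= K w /\ `|S s w| <= K w),
      {ae P, forall w s, 0 <= s <= T -> Yc s w = Y s w /\ `|I s w| <= K w} &
      {ae P, forall w, Y T w = xi w /\ forall a b, 0 <= a -> a <= b -> b <= T ->
         Y a w - Y b w = \int[mu]_(s in `[a, b]) f s w (Y s w) (Z s w) +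
           \int[mu]_(s in `[a, b]) (lam * Num.max 0 (S s w - Y s w)) -
           (I b w - I a w)}].
Proof.
have [I ito eqn] := YZ_equation solYZ.
have [C C0 lip] := f_lipschitz data.
have [_ I_cont _] := ito.
pose good := [set w |
  [/\ (forall (t y y' : R) (z z' : d.-tuple R), 0 <= t <= T ->
      `|f t w y z - f t w y' z'| <= C * (`|y - y'| + enorm (sub_tuple z z'))),
     mu.-integrable `[0, T] (fun s => (`|f0 s w| ^+ 2)%:E),
     mu.-integrable `[0, T] (fun s => (`|Y s w| ^+ 2)%:E),
     mu.-integrable `[0, T] (fun s => (enorm (Z s w) ^+ 2)%:E) &
     forall t : R, 0 <= t <= T ->
       Y t w = xi w + \int[mu]_(s in `[t, T]) driver s w
         + \int[mu]_(s in `[t, T]) gap s w - (I T w - I t w)]].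
have good_ae : {ae P, forall w, good w}.
  apply: filterS3 lip eqn (filterI sqr_f0.2 (filterI sqr_Y.2 sqr_Z.2)).
  by move=> w h1 h2 [h3 [h4 h5]]; split.
have F_good s : 0 <= s -> F s good.
  move=> s0; have sF := filt_sigma filtF s0.
  have : F 0 (~` good) by apply: (filt_complete filtF); exact: good_ae.
  have s00 : 0 <= (0 : R) <= s by rewrite lexx.
  move=> /(filt_mono filtF s00); rewrite -[in X in _ -> X](setCK good) -[X in _ -> F s X]setTD.
  by have [_ sD _] := sF; exact: sD.
pose Yc s w := \1_good w * Y s w.
have Yc_cont w : {within `[0, T], continuous (fun s => Yc s w)}.
  rewrite /Yc indicE; have [/set_mem [g1 g2 g3 g4 g5]|_] := boolP (w \in good).
    have -> : (fun s => true%:R * Y s w) = (fun s => Y s w).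
      by apply/funext => s; rewrite mul1r.
    exact: solution_continuous (ltW C0) (I_cont w) g1 g2 g3 g4 g5.
  have -> : (fun s => false%:R * Y s w) = cst 0 by apply/funext => s; rewrite mul0r.
  by apply: continuous_subspaceT => s; exact: cvg_cst.
have Yc_adapted : adapted F T Yc.
  move=> s /[dup] sT /andP[s0 _]; have sF := filt_sigma filtF s0.
  apply/measurable_wrtE => //; apply: measurable_funM; last first.
    by apply/measurable_wrtE => //; exact: Y_adapted solYZ s sT.
  by apply: measurable_indic; rewrite measurable_g_measurableTypeE//; exact: F_good.
have wrt_meas s X : 0 <= s <= T -> measurable_wrt (F s) X -> measurable_fun setT (X : Omega -> R).
  by move=> /andP[s0 _]; exact: measurable_wrt_measurable (filt_sub filtF s0).
have Yc_le s w : `|Yc s w| <= `|Y s w|.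
  rewrite /Yc normrM indicE; case: (_ \in _); rewrite ?normr1 ?mul1r//.
  by rewrite normr0 mul0r.
have [iKY hKY] := run_sup_sqr_integr T_ge0 Yc_cont
  (fun s sT => wrt_meas s _ sT (Yc_adapted s sT)) Yc_le (Y_L2 solYZ).
have [iKS hKS] := run_sup_sqr_integr T_ge0 (S_continuous data)
  (fun s sT => wrt_meas s _ sT (S_adapted data sT)) (fun s w => lexx _) (S_L2 data).
pose KY w := 1 + run_sup 0 T (fun s w => Yc s w ^+ 2) w.
pose KS w := 1 + run_sup 0 T (fun s w => S s w ^+ 2) w.
pose KF w := (T + \int[mu]_(r in `[0, T]) (`|f0 r w| ^+ 2)) +
     C * ((T + \int[mu]_(r in `[0, T]) (`|Y r w| ^+ 2)) +
          (T + \int[mu]_(r in `[0, T]) (enorm (Z r w) ^+ 2))).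
(* The first bracket is the bound of [ito_bound], with [KS] and [KY] inserted; the second covers
   [Yc] and [S]. *)
pose K w := (`|I 0 w| + 2 * KY w + KF w + lam * T * (KS w + KY w)) + (KY w + KS w).
have zT : 0 <= (0 : R) <= T by rewrite lexx.
have KY0 w : 0 <= KY w by apply: le_trans (hKY 0 w zT).
have KS0 w : 0 <= KS w by apply: le_trans (hKS 0 w zT).
have KF0 w : 0 <= KF w.
  have h g : (forall r, 0 <= g r) -> 0 <= T + \int[mu]_(r in `[0, T]) (g r : R).
    by move=> g0; rewrite addr_ge0//; apply: Rintegral_ge0.
  have h1 := h _ (fun r => sqr_ge0 `|f0 r w|); have h2 := h _ (fun r => sqr_ge0 `|Y r w|).
  have h3 := h _ (fun r => sqr_ge0 (enorm (Z r w))).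
  by rewrite /KF addr_ge0// mulr_ge0 ?(ltW C0)// addr_ge0.
have rest0 w : 0 <= `|I 0 w| + 2 * KY w + KF w + lam * T * (KS w + KY w).
  have lT : 0 <= lam * T by rewrite mulr_ge0// ltW.
  apply: addr_ge0; last by rewrite mulr_ge0// addr_ge0.
  by apply: addr_ge0 => //; apply: addr_ge0 => //; exact: mulr_ge0.
exists I, Yc, K; split => //.
- split=> [|s w sT]; last first.
    have hY : `|Yc s w| <= KY w := hKY s w sT.
    have hS : `|S s w| <= KS w := hKS s w sT.
    have := rest0 w; have := KY0 w; have := KS0 w.
    by rewrite /K; move: hY hS; split; lra.
  have i1 : integr P KY by apply: integrD => //; exact: integr_cst.
  have i2 : integr P KS by apply: integrD => //; exact: integr_cst.
  have iT (g : Omega -> R) : integr P g -> integr P (fun w => T + g w).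
    by apply: integrD; exact: integr_cst.
  have iI : integr P (I 0).
    by have [h _] := ito_martingale filtF bmW ito; apply: h; rewrite lexx.
  apply: integrD; last exact: integrD.
  apply: integrD; last by apply: integrZl; exact: integrD.
  apply: integrD; first by apply: integrD; [exact: integr_norm|exact: integrZl].
  apply: integrD; first by apply: iT; have [] := sqr_f0.
  apply: integrZl; apply: integrD; apply: iT.
    by have [] := sqr_Y.
  by have [] := sqr_Z.
- apply: filterS good_ae => w gw s sT.
  have YcE r : Yc r w = Y r w by rewrite /Yc indicE mem_set// mul1r.
  split; first exact: YcE.
  have [g1 g2 g3 g4 g5] := gw.
  have hY r : 0 <= r <= T -> `|Y r w| <= KY w by rewrite -YcE; exact: hKY.
  have := ito_bound (ltW C0) g1 g2 g3 g4 g5 (fun r rT => hKS r w rT) hY sT.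
  rewrite -/(KF w) -/(KS w); have := KY0 w; have := KS0 w.
  by rewrite /K; lra.
- apply: filterS good_ae => w [g1 g2 g3 g4 g5].
  split; first exact: solution_terminal g5.
  move=> a b a0 ab bT.
  exact: solution_increment (ltW C0) g1 g2 g3 g4 g5 _ _ a0 ab bT.
Qed.

End Regularity.

(** * The optimal time is an admissible stopping time *)

Section OptimalTime.
Context {R : realType} {disp : measure_display} {Omega : measurableType disp}.
Variables (P : probability Omega R) (F : R -> set (set Omega)).
Variables (Tn : nat -> Omega -> R) (lam T : R) (S Y Yc : R -> Omega -> R).
Hypothesis T_gt0 : 0 < T.
Hypothesis filtF : usual_filtration P F.
Hypothesis poissonT : poisson_arrivals P Tn lam.
Hypothesis S_cont : forall w, {within `[0, T], continuous (fun s => S s w)}.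
Hypothesis S_adapt : adapted F T S.
Hypothesis Yc_cont : forall w, {within `[0, T], continuous (fun s => Yc s w)}.
Hypothesis Yc_adapt : adapted F T Yc.
Hypothesis YcE : {ae P, forall w s, 0 <= s <= T -> Yc s w = Y s w}.
Local Notation G := (big_filtration P F Tn).
Local Notation count := (arrival_count Tn).
Implicit Types (w : Omega) (s u : R) (i n N : nat).

Lemma arrival_leE m n w : (Tn m w <= Tn n w) = (m <= n)%N.
Proof.
apply/idP/idP => [|/(arrival_le poissonT)//]; apply: contraTT.
by rewrite -ltnNge -ltNge => /(arrival_lt poissonT w).
Qed.

Lemma arrival_ge0 n w : 0 <= Tn n w.
Proof. by rewrite -(pa_start poissonT w) arrival_leE. Qed.

(** Arrival times increase strictly with the index, and those up to T have index at most [M]; so the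
    infimum is attained at the least admissible index, or the set is empty and the arrival of index
    M + 1 remains. The last clause of each case later makes [phi] vanish at the earlier jumps. *)
Lemma optimal_time_cases i w (M := count T w) :
  (exists N, [/\ (i <= N <= M)%N, Y (Tn N w) w <= S (Tn N w) w,
     optimal_time T S Y Tn i w = (Tn N w)%:E &
     forall n, (i <= n < N)%N -> S (Tn n w) w < Y (Tn n w) w]) \/
  (optimal_time T S Y Tn i w = (Tn M.+1 w)%:E /\
     forall n, (i <= n <= M)%N -> S (Tn n w) w < Y (Tn n w) w).
Proof.
pose NS := [set N | [/\ Tn i w <= Tn N w, Tn N w <= T & Y (Tn N w) w <= S (Tn N w) w]].
have NSE N : NS N <-> (i <= N <= M)%N /\ Y (Tn N w) w <= S (Tn N w) w.
  rewrite /NS /= arrival_leE -(arrival_count_ge poissonT N w (ltW T_gt0)).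
  by split=> [[-> -> ->]|[/andP[-> ->] ->]].
have [[N0 NSN0]|NS0] := pselect (exists N, NS N).
  have [N /asboolP NSN Nmin] :=
    ex_minnP (ex_intro (fun N => `[< NS N >]) N0 (introT (asboolP _) NSN0)).
  have /NSE[/andP[iN NM] YS] := NSN.
  left; exists N; split=> //; first by rewrite iN.
    rewrite /optimal_time -/NS.
    have -> : ereal_inf [set (Tn N w)%:E | N in NS] = (Tn N w)%:E.
      apply/eqP; rewrite eq_le; apply/andP; split.
        by apply: ereal_inf_lbound; exists N.
      apply: le_ereal_inf_tmp => _ [n NSn <-]; rewrite lee_fin arrival_leE.
      by apply: Nmin; exact/asboolP.
    by apply/min_idPl; rewrite lee_fin arrival_leE ltnW.
  move=> n /andP[iN' nN]; rewrite ltNge; apply/negP => YSn.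
  have /Nmin : `[< NS n >].
    by apply/asboolP/NSE; rewrite iN' YSn (leq_trans (ltnW nN)).
  by rewrite leqNgt nN.
right; split.
  rewrite /optimal_time -/NS (_ : NS = set0) ?image_set0 ?ereal_inf0.
    by apply/min_idPr; rewrite leey.
  by apply/seteqP; split=> // N NSN; apply: NS0; exists N.
move=> n inM; rewrite ltNge; apply/negP => YSn; apply: NS0; exists n.
exact/NSE.
Qed.

(** Where [Y] agrees with [Yc], the comparison is read off continuous adapted paths at a time at
    most [u]; the exceptional part is null, hence in [F 0]. *)
Lemma stop_candidate_event N u : 0 <= u <= T ->
  G u [set w | Tn N w <= u /\ Y (Tn N w) w <= S (Tn N w) w].
Proof.
move=> /andP[u0 uT]; have sG := big_filtration_sigma P F Tn u.
have [_ GD GU] := sG.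
have G_event A : P.-negligible A -> G u A.
  move=> /(filt_complete filtF) FA; apply: big_filtration_F.
  by apply: (filt_mono filtF) FA; rewrite lexx.
pose good := [set w | forall s, 0 <= s <= T -> Yc s w = Y s w].
have Ggood : G u good.
  rewrite -(setCK good) -setTD; apply: GD; apply: G_event; exact: YcE.
(* Capping at [u] changes nothing where the arrival is at most [u], and uses the paths up to [u]
   only. *)
pose sg w := Num.min (Tn N w) u.
have sgu w : 0 <= sg w <= u by rewrite le_min arrival_ge0 u0 ge_min lexx orbT.
have Tle s : 0 <= s <= u -> G u [set w | Tn N w <= s].
  move=> /andP[s0 su].
  have -> : [set w | Tn N w <= s] = count s @^-1` [set n | (N <= n)%N].
    by apply/seteqP; split=> w /=; rewrite (arrival_count_ge poissonT N w s0).
  apply: big_filtration_natural; apply: arrival_count_natural.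
  by rewrite s0.
have sub : `[0, u] `<=` `[0, T] by apply: subset_itvl; rewrite bnd_simp.
have mpsi : measurable_wrt (G u) (fun w => Yc (sg w) w - S (sg w) w).
  apply: (@measurable_at_time _ _ _ (G u) u (fun s w => Yc s w - S s w)) => //.
  - move=> w x; apply: cvgB.
      exact: (continuous_subspaceW sub (@Yc_cont w)).
    exact: (continuous_subspaceW sub (@S_cont w)).
  - move=> s /andP[s0 su]; have sT : 0 <= s <= T by rewrite s0 (le_trans su).
    have sub' : F s `<=` G u.
      move=> A FA; apply: (big_filtration_mono filtF s0 su).
      exact: big_filtration_F.
    apply/measurable_wrtE => //; apply: measurable_funB; apply/measurable_wrtE => //.
      exact: measurable_wrt_sub sub' (Yc_adapt sT).
    exact: measurable_wrt_sub sub' (S_adapt sT).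
  move=> s /andP[s0 su].
  have -> : [set w | sg w <= s] = [set w | Tn N w <= s] `|` [set w | u <= s].
    by apply/seteqP; split=> w /=; rewrite /sg ge_min => /orP.
  have [us|us] := boolP (u <= s).
    rewrite (_ : [set w | is_true true] = setT); last by apply/seteqP; split.
    rewrite setUT; exact: sigma_algebraT.
  rewrite (_ : [set w | is_true false] = set0); last by apply/seteqP; split.
  by rewrite setU0; apply: Tle; rewrite s0.
have GI := sigma_algebraI sG.
have uu : 0 <= u <= u by rewrite u0 lexx.
rewrite (_ : [set w | _] = ([set w | Tn N w <= u] `&`
    [set w | Yc (sg w) w - S (sg w) w <= 0] `&` good) `|`
    ([set w | Tn N w <= u /\ Y (Tn N w) w <= S (Tn N w) w] `&` ~` good)).
  rewrite -(measurable_g_measurableTypeE sG); apply: measurableU;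
    rewrite measurable_g_measurableTypeE//.
    apply: (GI) => //; apply: (GI); first exact: Tle.
    rewrite (_ : [set w | _] =
      (fun w => Yc (sg w) w - S (sg w) w) @^-1` `]-oo, 0]); first exact: mpsi.
    by apply/seteqP; split=> w /=; rewrite in_itv.
  apply: G_event; apply: negligibleS YcE => w [_ h]; exact: h.
have agree w : good w -> Tn N w <= u ->
    (Yc (sg w) w - S (sg w) w <= 0) = (Y (Tn N w) w <= S (Tn N w) w).
  move=> gw Tu; rewrite /sg (min_idPl Tu) gw ?subr_le0//.
  by rewrite arrival_ge0 (le_trans Tu).
apply/seteqP; split=> [w [Tu YS]|w].
  have [gw|gw] := pselect (good w); last by right.
  by left; split=> //; split=> //=; rewrite agree.
by case=> [[[/= Tu h] gw]|[]//]; split=> //; rewrite -agree.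
Qed.

(** A candidate reached by [s] bounds the least one, and the cap bounds the optimal time in every
    case; the minimum with [T] is there because only arrivals up to [T] are candidates. *)
Lemma optimal_time_event i s : 0 <= s ->
  [set w | (optimal_time T S Y Tn i w <= s%:E)%E] =
  (\bigcup_(N in [set N | (i <= N)%N])
     [set w | Tn N w <= Num.min s T /\ Y (Tn N w) w <= S (Tn N w) w]) `|`
  [set w | Tn (count T w).+1 w <= s].
Proof.
move=> s0; have T0 := ltW T_gt0.
apply/seteqP; split=> w /=.
  have [[N [/andP[iN NM] YS -> _]]|[-> _]] := optimal_time_cases i w.
    rewrite lee_fin => Ts; left; exists N => //=; split=> //.
    by rewrite le_min Ts -(arrival_count_ge poissonT N w T0).
  by rewrite lee_fin; right.
have [[N [/andP[iN NM] YS -> min_N]]|[-> none]] := optimal_time_cases i w;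
  rewrite lee_fin; last first.
  case=> // -[N /= iN [+ YS]]; rewrite le_min => /andP[_].
  rewrite -(arrival_count_ge poissonT N w T0) => NM.
  by have := none N; rewrite iN NM => /(_ isT); rewrite ltNge YS.
case=> [[n /= iN' [+ YS']]|].
  rewrite le_min => /andP[ns _]; apply: le_trans ns; rewrite arrival_leE.
  rewrite leqNgt; apply/negP => nN; have := min_N n; rewrite iN' nN => /(_ isT).
  by rewrite ltNge YS'.
by apply: le_trans; rewrite arrival_leE ltnW.
Qed.

(** Before [T] the event is empty, as arrival M + 1 exceeds [T]; from [T] on it says that the count
    at [s] exceeds the count at [T], both known at [s]. *)
Lemma next_arrival_event s : 0 <= s -> G s [set w | Tn (count T w).+1 w <= s].
Proof.
move=> s0; have T0 := ltW T_gt0; have [sT|Ts] := ltP s T.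
  have -> : [set w | Tn (count T w).+1 w <= s] = set0.
    apply/seteqP; split=> // w /= h.
    by have /andP[_] := arrival_countP poissonT w T0; rewrite ltNge (le_trans h (ltW sT)).
  by have [] := big_filtration_sigma P F Tn s.
have -> : [set w | Tn (count T w).+1 w <= s] = \bigcup_n
    (count T @^-1` [set n] `&` count s @^-1` [set m | (n < m)%N]).
  apply/seteqP; split=> w /=.
    by rewrite -(arrival_count_ge poissonT _ w s0) => h; exists (count T w).
  by move=> [n _ [/= <-]]; rewrite (arrival_count_ge poissonT _ w s0).
have sG := big_filtration_sigma P F Tn s; have [_ _ GU] := sG.
apply: GU => n; apply: (sigma_algebraI sG); apply: big_filtration_natural;
  by apply: arrival_count_natural; rewrite ?T0 ?s0 ?lexx.
Qed.

Lemma optimal_time_stopping i : stopping_time G (optimal_time T S Y Tn i).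
Proof.
split=> [w|s s0].
  by have [[N [_ _ -> _]]|[-> _]] := optimal_time_cases i w; rewrite lee_fin arrival_ge0.
rewrite optimal_time_event//; have sG := big_filtration_sigma P F Tn s.
rewrite -(measurable_g_measurableTypeE sG); apply: measurableU; last first.
  by rewrite measurable_g_measurableTypeE//; exact: next_arrival_event.
apply: bigcup_measurable => N _; rewrite measurable_g_measurableTypeE//.
have m0 : 0 <= Num.min s T by rewrite le_min s0 ltW.
apply: (big_filtration_mono filtF m0); first by rewrite ge_min lexx.
by apply: stop_candidate_event; rewrite m0 ge_min lexx orbT.
Qed.

Lemma stopping_time_measurable (tau : Omega -> \bar R) :
  stopping_time G tau -> measurable_fun setT tau.
Proof.
move=> [tau0 stop]; apply: (measurability _ (ErealGenOInfty.measurableE R)).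
move=> /= _ [_ [r ->] <-]; rewrite setTI.
have [r0|r0] := leP 0 r.
  have -> : tau @^-1` `]r%:E, +oo[ = ~` [set w | (tau w <= r%:E)%E].
    by apply/seteqP; split=> w /=; rewrite in_itv/= andbT ltNge => /negP.
  apply: measurableC; apply: (big_filtration_sub filtF poissonT r0); exact: stop.
have -> : tau @^-1` `]r%:E, +oo[ = setT; last exact: measurableT.
apply/seteqP; split=> // w _ /=; rewrite in_itv/= andbT.
by apply: lt_le_trans (tau0 w); rewrite lte_fin.
Qed.

Lemma optimal_time_control i : control_set P F T Tn i (optimal_time T S Y Tn i).
Proof.
have stop := optimal_time_stopping i; split=> //.
pose tau := optimal_time T S Y Tn i.
have tauE w : exists N, tau w = (Tn N w)%:E.
  have [[N [_ _ h _]]|[h _]] := optimal_time_cases i w; first by exists N.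
  by exists (count T w).+1.
(* The index is recovered from the time: strict monotonicity of the arrivals makes it unique, so {N
   = n} is the measurable event where [tau] equals [Tn n]. *)
pose N w := xget 0%N [set n | tau w = (Tn n w)%:E].
have NE w : tau w = (Tn (N w) w)%:E.
  by rewrite /N; case: xgetP => [n _ //|h]; have [n /h] := tauE w.
have N_uniq n w : tau w = (Tn n w)%:E -> N w = n.
  rewrite NE => -[e]; apply/eqP; rewrite eqn_leq.
  by rewrite -!(arrival_leE _ _ w) e lexx.
exists N => [_ B _|w iM].
  rewrite setTI (_ : N @^-1` B = \bigcup_(n in B) [set w | tau w = (Tn n w)%:E]).
    apply: bigcup_measurable => n _.
    have mtau := stopping_time_measurable stop.
    have mTn : measurable_fun setT (fun w => (Tn n w)%:E).
      by apply/measurable_EFinP; exact: (pa_meas poissonT).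
    have -> : [set w | tau w = (Tn n w)%:E] =
        (fun w => (tau w - (Tn n w)%:E)%E) @^-1` [set 0%E].
      apply/seteqP; split=> w /=; first by move=> ->; rewrite subee.
      by move: (tau w) => [r| |] //= -[] /eqP; rewrite subr_eq0 => /eqP ->.
    rewrite -[_ @^-1` _]setTI; apply: emeasurable_funB => //.
  apply/seteqP; split=> [w Bw|w [n Bn /N_uniq e]] /=; last by rewrite e.
  by exists (N w) => //=; exact: NE.
split; last exact: NE.
have [[n [/andP[h1 h2] _ /N_uniq -> _]]|[/N_uniq -> _]] := optimal_time_cases i w.
  by rewrite h1 ltnW.
by rewrite iM leqnn.
Qed.

End OptimalTime.

(** * Means of the payoff over events of [G t] *)

Section Payoff.
Context {R : realType} {disp : measure_display} {Omega : measurableType disp}.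
Variables (P : probability Omega R) (F : R -> set (set Omega)).
Variables (d : nat) (W : R -> Omega -> d.-tuple R) (T lam : R).
Variables (xi : Omega -> R) (f : R -> Omega -> R -> d.-tuple R -> R).
Variables (S Y : R -> Omega -> R) (Z : R -> Omega -> d.-tuple R).
Variables (Tn : nat -> Omega -> R) (I Yc : R -> Omega -> R) (K : Omega -> R).
Hypothesis T_gt0 : 0 < T.
Hypothesis lam_gt0 : 0 < lam.
Hypothesis filtF : usual_filtration P F.
Hypothesis bmW : brownian_motion P F W.
Hypothesis poissonT : poisson_arrivals P Tn lam.
Hypothesis indepFT : independent_sets P (filt_infty F)
                 (filt_infty (poisson_natural Tn)).
Hypothesis S_cont : forall w, {within `[0, T], continuous (fun s => S s w)}.
Hypothesis S_adapt : adapted F T S.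
Hypothesis ito : is_ito_integral P F W T Z I.
Hypothesis Yc_cont : forall w, {within `[0, T], continuous (fun s => Yc s w)}.
Hypothesis Yc_adapt : adapted F T Yc.
Hypothesis iK : integr P K.
Hypothesis K_bound : forall s w, 0 <= s <= T -> `|Yc s w| <= K w /\ `|S s w| <= K w.
Hypothesis YcE_I : {ae P, forall w s, 0 <= s <= T -> Yc s w = Y s w /\ `|I s w| <= K w}.
Hypothesis increments : {ae P, forall w, Y T w = xi w /\
  forall a b, 0 <= a -> a <= b -> b <= T ->
    Y a w - Y b w =
      \int[lebesgue_measure]_(s in `[a, b]) f s w (Y s w) (Z s w) +
      \int[lebesgue_measure]_(s in `[a, b]) (lam * Num.max 0 (S s w - Y s w)) -
      (I b w - I a w)}.
Variable t : R.
Hypothesis t_in : 0 <= t <= T.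
Local Notation G := (big_filtration P F Tn).
Local Notation count := (arrival_count Tn).

Let t_ge0 : 0 <= t. Proof. by have /andP[] := t_in. Qed.
Let tT : t <= T. Proof. by have /andP[] := t_in. Qed.
Let T_ge0 := ltW T_gt0.
Let zT : 0 <= T <= T. Proof. by rewrite T_ge0 lexx. Qed.
Let sub_itv : `[t, T] `<=` `[0, T].
Proof. by apply: subset_itvr; rewrite bnd_simp. Qed.
Let itv0 s : t <= s <= T -> 0 <= s <= T.
Proof. by move=> /andP[ts ->]; rewrite (le_trans t_ge0 ts). Qed.

Let sG s : t <= s <= T -> sigma_algebra setT (G s).
Proof. by move=> _; exact: big_filtration_sigma. Qed.
Let Gm s : t <= s <= T -> G s `<=` measurable.
Proof. by move=> /itv0/andP[s0 _]; exact (big_filtration_sub filtF poissonT s0). Qed.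
Let Gmono s s' : t <= s -> s <= s' -> s' <= T -> G s `<=` G s'.
Proof. by move=> ts ss' _; exact (big_filtration_mono filtF (le_trans t_ge0 ts) ss'). Qed.

Let F_meas s (X : Omega -> R) : 0 <= s <= T -> measurable_wrt (F s) X ->
  measurable_fun setT X.
Proof. by move=> /andP[s0 _]; exact: measurable_wrt_measurable (filt_sub filtF s0). Qed.

Let F_infty s (X : Omega -> R) : 0 <= s <= T -> measurable_wrt (F s) X ->
  measurable_wrt (filt_infty F) X.
Proof. by move=> /andP[s0 _]; apply: measurable_wrt_sub; exact: filt_infty_ub. Qed.

Let I_mart s s' E : t <= s -> s <= s' -> s' <= T -> G s E ->
  mean P (fun w => \1_E w * (I s' w - I s w)) = 0.
Proof.
move=> ts ss' s'T GE; have s0 := le_trans t_ge0 ts.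
have [iI mart] := ito_martingale filtF bmW ito.
have sT : 0 <= s <= T by rewrite s0 (le_trans ss').
have s'T' : 0 <= s' <= T by rewrite s'T (le_trans s0).
have [I_adapt _ _] := ito.
apply: (mean_big_filtration filtF poissonT indepFT s0 GE).
- have sFi := filt_infty_sigma F; apply/measurable_wrtE => //.
  apply: measurable_funB; apply/measurable_wrtE => //.
    exact: F_infty (I_adapt s' s'T').
  exact: F_infty (I_adapt s sT).
- by apply: integrB; apply: iI.
- by move=> A FA; exact: mart.
Qed.

Let phi s w := Num.max 0 (S s w - Yc s w).

Let phi_cont0 w : {within `[0, T], continuous (fun s => phi s w)}.
Proof.
apply: (@max_fun_continuous _ _ _ (cst 0 : subspace `[0, T] -> R)) => x.
  exact: cvg_cst.
by apply: cvgB; [exact: S_cont|exact: Yc_cont].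
Qed.

Let phi_cont w : {within `[t, T], continuous (fun s => phi s w)}.
Proof. exact: continuous_subspaceW sub_itv (@phi_cont0 w). Qed.

Let phi_ge0 s w : t <= s <= T -> 0 <= phi s w.
Proof. by move=> _; rewrite le_max lexx. Qed.

Let phi_le s w : t <= s <= T -> phi s w <= 2 * K w.
Proof.
move=> /itv0/(K_bound w)[h1 h2].
have := pos_part_sub_le (S s w) (Yc s w).
have := ler_norm (phi s w); rewrite /phi; lra.
Qed.

Let phi_meas s : t <= s <= T -> measurable_wrt (filt_infty F) (phi s).
Proof.
move=> /itv0 sT; have sFi := filt_infty_sigma F; apply/measurable_wrtE => //.
apply: measurable_maxr; first exact: measurable_cst.
apply: measurable_funB; apply/measurable_wrtE => //.
  exact: F_infty (S_adapt sT).
exact: F_infty (Yc_adapt sT).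
Qed.

Let iK2 : integr P (fun w => 2 * K w). Proof. exact: integrZl. Qed.

Definition capped (tau : Omega -> \bar R) w : R := fine (Order.min (tau w) T%:E).

Section StoppingTime.
Variable tau : Omega -> \bar R.
Hypothesis stop : stopping_time G tau.
Let sg := capped tau.

Lemma capped_lt w : (tau w < T%:E)%E -> tau w = (sg w)%:E.
Proof.
have := stop.1 w; rewrite /sg /capped; case: (tau w) => [r| |] //= _ rT.
by rewrite min_l//= ltW.
Qed.

Lemma capped_ge w : (T%:E <= tau w)%E -> sg w = T.
Proof. by move=> Tt; rewrite /sg /capped min_r. Qed.

Lemma capped_itv w : 0 <= sg w <= T.
Proof.
have [h|/capped_ge ->] := ltP (tau w) T%:E; last exact: zT.
have := stop.1 w; move: (h); rewrite (capped_lt h) lee_fin lte_fin => h1 ->.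
exact: ltW.
Qed.

Lemma capped_stop s : 0 <= s <= T -> G s [set w | sg w <= s].
Proof.
move=> /andP[s0]; rewrite le_eqVlt => /predU1P[->|sT].
  have -> : [set w | sg w <= T] = setT.
    by apply/seteqP; split=> // w _ /=; have /andP[] := capped_itv w.
  exact: sigma_algebraT (big_filtration_sigma P F Tn T).
have -> : [set w | sg w <= s] = [set w | (tau w <= s%:E)%E]; last exact: stop.2.
apply/seteqP; split=> w /=; have [h|h] := ltP (tau w) T%:E.
- by rewrite (capped_lt h) lee_fin.
- by rewrite (capped_ge h) leNgt sT.
- by rewrite (capped_lt h) lee_fin.
- by move=> h'; have := le_trans h h'; rewrite lee_fin leNgt sT.
Qed.

Let tau_meas : measurable_fun setT tau.
Proof. exact: (stopping_time_measurable filtF poissonT stop). Qed.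

(** Two versions are kept because the payoff pays [S] under a strict inequality, whereas an arrival
    exactly at [T] still counts among the jumps in ]t, T]. *)
Let B := [set w | (tau w <= T%:E)%E].
Let B' := [set w | (tau w < T%:E)%E].

Let B_meas : measurable B.
Proof. by apply: (big_filtration_sub filtF poissonT T_ge0); exact: stop.2. Qed.

Let B'_meas : measurable B'.
Proof.
have -> : B' = tau @^-1` `]-oo, T%:E[ by apply/seteqP; split=> w /=; rewrite in_itv.
by rewrite -[_ @^-1` _]setTI; exact: tau_meas measurableT _ (emeasurable_itv _).
Qed.

Let const_le_meas (c s : R) : measurable [set _ : Omega | c <= s].
Proof.
case: (c <= s).
  by rewrite (_ : [set _ | _] = setT) ?eqEsubset//; split.
by rewrite (_ : [set _ | _] = set0) ?eqEsubset//; split.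
Qed.

Let at_time_integr (X : R -> Omega -> R) (r : Omega -> R) :
  (forall w, {within `[0, T], continuous (fun s => X s w)}) -> adapted F T X ->
  (forall s w, 0 <= s <= T -> `|X s w| <= K w) ->
  (forall w, 0 <= r w <= T) -> (forall s, 0 <= s <= T -> measurable [set w | r w <= s]) ->
  integr P (fun w => X (r w) w).
Proof.
move=> cX aX XK rT mr.
have sm := @sigma_algebra_measurable _ Omega.
have mX : measurable_wrt (@measurable _ Omega) (fun w => X (r w) w).
  apply: (@measurable_at_time _ _ _ _ T X r) => // s sT; apply: measurable_wrt_sub (aX s sT).
  by have /andP[s0 _] := sT; exact: filt_sub filtF s s0.
apply: (integr_le _ iK); first exact: measurable_wrt_measurable mX.
by move=> w; rewrite (le_trans (XK _ _ (rT w)))// ler_norm.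
Qed.

Let xi_integr : integr P xi.
Proof.
apply: (@integr_ae _ _ _ P (Yc T)); first exact: negligible_measurable filtF.
  apply: (at_time_integr (r := fun=> T)) => //; first by move=> s w /(K_bound w)[].
by apply: filterS2 YcE_I increments => w h1 [<- _]; have [] := h1 T zT.
Qed.

(** Outside the event of the theorem an admissible [tau] may precede [t], yet the conditional
    expectation needs a payoff integrable on all of [Omega]. Replacing [sg] by [late] leaves the
    driver integral from [t] unchanged and gives a stopping time in [t, T]. *)
Let late w := Num.max t (sg w).

Let late_itv w : t <= late w <= T.
Proof.
by rewrite le_max lexx /= ge_max tT; have /andP[_ ->] := capped_itv w.
Qed.

Let late_stop s : t <= s <= T -> G s [set w | late w <= s].
Proof.
move=> /[dup] sT /andP[ts _].
have -> : [set w | late w <= s] = [set w | sg w <= s].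
  by apply/seteqP; split=> w /=; rewrite ge_max ts.
by apply: capped_stop; exact: itv0.
Qed.

Let sg_le_meas s : 0 <= s <= T -> measurable [set w | sg w <= s].
Proof.
move=> /[dup] sT /andP[s0 _].
by apply: (big_filtration_sub filtF poissonT s0); exact: capped_stop.
Qed.

Let S_sg_integr : integr P (fun w => S (sg w) w).
Proof.
apply: at_time_integr => //; last exact: capped_itv.
by move=> s w /(K_bound w)[].
Qed.

Let Yc_integr (r : Omega -> R) : (forall w, 0 <= r w <= T) ->
  (forall s, 0 <= s <= T -> measurable [set w | r w <= s]) ->
  integr P (fun w => Yc (r w) w).
Proof. by apply: at_time_integr => // s w /(K_bound w)[]. Qed.

Let stop_value w := if (tau w < T%:E)%E then S (sg w) w else xi w.

Let stop_value_integr : integr P stop_value.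
Proof.
have -> : stop_value = (fun w => \1_B' w * S (sg w) w + \1_(~` B') w * xi w).
  apply/funext => w; rewrite /stop_value !indicE in_setC.
  case: ifPn => h; first by rewrite mem_set//= mul1r mul0r addr0.
  by rewrite memNset ?mul0r ?mul1r ?add0r//; exact/negP.
apply: integrD; apply: integr_indicM; [exact: B'_meas|exact: S_sg_integr| |].
  exact: measurableC.
exact: xi_integr.
Qed.

Lemma payoff_decomposition : {ae P, forall w, payoff T xi f S Y Z t tau w =
  Yc t w - Yc (late w) w - lam * stopped_area t late phi w +
  (I (late w) w - I t w) + stop_value w}.
Proof.
apply: filterS2 YcE_I increments => w YcI [_ incr].
have /andP[tl lT] := late_itv w.
have lT' : 0 <= late w <= T by rewrite lT (le_trans t_ge0 tl).
have := incr t (late w) t_ge0 tl lT.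
rewrite -(YcI t t_in).1 -(YcI _ lT').1 => e.
have areaE : \int[lebesgue_measure]_(s in `[t, late w]) (lam * Num.max 0 (S s w - Y s w)) =
    lam * stopped_area t late phi w.
  rewrite /stopped_area -RintegralZl//; last first.
    apply: continuous_compact_integrable; first exact: segment_compact.
    apply: continuous_subspaceW (@phi_cont w).
    by apply: subset_itvl; rewrite bnd_simp.
  apply: eq_Rintegral => s; rewrite inE /= in_itv /= => /andP[ts sl].
  by rewrite /phi (YcI s _).1// (le_trans t_ge0 ts) (le_trans sl lT).
rewrite areaE in e.
rewrite /payoff -/(sg w).
have -> : \int[lebesgue_measure]_(s in `[t, sg w]) f s w (Y s w) (Z s w) =
    \int[lebesgue_measure]_(s in `[t, late w]) f s w (Y s w) (Z s w).
  rewrite /late; have [//|st] := leP t (sg w).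
  rewrite set_itv1 Rintegral_set1 set_itv_ge ?Rintegral_set0//.
  by rewrite bnd_simp -ltNge.
have -> : (if (tau w < T%:E)%E then S (fine (tau w)) w else xi w) = stop_value w.
  by rewrite /stop_value; case: ifPn => // h; rewrite (capped_lt h).
rewrite [X in X + _ = _](_ : _ = Yc t w - Yc (late w) w -
  lam * stopped_area t late phi w + (I (late w) w - I t w))//.
lra.
Qed.

Let I_bound : {ae P, forall w s, t <= s <= T -> `|I s w| <= K w}.
Proof. by apply: filterS YcE_I => w h s /itv0 /h[]. Qed.

Let I_cont w : {within `[t, T], continuous (fun s => I s w)}.
Proof. by have [_ h _] := ito; exact: continuous_subspaceW sub_itv (h w). Qed.

Let I_meas s : t <= s <= T -> measurable_fun setT (I s).
Proof. by move=> /itv0 sT; have [h _ _] := ito; exact: F_meas (h s sT). Qed.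

Lemma payoff_integr : integr P (payoff T xi f S Y Z t tau).
Proof.
have GT : G t setT := sigma_algebraT (big_filtration_sigma P F Tn t).
have lT w : setT w -> t <= late w <= T by move=> _; exact: late_itv.
have T1 (X : Omega -> R) : (fun w => \1_(@setT Omega) w * X w) = X.
  by apply/funext => w; rewrite indicT mul1r.
have late_meas s : 0 <= s <= T -> measurable [set w | late w <= s].
  move=> /andP[s0 sT]; have [ts|ts] := leP t s.
    by apply: (big_filtration_sub filtF poissonT s0); apply: late_stop; rewrite ts.
  have -> : [set w | late w <= s] = set0; last exact: measurable0.
  by apply/seteqP; split=> // w /=; rewrite ge_max leNgt ts.
apply: (integr_ae (negligible_measurable filtF) (X := fun w => Yc t w - Yc (late w) w -
    lam * stopped_area t late phi w + (I (late w) w - I t w) + stop_value w)); last first.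
  by apply: filterS payoff_decomposition => w /esym.
have i1 : integr P (fun w => Yc t w).
  exact: (Yc_integr (r := fun=> t)).
have i2 : integr P (fun w => Yc (late w) w).
  by apply: Yc_integr => // w; exact/itv0/late_itv.
have i3 : integr P (fun w => lam * stopped_area t late phi w).
  apply: integrZl; rewrite -[X in integr P X]T1.
  exact: (stopped_area_integr (P := P) tT sG Gm Gmono GT lT late_stop phi_cont phi_ge0 phi_le
    (filt_infty_sigma F) (filt_inftyF_sub filtF) phi_meas iK2).
have i4 : integr P (fun w => I (late w) w - I t w).
  rewrite -[X in integr P X]T1.
  by have [] := optional_stopping tT sG Gm Gmono GT lT late_stop I_cont I_meas iK I_bound I_mart.
have i5 := integrB (integrB i1 i2) i3; have i6 := integrD i5 i4.
exact: integrD i6 stop_value_integr.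
Qed.

Section OnEvent.
Variables (i : nat) (D : set Omega).
Hypothesis i_ge1 : (1 <= i)%N.
Hypothesis GD : G t D.
Hypothesis D_sub : forall w, D w -> Tn i.-1 w <= t < Tn i w.

Let arrival_D w n : D w -> (i <= n)%N -> t < Tn n w.
Proof.
move=> /D_sub/andP[_ ti] i_n; apply: lt_le_trans ti _.
exact: (arrival_le poissonT).
Qed.

Let D_meas : measurable D.
Proof. exact: (big_filtration_sub filtF poissonT t_ge0) GD. Qed.

Hypothesis sgD : forall w, D w -> t <= sg w <= T.

Let sg_stop s : t <= s <= T -> G s [set w | sg w <= s].
Proof. by move=> /itv0; exact: capped_stop. Qed.

Let jump_meas s s' : t <= s -> s <= s' -> s' <= T -> measurable (jump Tn s s').
Proof.
by move=> ts ss' _; exact: (jump_measurable poissonT (le_trans t_ge0 ts) ss').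
Qed.

Let jump_rate s s' E (X : Omega -> R) : t <= s -> s <= s' -> s' <= T -> G s E ->
  measurable_wrt (filt_infty F) X -> integr P X ->
  mean P (fun w => \1_E w * (\1_(jump Tn s s') w * X w)) =
  (1 - expR (- (lam * (s' - s)))) * mean P (fun w => \1_E w * X w).
Proof.
move=> ts ss' _; exact: (mean_jump lam_gt0 filtF poissonT indepFT (le_trans t_ge0 ts) ss').
Qed.

Let gain w := \1_B' w * (S (sg w) w - Yc (sg w) w).

Let gain_integr : integr P gain.
Proof.
apply: integr_indicM; first exact: B'_meas.
have iY : integr P (fun w => Yc (sg w) w).
  by apply: Yc_integr; [exact: capped_itv|exact: sg_le_meas].
exact: integrB S_sg_integr iY.
Qed.

Let reward w := \1_D w * (\1_B w * phi (sg w) w).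

Let reward_integr' : integr P reward.
Proof.
exact: (reward_integr (P := P) tT sG Gm Gmono GD sgD sg_stop phi_cont phi_ge0 phi_le
    (filt_inftyF_sub filtF) phi_meas iK2 B_meas).
Qed.

(** Optional stopping removes the [I] term. On [B'] the stop value minus [Yc] at [sg] is the gain;
    off [B'] it vanishes almost surely, since there [sg] is [T] and [Yc T] is [xi]. *)
Lemma mean_payoff : mean P (fun w => \1_D w * payoff T xi f S Y Z t tau w) =
  mean P (fun w => \1_D w * Yc t w) -
  lam * mean P (fun w => \1_D w * stopped_area t sg phi w) +
  mean P (fun w => \1_D w * gain w).
Proof.
have [iI I0] := optional_stopping tT sG Gm Gmono GD sgD sg_stop I_cont I_meas iK I_bound I_mart.
have iA := stopped_area_integr (P := P) tT sG Gm Gmono GD sgD sg_stop phi_cont phi_ge0 phi_le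
    (filt_infty_sigma F) (filt_inftyF_sub filtF) phi_meas iK2.
have iYt : integr P (fun w => \1_D w * Yc t w).
  apply: integr_indicM => //; exact: (Yc_integr (r := fun=> t)).
have iG : integr P (fun w => \1_D w * gain w) by exact: integr_indicM.
have iYA := integrB iYt (integrZl lam iA).
have iYAI := integrD iYA iI.
rewrite -meanZl// -meanB//; last exact: integrZl.
rewrite -[X in X + _]addr0 -I0 -meanD// -meanD//.
apply: eq_mean_ae.
- exact: integr_meas (integr_indicM D_meas payoff_integr).
- exact: integr_meas (integrD iYAI iG).
apply: filterS3 payoff_decomposition YcE_I increments => w -> YcI [xiE _].
rewrite indicE; have [/set_mem Dw|_] := boolP (w \in D); last by rewrite !mul0r; lra.
have /andP[tsg sgT'] := sgD Dw.
rewrite /stopped_area /late (max_idPr tsg) /gain /stop_value indicE.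
have [h|h] := ltP (tau w) T%:E.
  by rewrite mem_set// !mul1r; ring.
rewrite memNset; last by rewrite /B' /= ltNge h.
by rewrite (capped_ge h) -xiE -(YcI T zT).1 !mul1r mul0r; ring.
Qed.

(** The gain is at most [phi] at [sg] on [B], because [B'] lies in [B] and S - Yc <= [phi]. A cell
    ]s, s'] containing an arrival sees the count change, as [reward_le_compensator] requires. *)
Lemma mean_payoff_le : (forall w, D w -> exists2 N, (i <= N)%N & tau w = (Tn N w)%:E) ->
  mean P (fun w => \1_D w * payoff T xi f S Y Z t tau w) <=
  mean P (fun w => \1_D w * Yc t w).
Proof.
move=> tauD; rewrite mean_payoff.
have := reward_le_compensator (P := P) tT sG Gm Gmono GD sgD sg_stop phi_cont phi_ge0 phi_le
    (filt_infty_sigma F) (filt_inftyF_sub filtF) phi_meas iK2 jump_meas jump_rate B_meas.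
have : mean P (fun w => \1_D w * gain w) <= mean P reward.
  apply: le_mean => // [|w]; first exact: integr_indicM.
  rewrite /reward !indicE; have [/set_mem Dw|_] := boolP (w \in D); last by rewrite !mul0r.
  rewrite !mul1r /gain !indicE; have [/set_mem Bw|_] := boolP (w \in B').
    by rewrite mem_set ?mul1r /phi ?le_max ?lexx ?orbT//; exact: ltW.
  by rewrite mul0r mulr_ge0// phi_ge0// sgD.
move=> h1 h2; suff : mean P reward <=
    lam * mean P (fun w => \1_D w * stopped_area t sg phi w) by lra.
apply: h2 => w Dw Bw.
have [N iN tauN] := tauD w Dw.
have TNT : Tn N w <= T by rewrite -lee_fin -tauN.
have sgN : sg w = Tn N w by rewrite /sg /capped tauN min_l.
split; first by rewrite sgN; exact: arrival_D.
move=> s s' ts; rewrite sgN => sN Ns' s'T; rewrite /jump /=.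
have s0 := le_trans t_ge0 ts.
have s'0 : 0 <= s' by rewrite (le_trans s0)// ltW// (lt_le_trans sN).
move=> e; move: Ns'; rewrite -(arrival_count_ge poissonT N w s'0) e.
by rewrite (arrival_count_ge poissonT N w s0) leNgt sN.
Qed.

Lemma mean_payoff_eq : tau = optimal_time T S Y Tn i ->
  mean P (fun w => \1_D w * payoff T xi f S Y Z t tau w) =
  mean P (fun w => \1_D w * Yc t w).
Proof.
move=> tauE.
have cases w := @optimal_time_cases _ _ _ P Tn lam T S Y T_gt0 poissonT i w.
have iNM w : D w -> (i <= (count T w).+1)%N.
  move=> /D_sub/andP[it _]; rewrite -(prednK i_ge1) ltnS.
  by rewrite (arrival_count_ge poissonT _ w T_ge0) (le_trans it).
apply/eqP; rewrite eq_le mean_payoff_le; last first.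
  move=> w Dw; rewrite tauE; have [[N [/andP[h _] _ e _]]|[e _]] := cases w.
    by exists N.
  by exists (count T w).+1 => //; exact: iNM.
rewrite mean_payoff /=.
have M_lt w : T < Tn (count T w).+1 w.
  by have /andP[] := arrival_countP poissonT w T_ge0.
have sgE w : D w -> forall N, (N <= count T w)%N ->
    tau w = (Tn N w)%:E -> sg w = Tn N w /\ B w.
  move=> Dw N; rewrite (arrival_count_ge poissonT _ w T_ge0) => NT e.
  by rewrite /sg /capped /B /= e min_l.
have := compensator_le_reward (P := P) tT sG Gm Gmono GD sgD sg_stop lam_gt0 phi_cont phi_ge0 phi_le
    (filt_infty_sigma F) (filt_inftyF_sub filtF) phi_meas iK2 jump_meas jump_rate B_meas.
(* Stopping at a candidate arrival means S >= Y, so the gain is [phi] there; [B] and [B'] then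
   differ only by an arrival exactly at [T], a null event. *)
have -> : mean P (fun w => \1_D w * gain w) = mean P reward.
  apply: eq_mean_ae; [exact: integr_meas (integr_indicM D_meas gain_integr)|
    exact: integr_meas reward_integr'|].
  apply: filterS2 YcE_I (arrival_neq_ae lam_gt0 poissonT T_gt0) => w YcI neq.
  rewrite /reward !indicE; have [/set_mem Dw|_] := boolP (w \in D); last by rewrite !mul0r.
  rewrite !mul1r /gain indicE.
  have [[N [/andP[iN NM] YS e _]]|[e _]] := cases w; rewrite -tauE in e.
    have [sgN Bw] := sgE w Dw N NM e.
    have NT : Tn N w <= T by rewrite -(arrival_count_ge poissonT _ w T_ge0).
    have NT' : Tn N w < T.
      by rewrite lt_neqAle NT andbT; apply/eqP; apply: neq; exact: leq_trans iN.
    rewrite mem_set; last by rewrite /B' /= e lte_fin.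
    rewrite mem_set// !mul1r sgN /phi max_r//.
    by rewrite (YcI _ _).1 ?subr_ge0// NT andbT (arrival_ge0 poissonT).
  rewrite memNset; last by rewrite /B' /= e lte_fin; apply/negP; rewrite -leNgt ltW.
  by rewrite memNset ?mul0r//= /B /= e lee_fin; apply/negP; rewrite -ltNge.
move=> h; suff : lam * mean P (fun w => \1_D w * stopped_area t sg phi w) <=
    mean P reward by lra.
apply: h.
  apply: aeW => w Dw Bw.
  have [[N [/andP[iN NM] YS e _]]|[e _]] := cases w; rewrite -tauE in e.
    by have [-> _] := sgE w Dw N NM e; exact: arrival_D.
  by move: Bw; rewrite /B /= e lee_fin leNgt M_lt.
apply: filterS YcE_I => w YcI Dw s s' ts ssg ss' s'T Jw.
have s0 := le_trans t_ge0 ts; have s'0 := le_trans s0 ss'.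
(* The first arrival after [s]; its index is at least [i] because arrival i - 1 is at most t <= s.
   Either it precedes the optimal time, and S < Y makes [phi] zero at it, or the optimal arrival is
   no later than it. *)
pose n := (count s w).+1.
have sn : s < Tn n w by have /andP[] := arrival_countP poissonT w s0.
have ns' : Tn n w <= s'.
  rewrite -(arrival_count_ge poissonT _ w s'0) ltn_neqAle eq_sym; apply/andP; split.
    exact/eqP.
  rewrite (arrival_count_ge poissonT _ w s'0) (le_trans _ ss')//.
  by have /andP[] := arrival_countP poissonT w s0.
have i_n : (i <= n)%N.
  rewrite -(prednK i_ge1) ltnS (arrival_count_ge poissonT _ w s0) (le_trans _ ts)//.
  by have /andP[] := D_sub Dw.
have nM : (n <= count T w)%N.
  by rewrite (arrival_count_ge poissonT _ w T_ge0) (le_trans ns').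
have nT : 0 <= Tn n w <= T by rewrite (arrival_ge0 poissonT) (le_trans ns').
have zero : S (Tn n w) w < Y (Tn n w) w ->
    exists2 r, s <= r <= s' & phi r w = 0.
  move=> SY; exists (Tn n w); first by rewrite ltW.
  by rewrite /phi (YcI _ nT).1 max_l// subr_le0 ltW.
have [[N [/andP[iN NM] YS e minN]]|[e none]] := cases w; rewrite -tauE in e; last first.
  by left; apply: zero; apply: none; rewrite i_n.
have [nN|Nn] := ltnP n N; first by left; apply: zero; apply: minN; rewrite i_n.
have [sgN Bw] := sgE w Dw N NM e.
right; split=> //; rewrite sgN (le_trans _ ns')//.
by rewrite (arrival_leE poissonT).
Qed.

End OnEvent.
End StoppingTime.
End Payoff.

(** * From means over events of [G t] back to conditional expectations *)

Theorem theorem1p2 (R : realType) (disp : measure_display)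
    (Omega : measurableType disp) (P : probability Omega R)
    (F : R -> set (set Omega)) (d : nat) (W : R -> Omega -> d.-tuple R)
    (T lambda : R) (xi : Omega -> R) (f : R -> Omega -> R -> d.-tuple R -> R)
    (S : R -> Omega -> R) (Tn : nat -> Omega -> R)
    (Y : R -> Omega -> R) (Z : R -> Omega -> d.-tuple R)
    (T_gt0 : 0 < T) (lambda_gt0 : 0 < lambda)
    (filtF : usual_filtration P F)
    (bmW : brownian_motion P F W)
    (poissonT : poisson_arrivals P Tn lambda)
    (indepFT : independent_sets P (filt_infty F)
                 (filt_infty (poisson_natural Tn)))
    (data : standing_assumption P F T xi f S)
    (solYZ : penalized_solution P F T xi f S W lambda Y Z)
    (i : nat) (i_ge1 : (1 <= i)%N) (t : R) (t_in : 0 <= t <= T) :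
  let G := big_filtration P F Tn in
  let A := [set w | Tn i.-1 w <= t < Tn i w] in
  let J tau := cond_exp P (G t) (payoff T xi f S Y Z t tau) in
  let tau_star := optimal_time T S Y Tn i in
  [/\ is_ess_sup_on P A [set J tau | tau in control_set P F T Tn i]
        (EFin \o Y t),
      control_set P F T Tn i tau_star &
      {ae P, forall w, A w -> J tau_star w = Y t w}].
Proof.
move=> G A J tau_star; have [_ _ _ _ _ _ S_cont S_adapt _] := data.
have [I [Yc [K [ito [Yc_cont Yc_adapt] [iK K_bound] YcE_I incr]]]] :=
  solution_regular bmW T_gt0 lambda_gt0 filtF data solYZ.
have YcE : {ae P, forall w s, 0 <= s <= T -> Yc s w = Y s w}.
  by apply: filterS YcE_I => w h s /h[].
have [t0 tT] := andP t_in; have T0 := ltW T_gt0.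
have star := optimal_time_control T_gt0 filtF poissonT S_cont S_adapt
  Yc_cont Yc_adapt YcE i.
have sG : sigma_algebra setT (G t) := big_filtration_sigma P F Tn t.
have GM : G t `<=` measurable := big_filtration_sub filtF poissonT t0.
have GA : G t A.
  have -> : A = arrival_count Tn t @^-1` [set i.-1].
    apply/seteqP; split=> w /=.
      move=> /andP[h1 h2]; apply/eqP; rewrite eqn_leq.
      rewrite (arrival_count_ge poissonT _ w t0) h1 andbT -ltnS (prednK i_ge1).
      by rewrite ltnNge (arrival_count_ge poissonT _ w t0) -ltNge.
    move=> e; have := arrival_countP poissonT w t0.
    by rewrite e (prednK i_ge1).
  by apply: big_filtration_natural; apply: arrival_count_natural; rewrite t0 lexx.
have Yc_G : measurable_wrt (G t) (Yc t).
  by apply: measurable_wrt_sub (Yc_adapt t t_in); exact: big_filtration_F.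
have Yct_integr : integr P (Yc t).
  apply: (integr_le _ iK); first exact: measurable_wrt_measurable GM Yc_G.
  by move=> w; have [h _] := K_bound t w t_in; rewrite (le_trans h)// ler_norm.
have iJ tau : stopping_time G tau -> integr P (payoff T xi f S Y Z t tau).
  move=> stop; exact: (payoff_integr T_gt0 filtF bmW poissonT indepFT
    S_cont S_adapt ito Yc_cont Yc_adapt iK K_bound YcE_I incr t_in stop).
have JP tau : stopping_time G tau -> [/\ measurable_wrt (G t) (J tau),
    integr P (J tau) & forall D, G t D -> mean P (fun w => \1_D w * J tau w) =
      mean P (fun w => \1_D w * payoff T xi f S Y Z t tau w)].
  move=> /iJ ip; have [_ iV mV eqV] := cond_expP sG GM ip.
  split=> // D GD; apply: EFin_inj.
  by rewrite -!integral_indicM ?eqV//; exact: GM.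
(* On [A], arrival i - 1 is at most t <= T, which gives i <= M + 1, the guard in [control_set]. *)
have control tau : control_set P F T Tn i tau -> forall w, A w ->
    exists2 N, (i <= N)%N & tau w = (Tn N w)%:E.
  move=> [_ [N _ tauN]] w /andP[it _].
  have [|/andP[iN _] e] := tauN w; last by exists (N w).
  rewrite -(prednK i_ge1) ltnS (arrival_count_ge poissonT _ w T0).
  exact: le_trans it tT.
have late tau : control_set P F T Tn i tau -> forall w, A w ->
    t <= capped T tau w <= T.
  move=> /[dup] tauC [stop _] w Aw; have [N iN e] := control tau tauC w Aw.
  have [_ ->] := andP (capped_itv T_gt0 stop w); rewrite andbT.
  have [h|h] := ltP (tau w) T%:E; last by rewrite (capped_ge h).
  rewrite -lee_fin -(capped_lt stop h) e lee_fin.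
  have [_ ti] := andP Aw; apply: le_trans (ltW ti) _.
  exact: (arrival_le poissonT).
have ub tau : control_set P F T Tn i tau -> {ae P, forall w, A w -> J tau w <= Yc t w}.
  move=> /[dup] tauC [stop _]; have [mJ iJt J_mean] := JP tau stop.
  apply: (ae_le_of_mean sG GM GA mJ Yc_G iJt Yct_integr) => D GD DA.
  rewrite J_mean//.
  apply: (mean_payoff_le T_gt0 lambda_gt0 filtF bmW poissonT indepFT
    S_cont S_adapt ito Yc_cont Yc_adapt iK K_bound YcE_I incr t_in stop GD) => //.
  - by move=> w /DA /=; apply.
  - by move=> w /DA; exact: late.
  - by move=> w /DA; exact: control.
have [stop _] := star; have [mJ iJt J_mean] := JP tau_star stop.
(* The payoff of [tau_star] has the mean of [Yc t] over every [D] inside [A], so the comparison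
   lemma also applies in this direction. *)
have lb : {ae P, forall w, A w -> Yc t w <= J tau_star w}.
  apply: (ae_le_of_mean sG GM GA Yc_G mJ Yct_integr iJt) => D GD DA.
  rewrite J_mean// -(mean_payoff_eq T_gt0 lambda_gt0 filtF bmW poissonT indepFT
    S_cont S_adapt ito Yc_cont Yc_adapt iK K_bound YcE_I incr t_in stop i_ge1 GD)//.
  by move=> w /DA; exact: late.
have eqJ : {ae P, forall w, A w -> J tau_star w = Y t w}.
  apply: filterS3 YcE lb (ub _ star) => w YcEw h1 h2 Aw.
  by apply/eqP; rewrite -YcEw// eq_le h1// h2.
split=> //; split.
- apply/measurable_EFinP; apply: measurable_wrt_measurable (Y_adapted solYZ t_in).
  exact: filt_sub filtF t t0.
- move=> _ [tau tauC <-]; apply: filterS2 YcE (ub _ tauC) => w YcEw h Aw.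
  by rewrite lee_fin -YcEw// h.
(* Since [tau_star] is admissible, an upper bound of the family is at least its value, which is
   [Y t]. *)
- move=> y' _ y'_ub; have := y'_ub _ (ex_intro2 _ _ _ star erefl).
  by apply: filterS2 eqJ => w e h Aw; rewrite /= -e// h.
Qed.
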